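(* Let $\mathcal{X}$ be a non-empty $\delta$-well spaced subset of $\mathbb{R}/\mathbb{Z}$, let $N\ge1$ and let $(u_p)_{p\le N}$ be complex numbers indexed by primes $p\le N$. Then $$\sum_{x\in\mathcal{X}}\Bigl|\sum_{p\le N}u_pe(xp)\Bigr|^2\le(4e^\gamma+o(1))\frac{N+\delta^{-1}}{\log N}\log(2|\mathcal{X}|)\sum_{p\le N}|u_p|^2,$$ where $o(1)$ is a function tending to $0$ as $N$ and $|\mathcal{X}|$ tend to infinity. When $N\ge 10^4$, the inequality holds with the constant $4e^\gamma+o(1)$ replaced by $19$. Moreover, the constant $4e^\gamma+o(1)$ cannot in general be replaced by anything smaller than $\tfrac12+o(1)$.
   Context: $e(x)=e^{2\pi i x}$, $\gamma$ is Euler's constant. A set $\mathcal{X}\subset\mathbb{R}/\mathbb{Z}$ is $\delta$-well spaced if any two distinct points of it are at distance $\ge\delta$ in $\mathbb{R}/\mathbb{Z}$ (distance to nearest integer of the difference). *)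

(* Defs.v *)
From HB Require Import structures.
From mathcomp Require Import all_boot all_order all_algebra.
From mathcomp Require Import generic_quotient ring_quotient complex finmap.
From mathcomp Require Import all_classical all_reals all_analysis.

Set Implicit Arguments.
Unset Strict Implicit.
Unset Printing Implicit Defensive.

Import Order.TTheory GRing.Theory Num.Theory.
Import numFieldNormedType.Exports.

Local Open Scope classical_set_scope.
Local Open Scope ring_scope.
Local Open Scope quotient_scope.

(* The subgroup Z of R, i.e. the predicate [Num.int]. *)
Definition integers (R : realType) : zmodClosed R :=
  GRing.ZmodClosed.clone R (@Num.int_num_subdef R) _.

(* R/Z *)
Definition circle (R : realType) : Type := Quotient.quot (integers R).
HB.instance Definition _ (R : realType) := Choice.on (circle R).
HB.instance Definition _ (R : realType) := GRing.Zmodule.on (circle R).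
HB.instance Definition _ (R : realType) :=
  ZmodQuotient.copy (circle R) (Quotient.quot (integers R)).

Definition dist_int (R : realType) (t : R) : R :=
  inf [set `|t - m%:~R| | m in [set: int]].

(* [repr] picks an arbitrary real representative; [dist_int] and [e] do not
   depend on the choice, see [dist_int_pi] and [e_pi] below. *)
Definition circle_dist (R : realType) (x y : circle R) : R :=
  dist_int (repr (x - y)).

Definition well_spaced (R : realType) (delta : R) (X : set (circle R)) : Prop :=
  forall x y, X x -> X y -> x != y -> delta <= circle_dist x y.

Definition e (R : realType) (t : R) : R[i] :=
  Complex (cos (2 * pi * t)) (sin (2 * pi * t)).

Definition euler_gamma (R : realType) : R :=
  lim (series (@harmonic R) n - ln n%:R @[n --> \oo]).

Definition exp_sum (R : realType) (N : R) (u : nat -> R[i]) (x : circle R) :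
    R[i] :=
  \sum_(p < (Num.truncn N).+1 | prime p) u p * e (repr x * p%:R).

(* For 0 < delta a delta-well spaced set is finite ([well_spaced_finite]), so
   that the sum over X is genuine and [#|` fset_set X|] is the cardinal of X. *)
Definition prime_large_sieve (R : realType) (c delta : R) (X : set (circle R))
    (N : R) (u : nat -> R[i]) : Prop :=
  \sum_(x \in X) Normc.normc (exp_sum N u x) ^+ 2
  <= c * ((N + delta^-1) / ln N) * ln (2 * #|` fset_set X|%:R)
     * \sum_(p < (Num.truncn N).+1 | prime p) Normc.normc (u p) ^+ 2.

(* The inequality holds with the constant c + o(1), where o(1) is a function of
   N and of the cardinal of X, tending to 0 as both tend to infinity. *)
Definition asymptotic_constant (R : realType) (c : R) : Prop :=
  exists o : R -> nat -> R,
    o NK.1 NK.2 @[NK --> filter_prod (+oo : set_system R) \oo] --> (0 : R)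
    /\ forall (delta : R) (X : set (circle R)) (N : R) (u : nat -> R[i]),
         0 < delta -> well_spaced delta X -> X !=set0 -> 1 <= N ->
         prime_large_sieve (c + o N #|` fset_set X|) delta X N u.

Lemma piZ (R : realType) (s t : R) :
  (\pi_(circle R) s == \pi_(circle R) t) = (s - t \is a Num.int).
Proof. exact/esym/(Quotient.idealrBE (integers R)). Qed.

Lemma pi_circleB (R : realType) (s t : R) :
  \pi_(circle R) (s - t) = \pi_(circle R) s - \pi_(circle R) t.
Proof.
rewrite (pi_addr (s := Quotient.quot (integers R))).
by rewrite (pi_oppr (s := Quotient.quot (integers R))).
Qed.

Lemma dist_int_le (R : realType) (t : R) (m : int) :
  dist_int t <= `|t - m%:~R|.
Proof.
apply: ge_inf; last by exists m.
by exists 0 => _ [k _ <-].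
Qed.

Lemma dist_intDz (R : realType) (t : R) (m : int) :
  dist_int (t + m%:~R) = dist_int t.
Proof.
rewrite /dist_int; congr inf; apply/seteqP; split=> _ [k _ <-] /=.
  by exists (k - m) => //; rewrite rmorphB/= opprB addrA addrAC.
by exists (k + m) => //; rewrite rmorphD/= opprD addrACA subrr addr0.
Qed.

Lemma repr_piE (R : realType) (t : R) :
  exists m : int, repr (\pi_(circle R) t) = t + m%:~R.
Proof.
have : repr (\pi_(circle R) t) - t \is a Num.int by rewrite -piZ reprK.
by case/intrP => m tm; exists m; rewrite -tm addrC subrK.
Qed.

Lemma dist_int_pi (R : realType) (t : R) :
  dist_int (repr (\pi_(circle R) t)) = dist_int t.
Proof. by have [m ->] := repr_piE t; rewrite dist_intDz. Qed.

Lemma eDz (R : realType) (t : R) (m : int) : e (t + m%:~R) = e t.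
Proof.
wlog: t m / exists k : nat, m = k%:Z.
  move=> H; case: m => k; first by apply: H; exists k.
  by rewrite NegzE -(H (t + _) (Posz k.+1)) ?rmorphN/= ?subrK//; exists k.+1.
move=> [k ->]; rewrite /e -pmulrn.
have -> : 2 * pi * (t + k%:R) = 2 * pi * t + (pi *+ 2) *+ k.
  by rewrite mulrDr mulr_natr [2 * pi]mulr_natl.
by rewrite (periodicn (@cosD2pi R)) (periodicn (@sinD2pi R)).
Qed.

Lemma e_pi (R : realType) (t : R) (p : nat) :
  e (repr (\pi_(circle R) t) * p%:R) = e (t * p%:R).
Proof.
have [m ->] := repr_piE t.
by rewrite mulrDl -[p%:R]/((p%:Z)%:~R) -[in LHS]intrM eDz.
Qed.

Lemma well_spaced_finite (R : realType) (delta : R) (X : set (circle R)) :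
  0 < delta -> well_spaced delta X -> finite_set X.
Proof.
move=> d0 wX.
pose M := (Num.truncn delta^-1).+1.
have M0 : 0 < M%:R :> R by rewrite ltr0n.
have dM : M%:R^-1 < delta.
  by rewrite invf_plt ?posrE// truncnS_gt.
pose f (x : circle R) := repr x - (Num.floor (repr x))%:~R.
have f0 x : 0 <= f x by rewrite subr_ge0 floor_le.
have f1 x : f x < 1.
  by rewrite ltrBlDl -[X in _ + X]/(1%:~R) -intrD floorD1_gt.
pose g x := Num.truncn (f x * M%:R).
have gM x : (g x < M)%N.
  by rewrite truncn_lt_nat ?mulr_ge0// ?gtr_pMl// ltW.
have gI : {in X &, injective g}.
  move=> x y; rewrite !inE => Xx Xy gxy; apply/eqP/negPn/negP => xy.
  have := wX _ _ Xx Xy xy; apply/negP; rewrite -ltNge.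
  apply: le_lt_trans dM.
  have -> : circle_dist x y = dist_int (repr x - repr y).
    by rewrite /circle_dist -[RHS]dist_int_pi pi_circleB !reprK.
  apply: le_trans (dist_int_le _ (Num.floor (repr x) - Num.floor (repr y))) _.
  have -> : repr x - repr y - (Num.floor (repr x) - Num.floor (repr y))%:~R
            = f x - f y.
    by rewrite rmorphB/= /f !opprB [_ - (Num.floor (repr x))%:~R]addrC
      [in LHS]addrACA [- repr y + _]addrC.
  have Hx : 0 <= f x * M%:R by rewrite mulr_ge0.
  have Hy : 0 <= f y * M%:R by rewrite mulr_ge0.
  rewrite -[leRHS]mul1r ler_pdivlMr//.
  rewrite -[X in _ * X](ger0_norm (ltW M0)) -normrM mulrBl.
  have /andP[a b] := truncn_itv Hx; have /andP[c d] := truncn_itv Hy.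
  rewrite -/(g x) in a b; rewrite -/(g y) -gxy in c d.
  move: b d; rewrite -natr1 => b d.
  rewrite ler_norml; apply/andP; split.
    rewrite lerBrDr addrC lerBlDr; apply: le_trans (ltW d) _.
    by rewrite lerD2r.
  rewrite lerBlDr addrC; apply: le_trans (ltW b) _.
  by rewrite lerD2r.
have : finite_set (g @` X).
  by apply: sub_finite_set (finite_II M) => _ [x _ <-] /=; exact: gM.
by rewrite (eq_finite_set (inj_card_eq gI)).
Qed.

(* Main.v *)
(* Upper bounds. By duality one has to bound the sum over primes Q < p <= N of
   |sum_x c_x e(xp)|^2. For such p the sum of (mu(d) / phi(d)) e(pa/d) over the
   reduced fractions a/d with d <= Q free of prime factors <= z does not depend on
   p: it equals G = sum_d mu(d)^2 / phi(d). Multiplying by G replaces the points x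
   by the points x + a/d, after which the sum can be extended to all integers
   n <= N and becomes a quadratic form in a smoothed Dirichlet kernel. The pairs
   with the same a/d contribute about G (N + 1/delta), because X is well spaced.
   The difference of two distinct a/d has a non-trivial denominator free of primes
   <= z, so that these pairs are negligible once z is a large multiple of |X|.
   Finally G >= log Q * prod_(p <= z) (1 - 1/p), and the inverse of this product is
   at most 2.16 log z. A power of N for Q and a multiple of |X| for z give 19, and
   a constant below 6.97 < 4 e^gamma when N and |X| are large. If log |X| exceeds a
   fixed multiple of log N, the large sieve over all integers is enough, and if |X|
   is small, so are the Cauchy-Schwarz inequality and Chebyshev's bound.

   Lower bound. Let X be the set of all fractions with squarefree denominator at
   most Q, and u the indicator of the primes in (Q, N], S being the exponential sum.
   The identity above (with z = 1) gives G S(0) = sum (mu(d) / phi(d)) S(a/d), hence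
   sum_X |S|^2 >= G S(0)^2, where G >= log Q and |X| <= Q^2. It remains to let N
   tend to infinity along integers with pi(N) >= (1 - eps) N / log N, and then Q. *)

Require Import Defs.
From Stdlib Require NArith.
From mathcomp Require Import all_boot all_order all_algebra.
From mathcomp Require Import generic_quotient finmap complex.
From mathcomp Require Import all_classical all_reals all_analysis.
From mathcomp Require Import ring lra zify.

Import Order.TTheory GRing.Theory Num.Theory.
Import numFieldNormedType.Exports.

Set Implicit Arguments.
Unset Strict Implicit.
Unset Printing Implicit Defensive.

Local Open Scope classical_set_scope.
Local Open Scope ring_scope.
Local Open Scope quotient_scope.

(** * Rough denominators and their frequencies *)

Lemma sum_family_by_support (A : comPzSemiRingType) (T W : finType) (w0 : W)
    (F : T -> pred W) (B : pred T) (P : pred {ffun T -> bool})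
    (f : T -> W -> A) :
  \sum_(g in family F | P [ffun p => B p && (g p != w0)]) \prod_p f p (g p)
  = \sum_(D : {ffun T -> bool} | P D && [forall p, D p ==> B p])
      \prod_p \sum_(a | F p a && (B p ==> ((a != w0) == D p))) f p a.
Proof.
rewrite (partition_big (fun g : {ffun T -> W} => [ffun p => B p && (g p != w0)])
  (fun D => P D && [forall p, D p ==> B p])) /=; last first.
  move=> g /andP[_ ->] /=; apply/forallP => p; apply/implyP.
  by rewrite ffunE => /andP[->].
apply: eq_bigr => D /andP[PD /forallP DB].
rewrite bigA_distr_big_dep; apply: eq_bigl => g; apply/idP/idP.
  case/andP=> /andP[/familyP Fg _] /eqP/ffunP gD; apply/familyP => p.
  rewrite unfold_in /=; have := gD p; rewrite ffunE => <-.
  by have := Fg p; rewrite unfold_in => ->; case: (B p) => /=; rewrite ?eqxx.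
move=> /familyP Fg.
have E : [ffun p => B p && (g p != w0)] = D.
  apply/ffunP => p; rewrite ffunE; have := Fg p; rewrite unfold_in => /andP[_].
  case: (boolP (B p)) => [_ /= /eqP //|nB _ /=]; have := DB p.
  by rewrite (negbTE nB) implybF => /negbTE ->.
rewrite E PD eqxx !andbT; apply/familyP => p; have := Fg p.
by rewrite !unfold_in => /andP[].
Qed.

Definition rough (z p : nat) : bool := prime p && (z < p)%N.

Definition residues (z Q : nat) (p : 'I_Q.+1) : pred 'I_Q.+1 :=
  fun a => if rough z p then (a < p)%N else a == ord0.

(* A frequency [g] encodes the fraction [sum_p g p / p]: by the Chinese remainder
   theorem these are the fractions with squarefree denominator [den g], in lowest
   terms when [g p < p]. *)
Definition freq (Q : nat) : finType := {ffun 'I_Q.+1 -> 'I_Q.+1}.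

Definition supp (Q : nat) (g : freq Q) : {ffun 'I_Q.+1 -> bool} :=
  [ffun p => g p != ord0].

Definition prodS (Q : nat) (D : {ffun 'I_Q.+1 -> bool}) : nat :=
  (\prod_p (if D p then p : nat else 1))%N.

Definition den (Q : nat) (g : freq Q) : nat := prodS (supp g).

Definition level (z Q : nat) : pred (freq Q) :=
  fun g => (g \in family (@residues z Q)) && (den g <= Q)%N.

Definition levelS (z Q : nat) : pred {ffun 'I_Q.+1 -> bool} :=
  fun D => (prodS D <= Q)%N && [forall p : 'I_Q.+1, D p ==> rough z p].

Lemma rough_gt0 z p : rough z p -> (0 < p)%N.
Proof. by case/andP=> /prime_gt0. Qed.

Lemma rough_gt1 z p : rough z p -> (1 < p)%N.
Proof. by case/andP=> /prime_gt1. Qed.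

Lemma residues_supp z Q (g : freq Q) p :
  g \in family (@residues z Q) -> g p != ord0 -> rough z p && (g p < p)%N.
Proof.
move=> /familyP/(_ p); rewrite unfold_in /residues.
by case: ifP => // _ ->.
Qed.

Lemma supp_rough z Q (g : freq Q) : g \in family (@residues z Q) ->
  [ffun p : 'I_Q.+1 => rough z p && (g p != ord0)] = supp g.
Proof.
move=> Fg; apply/ffunP => p; rewrite !ffunE; case: (eqVneq (g p) ord0) => /=.
  by rewrite andbF.
by move=> /(residues_supp Fg)/andP[->].
Qed.

Lemma sum_level (A : comPzSemiRingType) (z Q : nat)
    (f : 'I_Q.+1 -> 'I_Q.+1 -> A) : (forall p, f p ord0 = 1) ->
  \sum_(g | level z g) \prod_p f p (g p)
  = \sum_(D | levelS z D)
      \prod_(p | D p) \sum_(a : 'I_Q.+1 | (a != ord0) && (a < p)%N) f p a.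
Proof.
move=> f0.
rewrite (eq_bigl (fun g : freq Q => (g \in family (@residues z Q)) &&
    (prodS [ffun p : 'I_Q.+1 => rough z p && (g p != ord0)] <= Q)%N)); last first.
  move=> g; rewrite /level; case: (boolP (g \in _)) => //= Fg.
  by rewrite supp_rough.
rewrite (sum_family_by_support ord0 (@residues z Q) (fun p : 'I_Q.+1 => rough z p)
  (fun D => (prodS D <= Q)%N)); apply: eq_bigr => D /andP[_ /forallP DB].
rewrite [RHS]big_mkcond; apply: eq_bigr => p _; rewrite /residues.
have := DB p; case: (boolP (rough z p)) => [rp _|_]; last first.
  by rewrite implybF => /negbTE ->; under eq_bigl do rewrite andbT;
    rewrite big_pred1_eq.
case: (D p) => /=; first by apply: eq_bigl => a; rewrite andbC; case: (a != _).
rewrite -(f0 p); apply: big_pred1 => a; rewrite /= eqbF_neg negbK.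
by case: eqP => [->|_]; rewrite ?andbF// (rough_gt0 rp).
Qed.

(** * Exponential sums *)

Section Exponential.
Variable R : realType.
Implicit Types s t : R.
Local Notation normc := (@Normc.normc R).

Lemma e0 : e (0 : R) = 1.
Proof. by rewrite /e mulr0 cos0 sin0. Qed.

Lemma eD s t : e (s + t) = e s * e t.
Proof.
rewrite /e mulrDr cosD sinD; apply/eqP; rewrite eq_complex /=; apply/andP.
by split; apply/eqP; ring.
Qed.

Lemma e_sum (I : finType) (t : I -> R) : e (\sum_i t i) = \prod_i e (t i).
Proof. exact: (big_morph _ eD e0). Qed.

Lemma e_natM (n : nat) t : e (n%:R * t) = e t ^+ n.
Proof.
elim: n => [|n IH]; first by rewrite mul0r e0 expr0.
by rewrite -natr1 mulrDl mul1r eD IH exprSr.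
Qed.

Lemma normcE (x : R[i]) : normc x = Num.sqrt (complex.Re x ^+ 2 + complex.Im x ^+ 2).
Proof. by case: x. Qed.

Lemma normc_ge0 (x : R[i]) : 0 <= normc x.
Proof. by rewrite normcE sqrtr_ge0. Qed.

Lemma sqr_normc (x : R[i]) : normc x ^+ 2 = complex.Re x ^+ 2 + complex.Im x ^+ 2.
Proof. by rewrite normcE sqr_sqrtr// addr_ge0// sqr_ge0. Qed.

Lemma sqr_normc_conj (x : R[i]) : ((normc x ^+ 2)%:C)%C = x * (x^*)%C.
Proof.
rewrite sqr_normc; case: x => a b /=; apply/eqP; rewrite eq_complex /=.
by apply/andP; split; apply/eqP; ring.
Qed.

Lemma normc_conj (x : R[i]) : normc (x^*)%C = normc x.
Proof. by case: x => a b; rewrite !normcE /= sqrrN. Qed.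

Lemma normc_e t : normc (e t) = 1.
Proof. by rewrite normcE /= cos2Dsin2 sqrtr1. Qed.

Lemma conj_e t : ((e t)^*)%C = e (- t).
Proof. by rewrite /e mulrN cosN sinN. Qed.

Lemma normc_real t : normc (t%:C)%C = `|t|.
Proof. by rewrite normcE /= expr0n addr0 sqrtr_sqr. Qed.

Lemma normc_e_sub1 t : normc (e t - 1) = 2 * `|sin (pi * t)|.
Proof.
apply/eqP; rewrite -(@eqrXn2 _ 2)// ?normc_ge0 ?mulr_ge0//.
rewrite sqr_normc exprMn real_normK ?num_real//.
have -> : e t = e (2^-1 * t) * e (2^-1 * t) by rewrite -eD; congr e; lra.
rewrite /e /=; have -> : 2 * pi * (2^-1 * t) = pi * t by lra.
have h := cos2Dsin2 (pi * t).
move: (cos (pi * t)) (sin (pi * t)) h => c s h.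
have -> : c * c - s * s - 1 = - 2 * s ^+ 2 by lra.
apply/eqP; rewrite subr0; transitivity (2 ^+ 2 * s ^+ 2 * (c ^+ 2 + s ^+ 2)).
  by ring.
by rewrite h mulr1.
Qed.

Lemma normc_sum (I : Type) (r : seq I) (P : pred I) (F : I -> R[i]) :
  normc (\sum_(i <- r | P i) F i) <= \sum_(i <- r | P i) normc (F i).
Proof.
elim/big_ind2: _ => [|x1 x2 y1 y2 h1 h2|//]; first by rewrite Normc.normc0.
by apply: le_trans (le_normcD _ _) _; exact: lerD.
Qed.

End Exponential.

Section Frequencies.
Variable R : realType.
Variables z Q : nat.
Local Notation freq := (freq Q).

(* [wt g = 1 / phi(d)], [sgnwt g = mu(d) / phi(d)] and [Gsum] is the sum of
   [mu(d)^2 / phi(d)] over [d <= Q] free of primes [<= z], where [d = den g]. *)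
Definition wt (g : freq) : R := \prod_p (if g p == ord0 then 1 else (p.-1)%:R^-1).

Definition sgnwt (g : freq) : R :=
  \prod_p (if g p == ord0 then 1 else - (p.-1)%:R^-1).

Definition ang (g : freq) : R := \sum_p (g p)%:R / p%:R.

Definition Gsum : R := \sum_(g | level z g) wt g ^+ 2.

Lemma card_nonzero_below (p : 'I_Q.+1) :
  #|[pred a : 'I_Q.+1 | (a != ord0) && (a < p)%N]| = p.-1.
Proof.
rewrite -[RHS]card_ord.
have h (k : 'I_p.-1) : (k.+1 < Q.+1)%N by have := ltn_ord k; have := ltn_ord p; lia.
pose f k := Ordinal (h k).
have fI : injective f by move=> k l /(congr1 val) /= [] /val_inj.
rewrite -(card_codom fI); apply: eq_card => a; rewrite !inE.
apply/andP/codomP => [[a0 ap]|[k ->]].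
  have a0' : (0 < a)%N by rewrite lt0n; apply: contraNneq a0 => a0; apply/eqP/val_inj.
  have hk : (a.-1 < p.-1)%N by lia.
  by exists (Ordinal hk); apply: val_inj; rewrite /= prednK.
by split=> //=; have := ltn_ord k; lia.
Qed.

Lemma Gsum_levelS :
  Gsum = \sum_(D | levelS z D) \prod_(p : 'I_Q.+1 | D p) (p.-1)%:R^-1.
Proof.
pose f (p a : 'I_Q.+1) : R := (if a == ord0 then 1 else (p.-1)%:R^-1) ^+ 2.
transitivity (\sum_(g | level z g) \prod_p f p (g p)).
  by apply: eq_bigr => g _; rewrite /f prodrXl.
rewrite sum_level; last by move=> p; rewrite /f eqxx expr1n.
apply: eq_bigr => D /andP[_ /forallP DB]; apply: eq_bigr => p Dp.
have rp : rough z p by have := DB p; rewrite Dp.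
rewrite (eq_bigr (fun=> ((p.-1)%:R^-1) ^+ 2)); last first.
  by move=> a /andP[/negbTE a0 _]; rewrite /f a0.
rewrite sumr_const card_nonzero_below -mulr_natr; field.
by rewrite pnatr_eq0; have := rough_gt1 rp; lia.
Qed.

Lemma sum_e_prime (p n : nat) : prime p -> ~~ (p %| n)%N ->
  \sum_(a < p) e (n%:R * (a%:R / p%:R)) = 0 :> R[i].
Proof.
move=> pp pn; have p0 : p%:R != 0 :> R by rewrite pnatr_eq0 -lt0n prime_gt0.
pose w : R[i] := e (n%:R / p%:R).
have E : (w - 1) * (\sum_(a < p) e (n%:R * (a%:R / p%:R))) = 0.
  have -> : \sum_(a < p) e (n%:R * (a%:R / p%:R : R)) = \sum_(a < p) w ^+ a.
    by apply: eq_bigr => a _; rewrite /w -e_natM; congr e; ring.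
  rewrite -subrX1 /w -e_natM mulrCA divff// mulr1.
  by rewrite -[n%:R]add0r -[n%:R]/((n%:Z)%:~R) eDz e0 subrr.
move/eqP: E; rewrite mulf_eq0 => /orP[/eqP w1|/eqP //]; exfalso.
have := divn_eq n p; set q := (n %/ p)%N; set r := (n %% p)%N => nE.
have r0 : (0 < r)%N by rewrite lt0n.
have rp : (r < p)%N by rewrite ltn_mod prime_gt0.
have wE : w = e (r%:R / p%:R : R).
  rewrite /w -(eDz (r%:R / p%:R) q%:Z); congr e.
  by rewrite nE natrD natrM -pmulrn; field.
have := normc_e_sub1 (r%:R / p%:R : R); rewrite -wE w1 Normc.normc0 => /esym/eqP.
rewrite mulf_eq0 pnatr_eq0 /= normr_eq0; apply/negP; rewrite gt_eqF// sin_gt0_pi//.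
have p0' : 0 < p%:R :> R by rewrite ltr0n prime_gt0.
rewrite mulr_gt0 ?pi_gt0 ?divr_gt0 ?ltr0n//=.
rewrite -[ltRHS]mulr1 ltr_pM2l ?pi_gt0//.
rewrite ltr_pdivrMr// mul1r ltr_nat.
all: by rewrite ?prime_gt0.
Qed.

(* The sum factors over the rough primes [p], each [p] not dividing [n] giving the
   factor [1 + (-1)/(p - 1) * (-1)]. *)
Lemma sum_sgnwt_e (n : nat) : (forall p, (p <= Q)%N -> rough z p -> ~~ (p %| n)%N) ->
  \sum_(g | level z g) ((sgnwt g)%:C)%C * e (n%:R * ang g) = (Gsum%:C)%C.
Proof.
move=> ndiv.
pose f (p a : 'I_Q.+1) : R[i] := ((if a == ord0 then 1 else - (p.-1)%:R^-1 : R)%:C)%C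
   * e (n%:R * (a%:R / p%:R)).
transitivity (\sum_(g | level z g) \prod_p f p (g p)).
  apply: eq_bigr => g _; rewrite /f big_split /= rmorph_prod; congr (_ * _).
  by rewrite -e_sum mulr_sumr.
rewrite sum_level; last by move=> p; rewrite /f eqxx mul0r mulr0 e0 mulr1.
rewrite Gsum_levelS rmorph_sum /=; apply: eq_bigr => D /andP[_ /forallP DB].
rewrite rmorph_prod /=; apply: eq_bigr => p Dp.
have rp : rough z p by have := DB p; rewrite Dp.
have pQ : (p <= Q)%N by rewrite -ltnS.
rewrite (eq_bigr (fun a : 'I_Q.+1 => (((- (p.-1)%:R^-1 : R)%:C)%C) *
    e (n%:R * (a%:R / p%:R : R)))); last first.
  by move=> a /andP[/negbTE a0 _]; rewrite /f a0.
rewrite -mulr_sumr.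
have pp : prime p by case/andP: rp.
have := sum_e_prime pp (ndiv _ pQ rp).
rewrite (big_ord_widen Q.+1 (fun a => e (n%:R * (a%:R / p%:R : R)))); last first.
  by rewrite ltnW.
rewrite (bigD1 ord0) /=; last exact: prime_gt0.
rewrite mul0r mulr0 e0 => /eqP; rewrite addrC addr_eq0 => /eqP E.
rewrite (eq_bigl (fun a : 'I_Q.+1 => (a < p)%N && (a != ord0))) ?E; last first.
  by move=> a; rewrite andbC.
by rewrite mulrN1 -rmorphN opprK.
Qed.

End Frequencies.

Lemma ler_sum_inj (R : realDomainType) (I J : finType) (P : pred I) (P' : pred J)
    (phi : I -> J) (F : J -> R) :
  {in P &, injective phi} -> (forall i, P i -> P' (phi i)) ->
  (forall j, P' j -> 0 <= F j) ->
  \sum_(i | P i) F (phi i) <= \sum_(j | P' j) F j.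
Proof.
move=> phiI PP' F0; rewrite (partition_big phi P') //=.
apply: ler_sum => j P'j.
case: (pickP (fun i => P i && (phi i == j))) => [i /andP[Pi /eqP ij]|no].
  rewrite (big_pred1 i) ?ij// => k; apply/andP/eqP => [[Pk /eqP kj]|->].
    by apply: phiI; rewrite // kj ij.
  by split=> //; apply/eqP.
by rewrite big_pred0// F0.
Qed.

Section Differences.
Variable R : realType.
Variables z Q : nat.
Local Notation freq := (freq Q).
Local Notation fam := (family (@residues z Q)).

Definition subres (p a b : 'I_Q.+1) : 'I_Q.+1 :=
  if rough z p then inord (if (b <= a)%N then a - b else a + p - b)%N else ord0.

Definition subfreq (f g : freq) : freq := [ffun p => subres p (f p) (g p)].

Lemma val_subres (p a b : 'I_Q.+1) : rough z p -> (a < p)%N -> (b < p)%N ->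
  subres p a b = (if (b <= a)%N then a - b else a + p - b)%N :> nat.
Proof.
move=> rp ap bp; rewrite /subres rp inordK//.
by have pQ := ltn_ord p; case: (leqP b a); lia.
Qed.

Lemma subres_eq0 (p a b : 'I_Q.+1) : rough z p -> (a < p)%N -> (b < p)%N ->
  (subres p a b == ord0) = (a == b).
Proof.
move=> rp ap bp; rewrite -!val_eqE /= val_subres//; case: leqP; lia.
Qed.

Lemma subres0 (p a : 'I_Q.+1) : rough z p -> (a < p)%N -> subres p a ord0 = a.
Proof.
move=> rp ap; apply: val_inj; rewrite /= val_subres ?(rough_gt0 rp)//=.
by rewrite subn0.
Qed.

Lemma subres_invol (p a b : 'I_Q.+1) : rough z p -> (a < p)%N -> (b < p)%N ->
  subres p a (subres p a b) = b.
Proof.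
move=> rp ap bp; apply: val_inj; rewrite /= val_subres//.
  by rewrite val_subres//; case: (leqP b a) => h; case: leqP; lia.
by rewrite val_subres//; case: (leqP b a); lia.
Qed.

Lemma fam_rough (g : freq) (p : 'I_Q.+1) : g \in fam -> rough z p -> (g p < p)%N.
Proof. by move=> /familyP/(_ p); rewrite unfold_in /residues => + rp; rewrite rp. Qed.

Lemma fam_nonrough (g : freq) (p : 'I_Q.+1) : g \in fam -> ~~ rough z p -> g p = ord0.
Proof.
move=> /familyP/(_ p); rewrite unfold_in /residues => + rp.
by rewrite (negbTE rp) => /eqP.
Qed.

Lemma subfreq_fam (f g : freq) : f \in fam -> g \in fam -> subfreq f g \in fam.
Proof.
move=> Ff Fg; apply/familyP => p; rewrite unfold_in /residues ffunE.
case: ifP => [rp|rp]; last by rewrite /subres rp.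
have := fam_rough Ff rp; have := fam_rough Fg rp => a b.
by rewrite val_subres//; case: (leqP (g p) (f p)); lia.
Qed.

Lemma subfreq_invol (f g : freq) : f \in fam -> g \in fam ->
  subfreq f (subfreq f g) = g.
Proof.
move=> Ff Fg; apply/ffunP => p; rewrite !ffunE.
case: (boolP (rough z p)) => [rp|rp].
  by rewrite subres_invol// fam_rough.
by rewrite /subres (negbTE rp) fam_nonrough.
Qed.

Definition freq0 : freq := [ffun=> ord0].

Lemma subfreq_eq0 (f g : freq) : f \in fam -> g \in fam ->
  (subfreq f g == freq0) = (f == g).
Proof.
move=> Ff Fg; apply/eqP/eqP => [/ffunP h|->]; apply/ffunP => p.
  have := h p; rewrite !ffunE => /eqP; case: (boolP (rough z p)) => [rp|rp].
    by rewrite subres_eq0 ?fam_rough// => /eqP.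
  by rewrite !fam_nonrough.
rewrite !ffunE; apply/eqP; case: (boolP (rough z p)) => [rp|rp].
  by rewrite subres_eq0 ?fam_rough.
by rewrite /subres (negbTE rp).
Qed.

Lemma ang_subfreq (f g : freq) : f \in fam -> g \in fam ->
  exists m : int, ang R f - ang R g = ang R (subfreq f g) + m%:~R.
Proof.
move=> Ff Fg; exists (\sum_(p < Q.+1) (if rough z p && (f p < g p)%N then -1 else 0)).
rewrite /ang -sumrB rmorph_sum -big_split /=; apply: eq_bigr => p _.
rewrite ffunE; case: (boolP (rough z p)) => [rp|rp] /=; last first.
  by rewrite /subres (negbTE rp) !fam_nonrough//= !mul0r subrr addr0.
have p0 : p%:R != 0 :> R by rewrite pnatr_eq0 -lt0n (rough_gt0 rp).
have a := fam_rough Ff rp; have b := fam_rough Fg rp.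
rewrite val_subres//; case: (leqP (g p) (f p)) => h /=; rewrite ?rmorphN1 ?addr0.
  by rewrite natrB// mulrBl.
rewrite natrB ?natrD; first by field. by rewrite (leq_trans (ltnW b)) ?leq_addl.
Qed.

Lemma prodS_mul_le (D D1 D2 : {ffun 'I_Q.+1 -> bool}) :
  (forall p, D p -> D1 p || D2 p) -> (forall p : 'I_Q.+1, D1 p || D2 p -> (0 < p)%N) ->
  (prodS D <= prodS D1 * prodS D2)%N.
Proof.
move=> sub pos; rewrite /prodS -big_split /=; apply: leq_prod => p _.
have := sub p; have := pos p; case: (D p); case: (D1 p); case: (D2 p) => //= h h'.
all: have := isT; move: h h'; rewrite ?muln1 ?mul1n//; try (move=> /(_ isT)); nia.
Qed.

Lemma supp_gt0 (g : freq) (p : 'I_Q.+1) : g \in fam -> supp g p -> (0 < p)%N.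
Proof.
by move=> Fg; rewrite ffunE => /(residues_supp Fg)/andP[/rough_gt0].
Qed.

Lemma den_subfreq (f g : freq) : f \in fam -> g \in fam ->
  (den (subfreq f g) <= den f * den g)%N.
Proof.
move=> Ff Fg; apply: prodS_mul_le => p; last first.
  by case/orP; exact: supp_gt0.
rewrite !ffunE; case: (boolP (rough z p)) => [rp|rp]; last first.
  by rewrite /subres (negbTE rp).
rewrite subres_eq0 ?fam_rough//; apply: contraR.
by rewrite negb_or !negbK => /andP[/eqP-> /eqP->].
Qed.

Lemma den_gt0 (g : freq) : g \in fam -> (0 < den g)%N.
Proof.
by move=> Fg; rewrite prodn_cond_gt0// => p _; case: ifP => // /(supp_gt0 Fg).
Qed.

End Differences.

(** * Correlations and spacing of frequencies *)

Section Correlation.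
Variable R : realType.
Variables z Q : nat.
Local Notation freq := (freq Q).
Local Notation fam := (family (@residues z Q)).

(* Bounds the normalised autocorrelation of the weights [wt] at the shift [g]. *)
Definition hwt (g : freq) : R := \prod_p (if g p == ord0 then 1 else 3 / (p.-1)%:R).

Definition locwt (p a : 'I_Q.+1) : R := if a == ord0 then 1 else (p.-1)%:R^-1.

Lemma locwt_ge0 p a : 0 <= locwt p a.
Proof. by rewrite /locwt; case: ifP. Qed.

Lemma wt_ge0 (g : freq) : 0 <= wt R g.
Proof. by apply: prodr_ge0 => p _; case: ifP. Qed.

Lemma hwt_ge0 (g : freq) : 0 <= hwt g.
Proof. by apply: prodr_ge0 => p _; case: ifP => // _; rewrite divr_ge0. Qed.

Lemma Gsum_ge0 : 0 <= Gsum R z Q.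
Proof. by apply: sumr_ge0 => g _; exact: sqr_ge0. Qed.

Lemma sum_below_const (p : 'I_Q.+1) (x : R) :
  \sum_(a : 'I_Q.+1 | (a != ord0) && (a < p)%N) x = x * (p.-1)%:R.
Proof. by rewrite sumr_const card_nonzero_below mulr_natr. Qed.

Lemma local_correlation (p b : 'I_Q.+1) : rough z p -> (b < p)%N -> b != ord0 ->
  \sum_(a : 'I_Q.+1 | (a < p)%N) locwt p a * locwt p (subres z p a b)
  <= 3 / (p.-1)%:R.
Proof.
move=> rp bp b0; have p1 : 0 < (p.-1)%:R :> R by rewrite ltr0n; have := rough_gt1 rp; lia.
have w0 : 0 <= (p.-1)%:R^-1 :> R by rewrite invr_ge0 ltW.
pose F (a : 'I_Q.+1) : R := (if a == ord0 then (p.-1)%:R^-1 else 0) +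
  ((if a == b then (p.-1)%:R^-1 else 0) + (if a != ord0 then (p.-1)%:R^-1 ^+ 2 else 0)).
apply: (@le_trans _ _ (\sum_(a : 'I_Q.+1 | (a < p)%N) F a)).
  apply: ler_sum => a ap; rewrite /F /locwt subres_eq0//.
  case: (eqVneq a ord0) => [->|a0] /=.
    by rewrite eq_sym (negbTE b0) mul1r !addr0.
  case: (eqVneq a b) => [ab|ab]; first by rewrite mulr1 add0r lerDl exprn_ge0.
  by rewrite !add0r expr2.
rewrite big_split /= big_split /= -!big_mkcondr /=.
rewrite (big_pred1 ord0); last first.
  by move=> a; rewrite /=; case: eqP => [->|]; rewrite ?andbF ?andbT// (rough_gt0 rp).
rewrite (big_pred1 b); last first.
  by move=> a; rewrite /=; case: eqP => [->|]; rewrite ?andbF ?andbT.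
under eq_bigl do rewrite andbC.
rewrite sum_below_const.
rewrite (_ : _ + _ = 3 / (p.-1)%:R)//; field.
by rewrite gt_eqF.
Qed.

Lemma prodS_le (D D' : {ffun 'I_Q.+1 -> bool}) :
  (forall p, D p -> D' p) -> (forall p : 'I_Q.+1, D' p -> (0 < p)%N) ->
  (prodS D <= prodS D')%N.
Proof.
move=> sub pos; apply: leq_prod => p _; case: (boolP (D p)) => [/sub->//|_].
by case: ifP => // /pos.
Qed.

Lemma wt_correlation (g : freq) : g \in fam ->
  \sum_(f | level z f) wt R f * wt R (subfreq z f g) <= Gsum R z Q * hwt g.
Proof.
move=> Fg.
pose f0 (p a : 'I_Q.+1) : R := locwt p a * locwt p (subres z p a (g p)).
pose B (p : 'I_Q.+1) := rough z p && (g p == ord0).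
have f00 p a : 0 <= f0 p a by rewrite mulr_ge0// locwt_ge0.
apply: (@le_trans _ _ (\sum_(f in fam |
    (prodS [ffun p => B p && (f p != ord0)] <= Q)%N) \prod_p f0 p (f p))).
  rewrite (eq_bigr (fun f : freq => \prod_p f0 p (f p))); last first.
    move=> f _; rewrite /wt -big_split /=; apply: eq_bigr => p _.
    by rewrite /f0 /locwt ffunE.
  rewrite [leRHS](bigID (fun f : freq => level z f)) /= -[leLHS]addr0 lerD//.
    rewrite le_eqVlt; apply/orP; left; apply/eqP; apply: eq_bigl => f.
    case: (boolP (level z f)) => [/andP[Ff df]|]; rewrite ?andbF ?andbT//= Ff /=.
    apply/esym; apply: leq_trans df; apply: prodS_le => p; last exact: supp_gt0 Ff.
    by rewrite !ffunE => /andP[].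
  by apply: sumr_ge0 => f _; exact: prodr_ge0.
rewrite (sum_family_by_support ord0 (@residues z Q) B (fun D => (prodS D <= Q)%N)).
rewrite Gsum_levelS mulr_suml.
have h0 (D : {ffun 'I_Q.+1 -> bool}) :
    0 <= (\prod_(p : 'I_Q.+1 | D p) (p.-1)%:R^-1) * hwt g.
  by rewrite mulr_ge0 ?hwt_ge0// prodr_ge0.
pose lS (D : {ffun 'I_Q.+1 -> bool}) :=
  (prodS D <= Q)%N && [forall p, D p ==> B p].
apply: (@le_trans _ _ (\sum_(D | lS D)
    (\prod_(p : 'I_Q.+1 | D p) (p.-1)%:R^-1) * hwt g)); last first.
  rewrite [leRHS](bigID (fun D => lS D)) /= -[leLHS]addr0 lerD//; last first.
    by apply: sumr_ge0 => D _; exact: h0.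
  rewrite le_eqVlt; apply/orP; left; apply/eqP; apply: eq_bigl => D.
  rewrite /lS /levelS; case: (prodS D <= Q)%N => //=.
  apply/idP/andP => [/forallP DB|[]//]; split; last exact/forallP.
  apply/forallP => p; have := DB p; rewrite /B.
  by case: (D p) => //= /andP[].
apply: ler_sum => D /andP[_ /forallP DB].
rewrite [X in X * _]big_mkcond /hwt -big_split /=; apply: ler_prod => p _.
rewrite sumr_ge0//=; have := DB p; rewrite /B /residues.
case: (boolP (rough z p)) => [rp|rp] /=; last first.
  rewrite implybF => /negbTE ->; under eq_bigl do rewrite andbT.
  rewrite big_pred1_eq /f0 /locwt eqxx mul1r /subres (negbTE rp) eqxx mul1r.
  by rewrite (fam_nonrough Fg rp).
case: (boolP (g p == ord0)) => [/eqP gp _|gp] /=; last first.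
  rewrite implybF => /negbTE ->; rewrite mul1r.
  under eq_bigl do rewrite andbT.
  apply: local_correlation => //; exact: fam_rough Fg rp.
rewrite mulr1; case: (D p) => /=.
  under eq_bigl do rewrite eqb_id andbC.
  rewrite (eq_bigr (fun=> ((p.-1)%:R^-1) ^+ 2)); last first.
    move=> a /andP[/negbTE a0 ap]; rewrite /f0 gp subres0// /locwt a0.
    by rewrite expr2.
  rewrite sum_below_const le_eqVlt; apply/orP; left; apply/eqP; field.
  by rewrite pnatr_eq0; have := rough_gt1 rp; lia.
rewrite (big_pred1 ord0) /f0 ?gp ?subres0 ?(rough_gt0 rp)// /locwt ?eqxx ?mulr1//.
move=> a /=; rewrite eqbF_neg negbK.
by case: eqP => [->|_]; rewrite ?andbF// (rough_gt0 rp).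
Qed.

Lemma offdiag_bound (K : R -> R) y : (forall t, 0 <= K t) ->
  (forall t (m : int), K (t + m%:~R) = K t) ->
  \sum_(f : freq | level z f) \sum_(f' : freq | level z f' && (f' != f))
     wt R f * wt R f' * K (y + (ang R f - ang R f'))
  <= Gsum R z Q * \sum_(g : freq | (g \in fam) && (g != freq0 Q) && (den g <= Q * Q)%N)
       hwt g * K (y + ang R g).
Proof.
move=> K0 Kper.
pose S (g : freq) := (g \in fam) && (g != freq0 Q) && (den g <= Q * Q)%N.
pose F (f g : freq) := wt R f * wt R (subfreq z f g) * K (y + ang R g).
have F0 f g : 0 <= F f g by rewrite !mulr_ge0 ?wt_ge0.
apply: (@le_trans _ _ (\sum_(f : freq | level z f) \sum_(g | S g) F f g)).
  apply: ler_sum => f /andP[Ff df].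
  rewrite (eq_bigr (fun f' => F f (subfreq z f f'))); last first.
    move=> f' /andP[/andP[Ff' _] _]; rewrite /F subfreq_invol//.
    have [m ->] := ang_subfreq R Ff Ff'.
    by rewrite addrA Kper.
  apply: ler_sum_inj => // [f1 f2|f'].
    move=> /andP[/andP[F1 _] _] /andP[/andP[F2 _] _] E.
    by rewrite -(subfreq_invol Ff F1) E subfreq_invol.
  move=> /andP[/andP[Ff' df'] ff']; rewrite /S subfreq_fam// subfreq_eq0//.
  rewrite eq_sym ff' /=; apply: leq_trans (den_subfreq Ff Ff') _.
  exact: leq_mul.
rewrite exchange_big mulr_sumr /=; apply: ler_sum => g /andP[/andP[Fg _] _].
rewrite -mulr_suml mulrA ler_wpM2r//.
exact: wt_correlation.
Qed.

Lemma den_ang_int (g : freq) (P : nat) : g \in fam ->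
  (forall p : 'I_Q.+1, g p != ord0 -> (p %| P)%N) ->
  P%:R * ang R g \is a Num.int.
Proof.
move=> Fg PP; rewrite /ang mulr_sumr; apply: rpred_sum => p _.
case: (eqVneq (g p) ord0) => [->|gp]; first by rewrite mul0r mulr0 rpred0.
have /dvdnP[k ->] := PP _ gp.
have /andP[/rough_gt0 rp _] := residues_supp Fg gp.
rewrite natrM; have -> : k%:R * p%:R * ((g p)%:R / p%:R) = k%:R * (g p)%:R :> R.
  by field; rewrite pnatr_eq0 -lt0n.
by rewrite rpredM// natr_int.
Qed.

Lemma ang_inj (g g' : freq) (m : int) : g \in fam -> g' \in fam ->
  ang R g - ang R g' = m%:~R -> g = g'.
Proof.
move=> Fg Fg' E; apply/ffunP => p.
case: (boolP (rough z p)) => [rp|rp]; last by rewrite (fam_nonrough Fg rp) (fam_nonrough Fg' rp).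
pose P := (\prod_(q < Q.+1 | rough z q && (q != p)) q)%N.
have coP : coprime p P.
  apply: (big_ind (coprime p)) => [|m1 m2 h1 h2|q /andP[rq qp]].
  - by rewrite coprimen1.
  - by rewrite coprimeMr h1.
  move: (rp) rq => /andP[pp _] /andP[pq _].
  rewrite prime_coprime// dvdn_prime2//; apply: contraNneq qp => h.
  by apply/eqP/val_inj.
have Pint (h : freq) : h \in fam ->
    P%:R * ang R h - P%:R * ((h p)%:R / p%:R) \is a Num.int.
  move=> Fh; rewrite /ang (bigD1 p)//= mulrDr addrAC subrr add0r mulr_sumr.
  apply: rpred_sum => q qp.
  case: (eqVneq (h q) ord0) => [->|hq]; first by rewrite mul0r mulr0 rpred0.
  have /andP[rq _] := residues_supp Fh hq.
  have q0 : q%:R != 0 :> R by rewrite pnatr_eq0 -lt0n (rough_gt0 rq).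
  rewrite /P (bigD1 q) ?rq//= natrM.
  rewrite (_ : _ * _ = (\prod_(i < Q.+1 | rough z i && (i != p) && (i != q)) i)%N%:R * (h q)%:R).
    by rewrite rpredM// natr_int.
  by field.
have : P%:R * (((g p)%:R - (g' p)%:R) / p%:R) \is a (@Num.int R).
  have -> : P%:R * (((g p)%:R - (g' p)%:R) / p%:R) =
    P%:R * (ang R g - ang R g') - ((P%:R * ang R g - P%:R * ((g p)%:R / p%:R)) -
     (P%:R * ang R g' - P%:R * ((g' p)%:R / p%:R))) by ring.
  apply: rpredB; last by apply: rpredB; exact: Pint.
  by rewrite E rpredM ?natr_int ?intr_int.
case/intrP => k kE.
have p0 : p%:R != 0 :> R by rewrite pnatr_eq0 -lt0n (rough_gt0 rp).
have kE' : (P%:Z * ((g p)%:Z - (g' p)%:Z) = p%:Z * k)%R.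
  apply/eqP; rewrite -(eqr_int R) !rmorphM /= rmorphB /= -!pmulrn; apply/eqP.
  by rewrite -kE; field.
have := fam_rough Fg rp; have := fam_rough Fg' rp => a b.
have : (p %| P * `|(g p)%:Z - (g' p)%:Z|)%N.
  have := congr1 absz kE'; rewrite !abszM /= => ->.
  by rewrite dvdn_mulr.
rewrite Gauss_dvdr// => /dvdn_leq h; apply: val_inj => /=; move: h a b.
move: (nat_of_ord (g p)) (nat_of_ord (g' p)) (nat_of_ord p) => u v w h a b.
by case: (posnP `|u%:Z - v%:Z|%N) => [|/h]; lia.
Qed.

Lemma ang_spaced (g g' : freq) (m : int) : g \in fam -> g' \in fam -> g != g' ->
  ((den g)%:R * (den g')%:R)^-1 <= `|ang R g - ang R g' - m%:~R|.
Proof.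
move=> Fg Fg' gg'.
have d0 : 0 < (den g)%:R * (den g')%:R :> R by rewrite mulr_gt0// ltr0n (den_gt0 (z := z)).
have dvd (h : freq) (p : 'I_Q.+1) : h p != ord0 -> (p %| den h)%N.
  by move=> hp; rewrite /den /prodS (bigD1 p)//= ffunE hp dvdn_mulr.
have : (den g)%:R * (den g')%:R * (ang R g - ang R g' - m%:~R) \is a Num.int.
  rewrite mulrBr rpredB//; last by rewrite !rpredM ?natr_int ?intr_int.
  rewrite mulrBr -natrM rpredB// den_ang_int// => p hp.
    by rewrite dvdn_mulr// dvd.
  by rewrite dvdn_mull// dvd.
case/intrP => k kE.
rewrite -div1r ler_pdivrMr// -[X in _ * X](ger0_norm (ltW d0)) -normrM mulrC kE.
have k0 : k != 0.
  apply: contraNneq gg' => k0; apply/eqP/(ang_inj (m := m) Fg Fg').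
  move/eqP: kE; rewrite k0 mulf_eq0 gt_eqF//= subr_eq0 => /eqP //.
by rewrite norm_intr_ge1 ?intr_int ?intr_eq0.
Qed.

End Correlation.

(** * A lower bound for the sieve sum *)

Section GLower.
Variable R : realType.

Definition mertens (z : nat) : R := \prod_(p < z.+1 | prime p) (p%:R / (p.-1)%:R).

Lemma logn_lt (p n : nat) : (0 < n)%N -> (logn p n < n)%N.
Proof.
move=> n0; case: (boolP (prime p)) => [pp|/negbTE np]; last by rewrite lognE np.
apply: leq_trans (dvdn_leq n0 (pfactor_dvdnn p n)).
exact/ltn_expl/prime_gt1.
Qed.

Lemma sum_geo_lt (x : R) (n : nat) : 0 <= x -> x < 1 ->
  \sum_(a < n) x ^+ a <= (1 - x)^-1.
Proof.
move=> x0 x1; have x1' : 0 < 1 - x by rewrite subr_gt0.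
rewrite -div1r ler_pdivlMr// mulrC.
rewrite -(opprB x 1) mulNr -subrX1 opprB.
by rewrite gerBl exprn_ge0.
Qed.

Lemma ln_le_harmonic (Q : nat) : ln (Q.+1)%:R <= \sum_(n < Q) n.+1%:R^-1 :> R.
Proof.
elim: Q => [|Q IH]; first by rewrite ln1 big_ord0.
rewrite big_ord_recr /=.
have q0 : 0 < Q.+1%:R :> R by rewrite ltr0n.
have -> : Q.+2%:R = Q.+1%:R * (1 + Q.+1%:R^-1) :> R.
  by rewrite mulrDr mulr1 divff ?gt_eqF// natr1.
have h : 0 < (Q.+1%:R)^-1 :> R by rewrite invr_gt0.
rewrite lnM ?posrE ?addr_gt0//; apply: lerD => //.
by apply: le_ln1Dx; apply: lt_trans h; rewrite ltrN10.
Qed.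

Lemma harmonic_le_mertens (z Q : nat) :
  \sum_(n < Q) n.+1%:R^-1 <= mertens z * Gsum R z Q.
Proof.
pose kf (n : 'I_Q) : freq Q := [ffun p : 'I_Q.+1 => inord (logn p n.+1)].
have kfE (n : 'I_Q) (p : 'I_Q.+1) : kf n p = logn p n.+1 :> nat.
  by rewrite ffunE inordK//; have := logn_lt p (ltn0Sn n); have := ltn_ord n; lia.
have nE (n : 'I_Q) : n.+1 = (\prod_(p < Q.+1) p ^ logn p n.+1)%N.
  rewrite -{1}[n.+1]partnT// (@widen_partn Q)//.
  by rewrite big_mkord; apply: eq_bigl => p; rewrite inE.
pose f (p a : 'I_Q.+1) : R := p%:R^-1 ^+ a.
pose F (p : 'I_Q.+1) : pred 'I_Q.+1 := fun a => prime p || (a == ord0).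
pose B (p : 'I_Q.+1) := rough z p.
have f0 p a : 0 <= f p a by rewrite exprn_ge0// invr_ge0.
apply: (@le_trans _ _ (\sum_(g in family F |
    (prodS [ffun p => B p && (g p != ord0)] <= Q)%N) \prod_p f p (g p))).
  rewrite (eq_bigr (fun n : 'I_Q => \prod_p f p (kf n p))); last first.
    move=> n _; rewrite {1}nE natr_prod -prodfV; apply: eq_bigr => p _.
    by rewrite /f kfE natrX exprVn.
  apply: (@ler_sum_inj R _ _ _ _ kf (fun g => \prod_p f p (g p))).
  - move=> n m _ _ E; apply/val_inj/succn_inj; rewrite nE [RHS]nE.
    by apply: eq_bigr => p _; rewrite -!kfE E.
  - move=> n _; apply/andP; split.
      apply/familyP => p; rewrite unfold_in /F.
      case: (boolP (prime p)) => //= np; apply/eqP/val_inj; rewrite /= kfE.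
      by rewrite lognE (negbTE np).
    apply: (@leq_trans n.+1) => //; rewrite [leqRHS]nE; apply: leq_prod => p _.
    rewrite ffunE; case: ifP => [/andP[rp kp]|_].
      rewrite -kfE; apply: (@leq_trans (p ^ 1)); first by rewrite expn1.
      apply: leq_pexp2l; first exact: rough_gt0 rp.
      by rewrite lt0n; apply: contra kp => /eqP h; apply/eqP/val_inj.
    case: (posnP p) => [->|p0]; last by rewrite expn_gt0 p0.
    by rewrite lognE.
  - by move=> g _; exact: prodr_ge0.
rewrite (sum_family_by_support ord0 F B (fun D => (prodS D <= Q)%N)).
rewrite Gsum_levelS mulr_sumr; apply: ler_sum => D /andP[_ /forallP DB].
pose small (p : nat) : R := if prime p && (p <= z)%N then p%:R / (p.-1)%:R else 1.
have small1 p : 1 <= small p.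
  rewrite /small; case: ifP => // /andP[/prime_gt1 p1 _].
  by rewrite ler_pdivlMr ?ltr0n ?mul1r ?ler_nat; lia.
have mE : \prod_(p < Q.+1) small p <= mertens z.
  have -> : mertens z = \prod_(p < z.+1) small p.
    rewrite /mertens big_mkcond; apply: eq_bigr => p _.
    by rewrite /small -ltnS ltn_ord andbT.
  case: (leqP Q z) => [Qz|zQ].
    rewrite -!(big_mkord xpredT (fun p => small p)) (@big_cat_nat _ _ _ Q.+1 0 z.+1)//=.
    rewrite -[leLHS]mulr1 ler_pM ?prodr_ge0// => [i _|].
      exact: le_trans (small1 i).
    by apply: (big_ind (fun x => 1 <= x)) => // x y hx hy; rewrite -[1]mulr1 ler_pM.
  rewrite -!(big_mkord xpredT (fun p => small p)) (@big_cat_nat _ _ _ z.+1 0 Q.+1)//=.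
  rewrite [X in _ * X]big1_seq ?mulr1// => p /andP[_]; rewrite mem_index_iota.
  by move=> /andP[zp _]; rewrite /small leqNgt zp andbF.
  exact: leqW.
apply: (@le_trans _ _ ((\prod_(p < Q.+1) small p) *
    \prod_(p : 'I_Q.+1 | D p) (p.-1)%:R^-1)); last first.
  by rewrite ler_wpM2r// prodr_ge0.
rewrite [X in _ * X]big_mkcond -big_split /=; apply: ler_prod => p _.
rewrite sumr_ge0//=; have := DB p; rewrite /B /F /rough /small.
case: (boolP (prime p)) => [pp|np] /=; last first.
  rewrite implybF => /negbTE ->; under eq_bigl do rewrite andbT.
  by rewrite big_pred1_eq /f expr0 mulr1.
have p1 := prime_gt1 pp.
have p1' : 0 < (p.-1)%:R :> R by rewrite ltr0n; lia.
have p0' : 0 < p%:R :> R by rewrite ltr0n; lia.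
have pE : p%:R = (p.-1)%:R + 1 :> R by rewrite natr1 prednK//; lia.
have vE : (1 - p%:R^-1)^-1 = p%:R / (p.-1)%:R :> R.
  by rewrite pE; field; rewrite -pE !gt_eqF.
have geo : \sum_(a < Q.+1) f p a <= p%:R / (p.-1)%:R.
  rewrite -vE; apply: sum_geo_lt; first by rewrite invr_ge0 ltW.
  by rewrite invf_lt1// ltr1n.
rewrite ltnNge; case: (leqP p z) => [pz|zp] /=.
  by rewrite implybF => /negbTE ->; rewrite mulr1.
case: (D p) => _ /=; rewrite mul1r.
  under eq_bigl do rewrite eqb_id.
  move: geo; rewrite (bigD1 ord0)//= {1}/f expr0 => geo.
  rewrite -(@lerD2l _ 1); apply: le_trans geo _.
  by rewrite le_eqVlt pE; apply/orP; left; apply/eqP; field; rewrite gt_eqF.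
rewrite (big_pred1 ord0) /f ?expr0//.
by move=> a /=; rewrite eqbF_neg negbK.
Qed.

End GLower.

(** * A smoothed counting kernel *)

Section Kernel.
Variable R : realType.
Implicit Types s t : R.
Local Notation normc := (@Normc.normc R).

Definition dirichlet (A : nat) t : R[i] := \sum_(m < A) e (m%:R * t).

Lemma dirichlet_le A t : normc (dirichlet A t) <= A%:R.
Proof.
apply: le_trans (normc_sum _ _ _) _.
under eq_bigr do rewrite normc_e.
by rewrite sumr_const card_ord.
Qed.

Lemma dirichlet_sin A t : normc (dirichlet A t) * `|sin (pi * t)| <= 1.
Proof.
have E : (e t - 1) * dirichlet A t = e (A%:R * t) - 1.
  rewrite e_natM subrX1; congr (_ * _); apply: eq_bigr => m _.
  by rewrite e_natM.
have := congr1 normc E; rewrite Normc.normcM !normc_e_sub1.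
have : `|sin (pi * (A%:R * t))| <= 1.
  by rewrite ler_norml sin_le1 sin_geN1.
by move=> h1 h2; rewrite mulrC -(@ler_pM2l _ 2)// mulrA h2 ler_pM2l.
Qed.

Lemma dirichletN A t : normc (dirichlet A (- t)) = normc (dirichlet A t).
Proof.
rewrite -normc_conj /dirichlet; congr normc; rewrite rmorph_sum.
by apply: eq_bigr => m _; rewrite [LHS]conj_e mulrN opprK.
Qed.

Lemma dirichletDz A t (m : int) : dirichlet A (t + m%:~R) = dirichlet A t.
Proof.
apply: eq_bigr => k _; rewrite mulrDr.
by rewrite -[(k : nat)%:R * m%:~R]/((k%:Z)%:~R * m%:~R) -intrM eDz.
Qed.

(* The absolute value of the Fourier transform of [1_[0,A) * 1_(-L,0] / L], a
   trapezoid equal to 1 on [[0, A - L]]. *)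
Definition kap (A L : nat) t : R :=
  normc (dirichlet A t) * normc (dirichlet L t) / L%:R.

Lemma kap_ge0 A L t : 0 <= kap A L t.
Proof. by rewrite divr_ge0 ?mulr_ge0 ?normc_ge0. Qed.

Lemma kap_le A L t : (0 < L)%N -> kap A L t <= A%:R.
Proof.
move=> L0; rewrite ler_pdivrMr ?ltr0n//.
by apply: ler_pM; rewrite ?normc_ge0 ?dirichlet_le.
Qed.

Lemma kap_sin A L t : (0 < L)%N -> sin (pi * t) != 0 ->
  kap A L t <= (L%:R * sin (pi * t) ^+ 2)^-1.
Proof.
move=> L0 s0; have L0' : 0 < L%:R :> R by rewrite ltr0n.
have s0' : 0 < `|sin (pi * t)| by rewrite normr_gt0.
have s20 : 0 < sin (pi * t) ^+ 2 by rewrite exprn_even_gt0.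
rewrite invfM /kap mulrC ler_pM2l ?invr_gt0//.
rewrite -[leRHS]mul1r ler_pdivlMr// -(real_normK (num_real (sin _))).
rewrite expr2 mulrACA -[leRHS]mulr1.
by apply: ler_pM; rewrite ?mulr_ge0 ?normc_ge0 ?dirichlet_sin.
Qed.

Lemma kapN A L t : kap A L (- t) = kap A L t.
Proof. by rewrite /kap !dirichletN. Qed.

Lemma kapDz A L t (m : int) : kap A L (t + m%:~R) = kap A L t.
Proof. by rewrite /kap !dirichletDz. Qed.

Lemma sum_shift_le (f : R -> R) (N L l : nat) : (l < L)%N ->
  (forall s, 0 <= f s) ->
  \sum_(n < N.+1) f n%:R <= \sum_(m < (N + L)%N) f (m%:R - l%:R).
Proof.
move=> lL f0; rewrite -(big_mkord xpredT (fun n => f n%:R)).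
rewrite -(big_mkord xpredT (fun m => f (m%:R - l%:R))).
rewrite (@big_cat_nat _ _ _ l 0 (N + L)) //=; last by lia.
rewrite (@big_cat_nat _ _ _ (N.+1 + l) l (N + L)) //=; [|by lia|by lia].
rewrite -{3}[l]add0n big_addn addnK.
have -> : \sum_(0 <= i < N.+1) f ((i + l)%:R - l%:R) = \sum_(0 <= n < N.+1) f n%:R.
  by apply: eq_bigr => i _; rewrite natrD addrK.
by rewrite addrCA lerDl addr_ge0// sumr_ge0.
Qed.

Lemma kernel_bound (I : finType) (c : I -> R[i]) (th : I -> R) (N L : nat) :
  (0 < L)%N ->
  \sum_(n < N.+1) normc (\sum_i c i * e (n%:R * th i)) ^+ 2 <=
  \sum_i \sum_j normc (c i) * normc (c j) * kap (N + L) L (th i - th j).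
Proof.
move=> L0; have L0' : 0 < L%:R :> R by rewrite ltr0n.
pose T s := \sum_i c i * e (s * th i).
pose W := \sum_(l < L) \sum_(m < (N + L)%N) normc (T (m%:R - l%:R)) ^+ 2.
have W0 : 0 <= W by apply: sumr_ge0 => l _; apply: sumr_ge0 => m _; exact: sqr_ge0.
have lower : L%:R * \sum_(n < N.+1) normc (T n%:R) ^+ 2 <= W.
  rewrite mulr_natl -[X in _ *+ X]card_ord -sumr_const; apply: ler_sum => l _.
  by apply: (sum_shift_le (f := fun s => normc (T s) ^+ 2)) => // s; exact: sqr_ge0.
have WE : (W%:C)%C = \sum_i \sum_j c i * ((c j)^*)%C *
    (dirichlet (N + L) (th i - th j) * dirichlet L (- (th i - th j))).
  rewrite rmorph_sum /=.
  under eq_bigr do rewrite rmorph_sum /=.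
  have TT l m : ((normc (T (m%:R - l%:R)) ^+ 2)%:C)%C =
      \sum_i \sum_j c i * ((c j)^*)%C * (e (m%:R * (th i - th j)) * e (l%:R * (- (th i - th j)))).
    rewrite sqr_normc_conj /T rmorph_sum mulr_suml; apply: eq_bigr => i _.
    rewrite mulr_sumr; apply: eq_bigr => j _.
    rewrite rmorphM [X in _ * (_ * X) = _]conj_e mulrACA -!eD; congr (_ * e _); ring.
  under eq_bigr do (under eq_bigr do rewrite TT).
  under eq_bigr do rewrite exchange_big /=.
  rewrite exchange_big /=; apply: eq_bigr => i _.
  under eq_bigr do rewrite exchange_big /=.
  rewrite exchange_big /=; apply: eq_bigr => j _.
  rewrite [dirichlet (N + L) _ * _]mulrC /dirichlet mulr_suml mulr_sumr.
  apply: eq_bigr => l _; rewrite !mulr_sumr; apply: eq_bigr => m _.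
  by rewrite [e (l%:R * _) * _]mulrC.
rewrite -(@ler_pM2l _ L%:R)//; apply: le_trans lower _.
rewrite -[leLHS](ger0_norm W0) -normc_real WE.
apply: le_trans (normc_sum _ _ _) _; rewrite mulr_sumr; apply: ler_sum => i _.
apply: le_trans (normc_sum _ _ _) _; rewrite mulr_sumr; apply: ler_sum => j _.
rewrite !Normc.normcM normc_conj dirichletN /kap.
have -> : L%:R * (normc (c i) * normc (c j) * (normc (dirichlet (N + L) (th i - th j)) *
    normc (dirichlet L (th i - th j)) / L%:R)) =
  normc (c i) * normc (c j) * (normc (dirichlet (N + L) (th i - th j)) *
    normc (dirichlet L (th i - th j))) by field; rewrite gt_eqF.
by [].
Qed.

End Kernel.

Section Trig.
Variable R : realType.
Implicit Types x : R.

Lemma ge0_of_derive (f df : R -> R) x : 0 <= x -> f 0 = 0 ->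
  (forall y : R, is_derive y 1 f (df y)) -> (forall y, 0 <= y -> y <= x -> 0 <= df y) ->
  0 <= f x.
Proof.
move=> x0 f0 Df df0.
have cf : {within `[0, x], continuous f}.
  by apply: derivable_within_continuous => y _; have [] := Df y.
have [c] := MVT_segment x0 (fun y _ => Df y) cf.
rewrite in_itv /= => /andP[c0 cx]; rewrite f0 !subr0 => ->.
by rewrite mulr_ge0// df0.
Qed.

Lemma sin_le_id x : 0 <= x -> sin x <= x.
Proof.
move=> x0; rewrite -subr_ge0.
apply: (@ge0_of_derive (fun y => y - sin y) (fun y => 1 - cos y)) => //.
by rewrite sin0 subr0.
Qed.

Lemma mul_cos_le_sin x : 0 <= x -> x <= pi / 2 -> x * cos x <= sin x.
Proof.
move=> x0 xp; rewrite -subr_ge0.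
apply: (@ge0_of_derive (fun y => sin y - y * cos y) (fun y => y * sin y)) => //.
- by rewrite sin0 mul0r subr0.
- move=> y; apply: is_derive_eq.
  by rewrite /GRing.scale /= !mulr1; ring.
- move=> y y0 yx; rewrite mulr_ge0// sin_ge0_pi// y0 /=.
  have := pi_ge0 R; move: xp yx; lra.
Qed.

Lemma cos_triple x : cos (x + x + x) = 4 * cos x ^+ 3 - 3 * cos x.
Proof.
rewrite !(cosD, sinD); have h := cos2Dsin2 x.
move: (cos x) (sin x) h => c s h.
have -> : (c * c - s * s) * c - (s * c + c * s) * s = c ^+ 3 - 3 * c * s ^+ 2 by ring.
by have -> : s ^+ 2 = 1 - c ^+ 2 by [lra]; ring.
Qed.

Lemma sqr_pi_ge : 241 / 25 <= (pi : R) ^+ 2.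
Proof.
pose x : R := pi / 12.
have pi0 := pi_gt0 R.
have x0 : 0 <= x by rewrite divr_ge0// ltW.
pose c := cos (x + x).
have c0 : 0 < c by apply: cos_gt0_pihalf; rewrite /x; apply/andP; split; lra.
have c3 : 4 * c ^+ 3 - 3 * c = 0.
  by rewrite -cos_triple (_ : _ + _ = pi / 2) ?cos_pihalf// /x; lra.
have c2 : c ^+ 2 = 3 / 4.
  apply: (mulfI (lt0r_neq0 c0)); move: c3; rewrite !exprS expr0; lra.
have c1 : c <= 97 / 112.
  rewrite leNgt; apply/negP => h; have := c2; rewrite expr2; nra.
have s2 : 2 * sin x ^+ 2 = 1 - c.
  by rewrite /c cosD -!expr2; have := cos2Dsin2 x; lra.
have sx := sin_le_id x0.
have s0 : 0 <= sin x by rewrite sin_ge0_pi// x0 /= /x; lra.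
have : sin x ^+ 2 <= x ^+ 2 by rewrite ler_pXn2r.
by rewrite [x ^+ 2]exprMn; lra.
Qed.

Lemma sin_pi_neq0 x : 0 < `|x| -> `|x| <= 2^-1 -> sin (pi * x) != 0.
Proof.
wlog x0 : x / 0 <= x.
  move=> H; case: (leP 0 x) => [|x0]; first exact: H.
  by have := H (- x); rewrite normrN mulrN sinN oppr_eq0; apply; lra.
rewrite ger0_norm// => x1 x2; rewrite gt_eqF// sin_gt0_pi//.
have := pi_gt0 R => pi0; rewrite mulr_gt0//=; nra.
Qed.

Lemma inv_sqr_sin_le x : 0 < `|x| -> `|x| <= 2^-1 ->
  (sin (pi * x) ^+ 2)^-1 <= 1 + ((241 / 25) * `|x| ^+ 2)^-1.
Proof.
wlog x0 : x / 0 <= x.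
  move=> H; case: (leP 0 x) => [|x0]; first exact: H.
  by have := H (- x); rewrite normrN mulrN sinN sqrrN; apply; lra.
move=> x1 x2; have sn0 := sin_pi_neq0 x1 x2.
move: x1 x2; rewrite ger0_norm// => x1 x2.
have pi0 := pi_gt0 R.
have s0 : 0 < sin (pi * x) by rewrite lt_neqAle eq_sym sn0 sin_ge0_pi//; nra.
have y0 : 0 < pi * x by rewrite mulr_gt0.
have yp : pi * x <= pi / 2 by nra.
have cs := mul_cos_le_sin (ltW y0) yp.
have c0 : 0 <= cos (pi * x) by rewrite cos_ge0_pihalf//; lra.
have h := cos2Dsin2 (pi * x).
have ps := sqr_pi_ge.
have cs2 : (pi * x) ^+ 2 * cos (pi * x) ^+ 2 <= sin (pi * x) ^+ 2.
  by rewrite -exprMn ler_pXn2r// ?nnegrE ?mulr_ge0// ltW.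
apply: (@le_trans _ _ (1 + ((pi * x) ^+ 2)^-1)).
  move: (pi * x) y0 (sin _) s0 (cos _) c0 h cs2 => y y0 s s0 c c0 h cs2.
  have yy : 0 < y ^+ 2 by rewrite exprn_gt0.
  have ss : 0 < s ^+ 2 by rewrite exprn_gt0.
  rewrite -div1r ler_pdivrMr// mulrDl mul1r -(ler_pM2l yy).
  have -> : y ^+ 2 * (s ^+ 2 + (y ^+ 2)^-1 * s ^+ 2) = y ^+ 2 * s ^+ 2 + s ^+ 2.
    by field; rewrite gt_eqF.
  rewrite -h; lra.
have q0 : 0 < 241 / 25 :> R by exact: divr_gt0 (ltr0n _ 241) (ltr0n _ 25).
rewrite lerD2l lef_pV2 ?posrE ?(exprn_gt0 _ y0) ?(mulr_gt0 q0) ?exprn_gt0//.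
by rewrite exprMn ler_wpM2r// exprn_ge0// ltW.
Qed.

End Trig.

(** * Sums over spaced points *)

Section Spaced.
Variable R : realType.
Implicit Types t u s w : R.

Definition nint t : int := Num.floor (t + 2^-1).

Lemma nintP t : `|t - (nint t)%:~R| <= 2^-1.
Proof.
have := floor_le (t + 2^-1); have := floorD1_gt (t + 2^-1); rewrite -/(nint t).
rewrite intrD => h1 h2; rewrite ler_norml; apply/andP; split; lra.
Qed.

Lemma spaced_sum (I : finType) (P : pred I) (t : I -> R) s w (J : nat)
    (K : R -> R) (phi : nat -> R) :
  0 < s ->
  (forall i j, P i -> P j -> i != j -> forall m : int, s <= `|t i - t j - m%:~R|) ->
  (forall i, P i -> forall m : int, w <= `|t i - m%:~R|) ->
  (forall u (m : int), K (u + m%:~R) = K u) ->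
  (forall j, 0 <= phi j) ->
  (forall u (j : nat), w + j%:R * s <= `|u| -> `|u| <= 2^-1 -> K u <= phi j) ->
  2^-1 < w + J.+1%:R * s ->
  \sum_(i | P i) K (t i) <= 2 * \sum_(j < J.+1) phi j.
Proof.
move=> s0 sep far Kper phi0 Kphi Jbig.
pose u i := t i - (nint (t i))%:~R.
pose k i := Num.truncn ((`|u i| - w) / s).
have Ku i : K (t i) = K (u i) by rewrite /u -rmorphN Kper.
have kP i : P i -> (k i)%:R * s <= `|u i| - w < (k i).+1%:R * s.
  move=> Pi; rewrite -ler_pdivlMr// -ltr_pdivrMr//; apply: truncn_itv.
  by rewrite divr_ge0 ?subr_ge0 ?far// ltW.
have kJ i : P i -> (k i < J.+1)%N.
  move=> Pi; have /andP[h _] := kP i Pi; have := nintP (t i); rewrite -/(u i) => u2.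
  rewrite -(ltr_nat R) -(ltr_pM2r s0); apply: le_lt_trans h _; lra.
have half (Q : pred I) : (forall i j, P i -> P j -> Q i -> Q j -> k i = k j -> `|u i - u j| < s) ->
    \sum_(i | P i && Q i) K (t i) <= \sum_(j < J.+1) phi j.
  move=> cl; apply: (@le_trans _ _ (\sum_(i | P i && Q i) phi (inord (k i) : 'I_J.+1))).
    apply: ler_sum => i /andP[Pi Qi]; rewrite Ku inordK ?kJ//; apply: Kphi.
      by have /andP[] := kP i Pi; rewrite lerBrDl.
    exact: nintP.
  apply: (@ler_sum_inj R _ _ _ _ (fun i => inord (k i) : 'I_J.+1) (fun j => phi j)) => //.
  move=> i j /andP[Pi Qi] /andP[Pj Qj] /(congr1 val); rewrite /= !inordK ?kJ// => kk.
  apply/eqP/negPn/negP => ij; have := cl i j Pi Pj Qi Qj kk; rewrite ltNge.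
  have := sep i j Pi Pj ij (nint (t i) - nint (t j)).
  by rewrite rmorphB /= (_ : _ - _ - _ = u i - u j) ?/u; [move=> ->|ring].
have kk i j : P i -> P j -> k i = k j -> - s < `|u i| - `|u j| < s.
  move=> Pi Pj kij; have := kP i Pi; have := kP j Pj; rewrite kij -[(k j).+1]addn1 natrD mulrDl mul1r.
  move=> /andP[h1 h2] /andP[h3 h4]; apply/andP; split; lra.
rewrite (bigID (fun i => 0 <= u i)) /= mulr_natl mulr2n; apply: lerD; apply: half => i j Pi Pj.
  move=> ui uj /(kk _ _ Pi Pj); rewrite (ger0_norm ui) (ger0_norm uj) ltr_norml => /andP[-> ->] //.
rewrite -!ltNge => ui uj /(kk _ _ Pi Pj); rewrite (ltr0_norm ui) (ltr0_norm uj) ltr_norml => /andP[h1 h2].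
apply/andP; split; lra.
Qed.

Lemma sum_inv_sqr_le (J : nat) : \sum_(j < J) (j.+1%:R ^+ 2)^-1 <= 33 / 20 :> R.
Proof.
case: J => [|[|J]]; rewrite ?big_ord0 ?big_ord_recl ?big_ord0 /=; [lra|lra|].
suff : \sum_(j < J) ((j.+3)%:R ^+ 2)^-1 <= 2 / 5 - (J%:R + 5 / 2)^-1 :> R.
  move=> h; have h0 : 0 <= (J%:R + 5 / 2 : R)^-1 by rewrite invr_ge0 addr_ge0// divr_ge0.
  rewrite /bump /= -[leLHS]/(1 ^- 2 + (2%:R ^- 2 + \sum_(j < J) j.+3%:R ^- 2)).
  move: h h0; set S := \sum_(j < J) _; lra.
elim: J => [|J IH]; first by rewrite big_ord0 add0r; lra.
rewrite big_ord_recr /=; apply: le_trans (lerD IH (lexx _)) _.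
have j0 : 0 <= J%:R :> R by [].
have -> : J.+3%:R = J%:R + 3 :> R by rewrite -natrD addn3.
have -> : J.+1%:R = J%:R + 1 :> R by rewrite natr1.
move: (J%:R : R) j0 => x x0.
have -> : ((x + 3) ^+ 2)^-1 = ((x + 5 / 2) * (x + 7 / 2))^-1 - (4 * (x + 3) ^+ 2 * ((x + 5 / 2) * (x + 7 / 2)))^-1.
  by field; rewrite !gt_eqF//; lra.
have -> : ((x + 5 / 2) * (x + 7 / 2))^-1 = (x + 5 / 2)^-1 - (x + 1 + 5 / 2)^-1.
  by field; rewrite !gt_eqF//; lra.
have : 0 <= (4 * (x + 3) ^+ 2 * ((x + 5 / 2) * (x + 7 / 2)))^-1.
  by rewrite invr_ge0 !mulr_ge0// ?exprn_ge0//; lra.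
lra.
Qed.

Lemma sum_inv_sqr_half_le (J : nat) :
  \sum_(j < J) ((j%:R + 2^-1) ^+ 2)^-1 <= 5 :> R.
Proof.
case: J => [|J]; first by rewrite big_ord0.
rewrite big_ord_recl /=.
suff : \sum_(j < J) ((j.+1%:R + 2^-1) ^+ 2)^-1 <= 1 - (J.+1%:R)^-1 :> R.
  move=> h; have h0 : 0 <= (J.+1%:R : R)^-1 by rewrite invr_ge0.
  rewrite add0r -[leLHS]/(2^-1 ^- 2 + \sum_(j < J) (j.+1%:R + 2^-1) ^- 2).
  have -> : (2^-1 : R) ^- 2 = 4 by rewrite exprVn invrK; ring.
  move: h h0; move: (\sum_(j < J) _) (J.+1%:R^-1) => S x h h0; lra.
elim: J => [|J IH]; first by rewrite big_ord0 invr1 subrr.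
rewrite big_ord_recr /=; apply: le_trans (lerD IH (lexx _)) _.
have j0 : 0 <= J%:R :> R by [].
have -> : J.+2%:R = J%:R + 2 :> R by rewrite -natrD addn2.
have -> : J.+1%:R = J%:R + 1 :> R by rewrite natr1.
move: (J%:R : R) j0 => x x0.
have h : ((x + 1 + 2^-1) ^+ 2)^-1 <= ((x + 1) * (x + 2))^-1.
  rewrite lef_pV2 ?posrE ?exprn_gt0 ?mulr_gt0//; try lra.
have : ((x + 1) * (x + 2))^-1 = (x + 1)^-1 - (x + 2)^-1.
  by field; rewrite !gt_eqF//; lra.
by move: h; lra.
Qed.

Lemma sum_inv_sqr_tail_le (J m : nat) : (0 < m)%N ->
  \sum_(j < J | (m < j)%N) (j%:R ^+ 2)^-1 <= (m%:R)^-1 :> R.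
Proof.
move=> m0; have m0' : 0 < m%:R :> R by rewrite ltr0n.
suff : \sum_(j < J | (m < j)%N) (j%:R ^+ 2)^-1 <= (m%:R)^-1 - ((maxn m J.-1)%:R)^-1 :> R.
  by move=> h; apply: le_trans h _; rewrite gerBl invr_ge0.
elim: J => [|J IH]; first by rewrite big_ord0 maxn0 subrr.
rewrite big_mkcond big_ord_recr -big_mkcond /=.
case: ltnP => mJ.
  apply: le_trans (lerD IH (lexx _)) _.
  have -> : maxn m J.-1 = J.-1 by lia.
  have j0 : 0 < J.-1%:R :> R by rewrite ltr0n; lia.
  have -> : J%:R = J.-1%:R + 1 :> R by rewrite natr1 prednK//; lia.
  move: (J.-1%:R : R) j0 => x x0.
  have h : ((x + 1) ^+ 2)^-1 <= (x * (x + 1))^-1.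
    rewrite lef_pV2 ?posrE ?exprn_gt0 ?mulr_gt0//; try lra.
  have : (x * (x + 1))^-1 = x^-1 - (x + 1)^-1.
    by field; rewrite !gt_eqF//; lra.
  by move: h; lra.
rewrite addr0; apply: le_trans IH _.
by have -> : maxn m J.-1 = m by lia.
Qed.

End Spaced.

Section KernelSums.
Variable R : realType.
Implicit Types t u s : R.
Variables A L : nat.
Hypothesis L0 : (0 < L)%N.

Let L0' : 0 < L%:R :> R. Proof. by rewrite ltr0n. Qed.

Lemma kap_le_inv u : 0 < `|u| -> `|u| <= 2^-1 ->
  kap A L u <= L%:R^-1 * (1 + (241 / 25 * `|u| ^+ 2)^-1).
Proof.
move=> u0 u1; apply: le_trans (kap_sin A L0 (sin_pi_neq0 u0 u1)) _.
by rewrite invfM ler_wpM2l ?invr_ge0 ?ler0n// inv_sqr_sin_le.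
Qed.

Lemma kap_le_inv_sqr u x : 0 < x -> x <= `|u| -> `|u| <= 2^-1 ->
  kap A L u <= L%:R^-1 * (37 / 100 * (x ^+ 2)^-1).
Proof.
move=> x0 xu u1; have u0 : 0 < `|u| by exact: lt_le_trans xu.
apply: le_trans (kap_le_inv u0 u1) _; rewrite ler_wpM2l ?invr_ge0 ?ler0n//.
have u2 : 0 < `|u| ^+ 2 by rewrite exprn_gt0.
apply: (@le_trans _ _ (37 / 100 * (`|u| ^+ 2)^-1)).
  rewrite -(ler_pM2r u2) mulfVK ?gt_eqF// mulrDl mul1r invfM -mulrA mulVf ?gt_eqF//.
  have : `|u| ^+ 2 <= (2^-1) ^+ 2 by rewrite ler_pXn2r ?nnegrE.
  by rewrite exprVn; lra.
rewrite ler_wpM2l// lef_pV2 ?posrE ?exprn_gt0// ler_pXn2r ?nnegrE//.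
exact: ltW.
Qed.

Variables (I : finType) (P : pred I) (t : I -> R) (s : R).
Hypothesis s0 : 0 < s.
Hypothesis sep : forall i j, P i -> P j -> i != j ->
  forall m : int, s <= `|t i - t j - m%:~R|.

Let truncn_bound : 2^-1 < (Num.truncn (2 * s)^-1).+1%:R * s.
Proof.
have := truncnS_gt (2 * s)^-1; set n := (Num.truncn _).+1 => h.
have -> : 2^-1 = (2 * s)^-1 * s :> R by field; rewrite gt_eqF.
by rewrite ltr_pM2r.
Qed.

Lemma row_sum : (forall i, P i -> forall m : int, s <= `|t i - m%:~R|) ->
  \sum_(i | P i) kap A L (t i) <= L%:R^-1 * (s^-1 + 2 + 12 / 35 * (s ^+ 2)^-1).
Proof.
move=> far; set J := Num.truncn (2 * s)^-1.
have q0 : 0 < 241 / 25 :> R by exact: divr_gt0 (ltr0n _ 241) (ltr0n _ 25).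
pose phi (j : nat) := L%:R^-1 * (1 + (241 / 25 * (s * j.+1%:R) ^+ 2)^-1).
apply: le_trans (spaced_sum (J := J) (phi := phi) s0 sep far _ _ _ _) _.
- exact: kapDz.
- move=> j; apply: mulr_ge0; first by rewrite invr_ge0 ler0n.
  by rewrite addr_ge0 ?ler01 ?invr_ge0 ?(mulr_ge0 (ltW q0) (sqr_ge0 _)).
- move=> u j ju u1.
  have ju' : s * j.+1%:R <= `|u| by rewrite -natr1 mulrDr mulr1 addrC mulrC.
  have sj : 0 < s * j.+1%:R by rewrite mulr_gt0// ltr0n.
  have u0 : 0 < `|u| by exact: lt_le_trans ju'.
  apply: le_trans (kap_le_inv u0 u1) _; rewrite ler_wpM2l ?invr_ge0 ?ler0n//.
  rewrite lerD2l lef_pV2 ?posrE ?(mulr_gt0 q0 (exprn_gt0 _ _))//.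
  by rewrite (ler_wpM2l (ltW q0))// ler_pXn2r ?nnegrE// ltW.
- by apply: lt_le_trans truncn_bound _; rewrite lerDr ltW.
rewrite -mulr_sumr mulrCA ler_wpM2l ?invr_ge0 ?ler0n//.
rewrite big_split /= sumr_const card_ord mulrDr.
apply: lerD.
  have h : J%:R <= (2 * s)^-1 by rewrite truncn_le// invr_ge0 mulr_ge0// ltW.
  by rewrite -natr1; move: h; rewrite invfM; lra.
under eq_bigr do rewrite exprMn mulrA invfM.
rewrite -mulr_sumr.
have h := @sum_inv_sqr_le R J.+1.
have c0 : 0 <= (241 / 25 * s ^+ 2)^-1.
  by rewrite invr_ge0 (mulr_ge0 (ltW q0) (sqr_ge0 s)).
apply: (@le_trans _ _ (2 * ((241 / 25 * s ^+ 2)^-1 * (33 / 20)))).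
  by rewrite ler_wpM2l// ler_wpM2l.
have : 0 <= (s ^+ 2)^-1 by rewrite invr_ge0 exprn_ge0// ltW.
by rewrite invfM; lra.
Qed.

Lemma far_sum (Q : pred I) : (forall i, Q i -> P i) ->
  (forall i, Q i -> forall m : int, s / 2 <= `|t i - m%:~R|) ->
  \sum_(i | Q i) kap A L (t i) <= L%:R^-1 * (37 / 10 * (s ^+ 2)^-1).
Proof.
move=> QP far; set J := Num.truncn (2 * s)^-1.
pose phi (j : nat) := L%:R^-1 * (37 / 100 * ((s * (j%:R + 2^-1)) ^+ 2)^-1).
have sepQ i j : Q i -> Q j -> i != j -> forall m : int, s <= `|t i - t j - m%:~R|.
  by move=> Qi Qj; apply: sep; exact: QP.
apply: le_trans (spaced_sum (J := J) (phi := phi) s0 sepQ far _ _ _ _) _.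
- exact: kapDz.
- move=> j; rewrite mulr_ge0 ?invr_ge0 ?ler0n// mulr_ge0// invr_ge0.
  by rewrite sqr_ge0.
- move=> u j ju u1; apply: kap_le_inv_sqr => //.
    by rewrite mulr_gt0// ltr_wpDl.
  by rewrite mulrDr addrC [_ * j%:R]mulrC.
- by apply: lt_le_trans truncn_bound _; rewrite lerDr divr_ge0// ltW.
rewrite -mulr_sumr mulrCA ler_wpM2l ?invr_ge0 ?ler0n//.
under eq_bigr do rewrite exprMn invfM.
rewrite -!mulr_sumr.
have h := @sum_inv_sqr_half_le R J.+1.
have c0 : 0 <= (s ^+ 2)^-1 by rewrite invr_ge0 exprn_ge0// ltW.
apply: (@le_trans _ _ (2 * (37 / 100 * ((s ^+ 2)^-1 * 5)))); last lra.
by rewrite !ler_wpM2l.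
Qed.

Lemma near_sum : \sum_(i | P i) kap A L (t i) <=
  A%:R + L%:R^-1 * (37 / 10 * (s ^+ 2)^-1).
Proof.
case: (pselect (exists2 i0, P i0 & exists m : int, `|t i0 - m%:~R| < s / 2)).
  move=> [i0 Pi0 [m0 near]]; rewrite (bigD1 i0)//=; apply: lerD.
    exact: kap_le.
  apply: far_sum => [i /andP[]//|i /andP[Pi ii0] m].
  rewrite leNgt; apply/negP => near'.
  have := sep Pi Pi0 ii0 (m - m0); rewrite leNgt => /negP; apply.
  have -> : t i - t i0 - (m - m0)%:~R = (t i - m%:~R) - (t i0 - m0%:~R).
    by rewrite rmorphB /=; ring.
  by apply: le_lt_trans (ler_normB _ _) _; move: near near'; lra.
move=> no; apply: le_trans (far_sum (Q := P) _ _) _ => //.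
  move=> i Pi m; rewrite leNgt; apply/negP => near; apply: no.
  by exists i => //; exists m.
by rewrite lerDr.
Qed.

Lemma block_sum (m : nat) : (0 < m)%N -> \sum_(i | P i) kap A L (t i) <=
  2 * (A%:R * m.+1%:R + L%:R^-1 * (37 / 100 * (s ^+ 2 * m%:R)^-1)).
Proof.
move=> m0; set J := Num.truncn (2 * s)^-1.
pose phi (j : nat) := if (j <= m)%N then A%:R
  else L%:R^-1 * (37 / 100 * ((s * j%:R) ^+ 2)^-1).
have far i : P i -> forall k : int, 0 <= `|t i - k%:~R| by [].
apply: le_trans (spaced_sum (J := J) (phi := phi) s0 sep far _ _ _ _) _.
- exact: kapDz.
- move=> j; rewrite /phi; case: ifP => // _; rewrite mulr_ge0 ?invr_ge0 ?ler0n// mulr_ge0// invr_ge0.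
  by rewrite sqr_ge0.
- move=> u j; rewrite add0r => ju u1; rewrite /phi; case: leqP => jm.
    exact: kap_le.
  apply: kap_le_inv_sqr => //; last by rewrite mulrC.
  by rewrite mulr_gt0// ltr0n; lia.
- by rewrite add0r.
rewrite ler_wpM2l// (bigID (fun j : 'I_J.+1 => (j <= m)%N)) /=; apply: lerD.
  rewrite (eq_bigr (fun=> A%:R)); last by move=> j jm; rewrite /phi jm.
  apply: (@le_trans _ _ (\sum_(j < m.+1) A%:R)).
    apply: (@ler_sum_inj R _ _ _ _ (fun j : 'I_J.+1 => inord j : 'I_m.+1)) => // i j im jm.
    by move/(congr1 val); rewrite /= !inordK// => /val_inj.
  by rewrite sumr_const card_ord mulr_natr.
rewrite (eq_bigr (fun j : 'I_J.+1 => L%:R^-1 * (37 / 100 * (s ^+ 2)^-1) * (j%:R ^+ 2)^-1)); last first.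
  by move=> j jm; rewrite /phi (negbTE jm) exprMn invfM !mulrA.
rewrite -mulr_sumr; under eq_bigl do rewrite -ltnNge.
rewrite [(_ * m%:R)^-1]invfM [37 / 100 * (_ * _)]mulrA [leRHS]mulrA.
rewrite ler_wpM2l ?sum_inv_sqr_tail_le//.
by rewrite !mulr_ge0// ?invr_ge0// exprn_ge0// ltW.
Qed.

End KernelSums.

(** * The dual sieve *)

Section Dual.
Variable R : realType.
Local Notation normc := (@Normc.normc R).

Lemma schur_bound (I : finType) (a : I -> R) (M : I -> I -> R) (B : R) :
  (forall i j, 0 <= M i j) -> (forall i, \sum_j M i j <= B) ->
  (forall j, \sum_i M i j <= B) ->
  \sum_i \sum_j a i * a j * M i j <= B * \sum_i a i ^+ 2.
Proof.
move=> M0 rowB colB.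
apply: (@le_trans _ _ (\sum_i \sum_j (a i ^+ 2 * M i j / 2 + a j ^+ 2 * M i j / 2))).
  apply: ler_sum => i _; apply: ler_sum => j _.
  rewrite -mulrDl -mulrDl [leRHS]mulrAC ler_wpM2r// ler_pdivlMr//.
  by have := sqr_ge0 (a i - a j); rewrite sqrrB mulr2n; lra.
under eq_bigr do rewrite big_split /=.
rewrite big_split /= [X in _ + X]exchange_big /=.
have h (x y : R) : x <= B * (\sum_i a i ^+ 2) / 2 -> y <= B * (\sum_i a i ^+ 2) / 2 ->
  x + y <= B * \sum_i a i ^+ 2 by lra.
apply: h.
  rewrite mulr_sumr mulr_suml; apply: ler_sum => i _.
  by rewrite -mulr_suml ler_wpM2r ?invr_ge0// -mulr_sumr mulrC ler_wpM2r ?sqr_ge0.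
rewrite mulr_sumr mulr_suml; apply: ler_sum => i _.
by rewrite -mulr_suml ler_wpM2r ?invr_ge0// -mulr_sumr mulrC ler_wpM2r ?sqr_ge0.
Qed.

Lemma sqr_sum_le (I : finType) (a : I -> R) :
  (\sum_i a i) ^+ 2 <= #|I|%:R * \sum_i a i ^+ 2.
Proof.
have := @schur_bound I a (fun _ _ => 1) #|I|%:R.
rewrite expr2 mulr_suml => h; apply: le_trans (h _ _ _) => //.
- by apply: ler_sum => i _; rewrite mulr_sumr; apply: ler_sum => j _; rewrite mulr1.
- by move=> i; rewrite sumr_const.
- by move=> i; rewrite sumr_const.
Qed.

Lemma duality (I J : finType) (P : pred J) (a : I -> J -> R[i]) (B : R) : 0 < B ->
  (forall c : I -> R[i], \sum_(j | P j) normc (\sum_i c i * a i j) ^+ 2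
     <= B * \sum_i normc (c i) ^+ 2) ->
  forall u : J -> R[i], \sum_i normc (\sum_(j | P j) u j * a i j) ^+ 2
     <= B * \sum_(j | P j) normc (u j) ^+ 2.
Proof.
move=> B0 dual u; pose S i := \sum_(j | P j) u j * a i j.
pose w j := \sum_i ((S i)^*)%C * a i j.
set T := \sum_i _; set U := \sum_(j | P j) normc (u j) ^+ 2.
have T0 : 0 <= T by apply: sumr_ge0 => i _; exact: sqr_ge0.
have TE : (T%:C)%C = \sum_(j | P j) u j * w j.
  rewrite /T rmorph_sum /=.
  under eq_bigr do rewrite sqr_normc_conj -/(S _) mulrC {2}/S mulr_sumr.
  rewrite exchange_big /=; apply: eq_bigr => j _.
  by rewrite /w mulr_sumr; apply: eq_bigr => i _; rewrite mulrCA.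
have wT : \sum_(j | P j) normc (w j) ^+ 2 <= B * T.
  apply: le_trans (dual _) _; rewrite ler_wpM2l ?(ltW B0)//.
  by apply: ler_sum => i _; rewrite normc_conj.
have TU : T <= \sum_(j | P j) normc (u j) * normc (w j).
  rewrite -(ger0_norm T0) -normc_real TE.
  by apply: le_trans (normc_sum _ _ _) _; apply: ler_sum => j _; rewrite Normc.normcM.
have : \sum_(j | P j) normc (u j) * normc (w j) <=
    \sum_(j | P j) (B * normc (u j) ^+ 2 / 2 + normc (w j) ^+ 2 / B / 2).
  apply: ler_sum => j _; move: (normc (u j)) (normc (w j)) => x y.
  have -> : B * x ^+ 2 / 2 + y ^+ 2 / B / 2 = x * y + B / 2 * (x - y / B) ^+ 2.
    by field; rewrite gt_eqF.
  by rewrite lerDl mulr_ge0 ?sqr_ge0// divr_ge0// ltW.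
rewrite big_split /= -!mulr_suml -mulr_sumr -/U => h.
have h2 : (\sum_(j | P j) normc (w j) ^+ 2) / B <= T by rewrite ler_pdivrMr// mulrC.
move: (\sum_(j | P j) normc (w j) ^+ 2) (\sum_(j | P j) normc (u j) * normc (w j)) TU h h2 => X Y.
move: (X / B) => Z; move: (B * U) => V; lra.
Qed.

End Dual.

Section DualSieve.
Variable R : realType.
Local Notation normc := (@Normc.normc R).
Variables z Q : nat.
Local Notation freq := (freq Q).
Local Notation fam := (family (@residues z Q)).

(* Contribution of the pairs of frequencies with non-zero difference [g] modulo 1. *)
Definition errsum (K : R -> R) (y : R) : R :=
  \sum_(g : freq | (g \in fam) && (g != freq0 Q) && (den g <= Q * Q)%N)
     hwt R g * K (y + ang R g).

Lemma normc_sgnwt (g : freq) : normc ((sgnwt R g)%:C)%C = wt R g.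
Proof.
rewrite normc_real /sgnwt normr_prod; apply: eq_bigr => p _.
by case: ifP => _; rewrite ?normr1// normrN ger0_norm.
Qed.

Lemma level_freq0 : (0 < Q)%N -> level z (freq0 Q).
Proof.
move=> Q0; rewrite /level /den /prodS big1 ?Q0 ?andbT; last by move=> p _; rewrite !ffunE eqxx.
apply/familyP => p; rewrite unfold_in /residues ffunE.
by case: ifP => // rp; rewrite (rough_gt0 rp).
Qed.

Lemma Gsum_ge1 : (0 < Q)%N -> 1 <= Gsum R z Q.
Proof.
move=> Q0; rewrite /Gsum (bigD1 (freq0 Q)) /=; last exact: level_freq0.
rewrite [wt _ _]big1; last by move=> p _; rewrite ffunE eqxx.
by rewrite expr1n lerDl; apply: sumr_ge0 => g _; exact: sqr_ge0.
Qed.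

Lemma dual_sieve (I : finType) (th : I -> R) (c : I -> R[i]) (N L : nat) (B E : R) :
  (0 < L)%N -> (0 < Q)%N ->
  (forall i, \sum_j kap (N + L) L (th i - th j) <= B) ->
  (forall y, errsum (kap (N + L) L) y <= E) ->
  \sum_(p < N.+1 | prime p && (Q < p)%N) normc (\sum_i c i * e (p%:R * th i)) ^+ 2
  <= (Gsum R z Q)^-1 * (B + #|I|%:R * E) * \sum_i normc (c i) ^+ 2.
Proof.
move=> L0 Q0 rowB errE; pose G := Gsum R z Q; pose K := @kap R (N + L) L.
have G0 : 0 < G by apply: lt_le_trans (Gsum_ge1 Q0).
pose cc (x : I * freq) : R[i] := if level z x.2 then c x.1 * ((sgnwt R x.2)%:C)%C else 0.
pose tt (x : I * freq) : R := th x.1 + ang R x.2.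
have lhs : G ^+ 2 * \sum_(p < N.+1 | prime p && (Q < p)%N) normc (\sum_i c i * e (p%:R * th i)) ^+ 2
    <= \sum_(p < N.+1) normc (\sum_x cc x * e (p%:R * tt x)) ^+ 2.
  rewrite mulr_sumr big_mkcond; apply: ler_sum => p _.
  case: ifP => [/andP[pp Qp]|_]; last exact: sqr_ge0.
  rewrite le_eqVlt -(ger0_norm (ltW G0)) -normc_real -exprMn -Normc.normcM.
  apply/orP; left; apply/eqP; congr (normc _ ^+ 2).
  rewrite -(@sum_sgnwt_e R z Q p); last first.
    move=> q qQ /andP[pq _]; rewrite dvdn_prime2//.
    by apply: contraTneq Qp => <-; rewrite -leqNgt.
  rewrite mulr_suml -(pair_big xpredT xpredT (fun i f => cc (i, f) * e (p%:R * tt (i, f)))) /=.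
  rewrite exchange_big /= big_mkcond; apply: eq_bigr => f _.
  rewrite /cc /tt /=; case: ifP => lf; last by rewrite big1// => i _; rewrite mul0r.
  rewrite mulr_sumr; apply: eq_bigr => i _.
  by rewrite mulrDr eD; ring.
have rhs : \sum_(p < N.+1) normc (\sum_x cc x * e (p%:R * tt x)) ^+ 2 <=
    \sum_i \sum_j normc (c i) * normc (c j) *
      (G * (K (th i - th j) + errsum K (th i - th j))).
  apply: le_trans (kernel_bound cc tt N L0) _.
  rewrite -(pair_big xpredT xpredT (fun i f => \sum_y normc (cc (i, f)) * normc (cc y) * K (tt (i, f) - tt y))) /=.
  apply: ler_sum => i _.
  under eq_bigr => f _ do rewrite -(pair_big xpredT xpredT (fun j f' => normc (cc (i, f)) * normc (cc (j, f')) * K (tt (i, f) - tt (j, f')))) /=.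
  rewrite exchange_big /=; apply: ler_sum => j _.
  have -> : \sum_(f : freq) \sum_(f' : freq) normc (cc (i, f)) * normc (cc (j, f')) * K (tt (i, f) - tt (j, f'))
     = normc (c i) * normc (c j) * \sum_(f : freq | level z f) \sum_(f' : freq | level z f')
         wt R f * wt R f' * K (th i - th j + (ang R f - ang R f')).
    rewrite [in RHS]big_mkcond mulr_sumr; apply: eq_bigr => f _; rewrite /cc /=.
    case: ifP => lf; last first.
      by rewrite mulr0 big1// => f' _; rewrite Normc.normc0 !mul0r.
    rewrite [in RHS]big_mkcond mulr_sumr; apply: eq_bigr => f' _.
    case: ifP => lf'; last by rewrite Normc.normc0 !(mulr0, mul0r).
    rewrite !Normc.normcM !normc_sgnwt /tt /=.
    rewrite (_ : th i + ang R f - (th j + ang R f') = th i - th j + (ang R f - ang R f')); ring.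
  rewrite ler_wpM2l ?mulr_ge0 ?normc_ge0//.
  have -> : \sum_(f : freq | level z f) \sum_(f' : freq | level z f')
      wt R f * wt R f' * K (th i - th j + (ang R f - ang R f')) =
    G * K (th i - th j) + \sum_(f : freq | level z f) \sum_(f' : freq | level z f' && (f' != f))
      wt R f * wt R f' * K (th i - th j + (ang R f - ang R f')).
    rewrite /G /Gsum mulr_suml -big_split /=; apply: eq_bigr => f lf.
    by rewrite (bigD1 f)//= subrr addr0 expr2.
  rewrite mulrDr lerD2l; apply: offdiag_bound; first exact: kap_ge0.
  exact: kapDz.
have E0 y : 0 <= errsum K y.
  by apply: sumr_ge0 => g _; rewrite mulr_ge0 ?hwt_ge0 ?kap_ge0.
have mid : \sum_i \sum_j normc (c i) * normc (c j) *
      (G * (K (th i - th j) + errsum K (th i - th j))) <=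
    (G * (B + #|I|%:R * E)) * \sum_i normc (c i) ^+ 2.
  apply: schur_bound => [i j|i|j].
  - by rewrite mulr_ge0 ?(ltW G0)// addr_ge0 ?kap_ge0.
  - rewrite -mulr_sumr ler_wpM2l ?(ltW G0)// big_split /= lerD//.
    by rewrite mulr_natl -sumr_const; apply: ler_sum => j _; exact: errE.
  - rewrite -mulr_sumr ler_wpM2l ?(ltW G0)// big_split /= lerD//.
      by under eq_bigr do rewrite -opprB /K kapN; exact: rowB.
    by rewrite mulr_natl -sumr_const; apply: ler_sum => i _; exact: errE.
have := le_trans lhs (le_trans rhs mid); set X := \sum_(p < _ | _) _ => h.
rewrite -/G -(ler_pM2l (exprn_gt0 2 G0)); apply: le_trans h _.
rewrite le_eqVlt; apply/orP; left; apply/eqP; field.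
by rewrite gt_eqF.
Qed.

Lemma large_sieve_primes (I : finType) (th : I -> R) (u : nat -> R[i]) (N L : nat) (B E : R) :
  (0 < L)%N -> (0 < Q)%N ->
  (forall i, \sum_j kap (N + L) L (th i - th j) <= B) -> 0 < B ->
  (forall y, errsum (kap (N + L) L) y <= E) -> 0 <= E ->
  \sum_i normc (\sum_(p < N.+1 | prime p) u p * e (th i * p%:R)) ^+ 2
  <= ((Gsum R z Q)^-1 * (B + #|I|%:R * E) + (Q.-1)%:R * #|I|%:R) *
     \sum_(p < N.+1 | prime p) normc (u p) ^+ 2.
Proof.
move=> L0 Q0 rowB B0 errE E0.
have G0 : 0 < Gsum R z Q by apply: lt_le_trans (Gsum_ge1 Q0).
apply: (@duality R I 'I_N.+1 (fun p => prime p) (fun i p => e (th i * p%:R)) _ _ _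
  (fun p => u p)).
  rewrite ltr_wpDr ?mulr_ge0// mulr_gt0 ?invr_gt0// ltr_wpDr// mulr_ge0//.
move=> c; under eq_bigr => p _ do under eq_bigr => i _ do rewrite [th i * _]mulrC.
rewrite (bigID (fun p : 'I_N.+1 => Q < p)%N) /= mulrDl lerD//.
  by apply: (@dual_sieve I th c N L B E).
apply: (@le_trans _ _ (\sum_(p < N.+1 | prime p && ~~ (Q < p)%N)
    #|I|%:R * \sum_i normc (c i) ^+ 2)).
  apply: ler_sum => p _; apply: le_trans _ (sqr_sum_le _).
  rewrite ler_pXn2r ?nnegrE ?normc_ge0//; last by apply: sumr_ge0 => i _; exact: normc_ge0.
  apply: le_trans (normc_sum _ _ _) _; apply: ler_sum => i _.
  by rewrite Normc.normcM normc_e mulr1.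
apply: (@le_trans _ _ (\sum_(q : 'I_Q.-1.+1 | q != ord0)
    #|I|%:R * \sum_i normc (c i) ^+ 2)).
  have lt1 (p : 'I_N.+1) : prime p && ~~ (Q < p)%N -> (0 < p.-1 < Q.-1.+1)%N.
    by case/andP=> /prime_gt1; lia.
  apply: (@ler_sum_inj R _ _ _ _ (fun p : 'I_N.+1 => inord p.-1 : 'I_Q.-1.+1)
    (fun=> #|I|%:R * \sum_i normc (c i) ^+ 2)) => [p q hp hq|p hp|q _].
  - have /andP[p0 pQ] := lt1 p hp; have /andP[q0 qQ] := lt1 q hq.
    move=> /(congr1 val); rewrite /= !inordK// => pq; apply: val_inj.
    by rewrite /=; lia.
  - have /andP[p0 pQ] := lt1 p hp.
    by rewrite -val_eqE /= inordK// -lt0n.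
  - by rewrite mulr_ge0// sumr_ge0// => i _; exact: sqr_ge0.
rewrite sumr_const cardC1 card_ord /= -[leLHS]mulr_natl mulrA.
by [].
Qed.

End DualSieve.

Section ErrorTerm.
Variable R : realType.
Variables z Q : nat.
Local Notation freq := (freq Q).
Local Notation fam := (family (@residues z Q)).
Hypothesis z3 : (3 <= z)%N.

Lemma local_hwt_le1 p : rough z p -> 3 / (p.-1)%:R <= 1 :> R.
Proof.
case/andP=> _ zp; rewrite ler_pdivrMr ?mul1r ?ler_nat; last by rewrite ltr0n; lia.
lia.
Qed.

Lemma hwt_le_inv (g : freq) : g \in fam -> g != freq0 Q -> hwt R g <= 3 / z%:R.
Proof.
move=> Fg g0.
have [p gp] : exists p, g p != ord0.
  apply/existsP; rewrite -negb_forall; apply: contra g0 => /forallP h.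
  by apply/eqP/ffunP => p; rewrite ffunE; apply/eqP.
have /andP[rp _] := residues_supp Fg gp.
rewrite /hwt (bigD1 p)//= (negbTE gp) -[leRHS]mulr1; apply: ler_pM.
- by rewrite divr_ge0.
- by apply: prodr_ge0 => q _; case: ifP => // _; rewrite divr_ge0.
- have /andP[_ zp] := rp; rewrite ler_pM2l// lef_pV2 ?posrE ?ltr0n ?ler_nat; lia.
- apply: prodr_ile1 => q _; case: (eqVneq (g q) ord0) => [_|gq]; first by rewrite ler01 lexx.
  have /andP[rq _] := residues_supp Fg gq.
  by rewrite divr_ge0//= local_hwt_le1.
Qed.

Variable kappa : R.
Hypothesis kappaP : forall p, prime p -> (z < p)%N ->
  3 * p%:R <= (p.-1)%:R * p%:R `^ kappa.

Lemma hwt_le_powR (g : freq) : g \in fam -> hwt R g <= (den g)%:R `^ (kappa - 1).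
Proof.
move=> Fg; rewrite /den /prodS natr_prod /hwt.
have -> : (\prod_(p < Q.+1) (if supp g p then p : nat else 1%N)%:R) `^ (kappa - 1) =
   \prod_(p < Q.+1) ((if supp g p then p : nat else 1%N)%:R : R) `^ (kappa - 1).
  apply: (proj2 (big_rec2 (fun x y : R => 0 <= x /\ x `^ (kappa - 1) = y) _ _)) => //.
    by rewrite powR1.
  by move=> p x y _ [y0 <-]; rewrite mulr_ge0// powRM.
apply: ler_prod => p _; rewrite ffunE.
case: (eqVneq (g p) ord0) => [_|gp] /=; first by rewrite powR1 ler01 lexx.
have /andP[/andP[pp zp] _] := residues_supp Fg gp.
have p0 : 0 < p%:R :> R by rewrite ltr0n; lia.
have p1 : 0 < (p.-1)%:R :> R by rewrite ltr0n; lia.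
rewrite divr_ge0//= ler_pdivrMr// powRB; last by rewrite (gt_eqF p0) implybT.
rewrite powRr1 ?(ltW p0)// mulrAC ler_pdivlMr// [leRHS]mulrC.
exact: kappaP.
Qed.

Variables (A L N : nat) (M U : R).
Hypotheses (L0 : (0 < L)%N) (N0 : (0 < N)%N) (U1 : 1 <= U).
Hypotheses (AM : A%:R <= 6 / 5 * M) (NM : N%:R <= M) (LN : L%:R^-1 <= 10 / N%:R :> R).
Hypotheses (kappa0 : 0 <= kappa) (kappa1 : kappa <= 1).

Let N0' : 0 < N%:R :> R. Proof. by rewrite ltr0n. Qed.
Let U0 : 0 < U. Proof. exact: lt_le_trans U1. Qed.

Let S (g : freq) := (g \in fam) && (g != freq0 Q) && (den g <= Q * Q)%N.

Lemma low_error y :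
  \sum_(g : freq | S g && ((den g)%:R <= U)) hwt R g * kap A L (y + ang R g)
  <= 3 / z%:R * (6 / 5 * M + 37 * U ^+ 4 / N%:R).
Proof.
have z0 : 0 < z%:R :> R by rewrite ltr0n; lia.
apply: (@le_trans _ _ (3 / z%:R * \sum_(g : freq | S g && ((den g)%:R <= U)) kap A L (y + ang R g))).
  rewrite mulr_sumr; apply: ler_sum => g /andP[/andP[/andP[Fg g0] _] _].
  by rewrite ler_wpM2r ?kap_ge0// hwt_le_inv.
rewrite ler_wpM2l ?divr_ge0//.
have s0 : 0 < (U ^+ 2)^-1 by rewrite invr_gt0 exprn_gt0.
apply: le_trans (near_sum A L0 (s := (U ^+ 2)^-1) s0 _) _.
  move=> g g' /andP[/andP[/andP[Fg _] _] dg] /andP[/andP[/andP[Fg' _] _] dg'] gg' m.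
  have -> : y + ang R g - (y + ang R g') = ang R g - ang R g' by ring.
  apply: le_trans (ang_spaced R m Fg Fg' gg').
  have d1 : 0 < (den g)%:R :> R by rewrite ltr0n (den_gt0 Fg).
  have d2 : 0 < (den g')%:R :> R by rewrite ltr0n (den_gt0 Fg').
  rewrite lef_pV2 ?posrE ?mulr_gt0 ?exprn_gt0// expr2.
  by apply: ler_pM.
apply: lerD => //; rewrite exprVn invrK -exprM.
apply: (@le_trans _ _ (10 / N%:R * (37 / 10 * U ^+ 4))).
  by rewrite ler_wpM2r// mulr_ge0// exprn_ge0// ltW.
rewrite le_eqVlt; apply/orP; left; apply/eqP; field.
by rewrite gt_eqF.
Qed.

Lemma block_error W y : 1 <= W -> U <= W ->
  \sum_(g : freq | S g && (W < (den g)%:R <= 2 * W)) hwt R g * kap A L (y + ang R g)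
  <= M * (40 * ((Q * Q)%:R `^ (1 + kappa)) / N%:R + 5 * U `^ (kappa - 1)).
Proof.
move=> W1 UW; have W0 : 0 < W by exact: lt_le_trans W1.
have M0 : 0 <= M by apply: le_trans NM.
have rhs0 : 0 <= M * (40 * ((Q * Q)%:R `^ (1 + kappa)) / N%:R + 5 * U `^ (kappa - 1)).
  by rewrite mulr_ge0// addr_ge0// ?divr_ge0 ?mulr_ge0 ?powR_ge0.
case: (ltrP W (Q * Q)%:R) => [WQ|QW]; last first.
  rewrite big_pred0// => g; apply/negP => /andP[/andP[_ dg] /andP[Wd _]].
  by have := le_lt_trans QW Wd; rewrite ltr_nat ltnNge dg.
have WkE : W `^ (kappa - 1) * W ^+ 2 = W `^ (1 + kappa).
  rewrite -powR_mulrn ?(ltW W0)// -powRD ?(gt_eqF W0) ?implybT//.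
  by congr (_ `^ _); lra.
apply: (@le_trans _ _ (W `^ (kappa - 1) * \sum_(g : freq | S g && (W < (den g)%:R <= 2 * W)) kap A L (y + ang R g))).
  rewrite mulr_sumr; apply: ler_sum => g /andP[/andP[/andP[Fg g0] _] /andP[dg _]].
  rewrite ler_wpM2r ?kap_ge0//; apply: le_trans (hwt_le_powR Fg) _.
  have -> : kappa - 1 = - (1 - kappa) by lra.
  rewrite !powRN lef_pV2 ?posrE ?powR_gt0//; last exact: lt_trans dg.
  apply: ge0_ler_powR; rewrite ?nnegrE ?subr_ge0//; exact: ltW.
pose s := ((2 * W) ^+ 2)^-1.
have s0 : 0 < s by rewrite invr_gt0 exprn_gt0// mulr_gt0.
pose m := (Num.truncn (4 * W ^+ 2 / N%:R)).+1.
have x0 : 0 < 4 * W ^+ 2 / N%:R by rewrite divr_gt0// mulr_gt0// exprn_gt0.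
have m1 : 4 * W ^+ 2 / N%:R < m%:R by exact: truncnS_gt.
have m2 : m.+1%:R <= 4 * W ^+ 2 / N%:R + 2.
  by rewrite /m -addn2 natrD lerD2r truncn_le// ltW.
have m0' : 0 < m%:R :> R by rewrite ltr0n.
have step : \sum_(g : freq | S g && (W < (den g)%:R <= 2 * W)) kap A L (y + ang R g)
   <= M * (40 * W ^+ 2 / N%:R + 5).
  apply: le_trans (block_sum A L0 (s := s) s0 _ (m := m) _) _ => //.
    move=> g g' /andP[/andP[/andP[Fg _] _] /andP[_ dg]] /andP[/andP[/andP[Fg' _] _] /andP[_ dg']] gg' k.
    have -> : y + ang R g - (y + ang R g') = ang R g - ang R g' by ring.
    apply: le_trans (ang_spaced R k Fg Fg' gg').
    have d1 : 0 < (den g)%:R :> R by rewrite ltr0n (den_gt0 Fg).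
    have d2 : 0 < (den g')%:R :> R by rewrite ltr0n (den_gt0 Fg').
    rewrite /s lef_pV2 ?posrE ?mulr_gt0 ?exprn_gt0 ?mulr_gt0// expr2.
    by apply: ler_pM.
  have t1 : A%:R * m.+1%:R <= 6 / 5 * M * (4 * W ^+ 2 / N%:R + 2) by apply: ler_pM.
  have t2 : L%:R^-1 * (37 / 100 * (s ^+ 2 * m%:R)^-1) <= 10 / N%:R * (37 / 100 * (4 * W ^+ 2 * N%:R)).
    apply: ler_pM => //; rewrite ?mulr_ge0 ?invr_ge0 ?mulr_ge0 ?sqr_ge0 ?(ltW s0)//.
    have -> : (s ^+ 2 * m%:R)^-1 = ((2 * W) ^+ 2) ^+ 2 / m%:R.
      by rewrite invfM /s -exprVn invrK.
    rewrite ler_wpM2l// ler_pdivrMr//.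
    have -> : ((2 * W) ^+ 2) ^+ 2 = 4 * W ^+ 2 * N%:R * (4 * W ^+ 2 / N%:R).
      by field; rewrite gt_eqF.
    by rewrite ler_wpM2l ?(ltW m1)// ?mulr_ge0 ?(ltW W0).
  have t3 : 10 / N%:R * (37 / 100 * (4 * W ^+ 2 * N%:R)) = 37 / 10 * (4 * W ^+ 2 / N%:R) * N%:R.
    by field; rewrite gt_eqF.
  have t4 : (4 * W ^+ 2 / N%:R) * N%:R <= (4 * W ^+ 2 / N%:R) * M by rewrite ler_wpM2l// ltW.
  have -> : 40 * W ^+ 2 / N%:R = 10 * (4 * W ^+ 2 / N%:R) by field; rewrite gt_eqF.
  move: (4 * W ^+ 2 / N%:R) x0 t1 t2 t3 t4 => x x0 t1 t2 t3 t4.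
  apply: le_trans (_ : 2 * (6 / 5 * M * (x + 2) + 37 / 10 * (x * M)) <= _).
    rewrite ler_wpM2l// lerD//; apply: le_trans t2 _; rewrite t3 -mulrA ler_wpM2l//.
  have xM : 0 <= x * M by rewrite mulr_ge0// ltW.
  have -> : 2 * (6 / 5 * M * (x + 2) + 37 / 10 * (x * M)) = 49 / 5 * (x * M) + 24 / 5 * M by field.
  have -> : M * (10 * x + 5) = 10 * (x * M) + 5 * M by ring.
  by lra.
apply: le_trans (ler_wpM2l (powR_ge0 _ _) step) _.
rewrite mulrCA ler_wpM2l// mulrDr; apply: lerD.
  have -> : W `^ (kappa - 1) * (40 * W ^+ 2 / N%:R) = 40 * W `^ (1 + kappa) / N%:R.
    by rewrite -WkE; ring.
  rewrite ler_wpM2r ?invr_ge0// ler_wpM2l//; apply: ge0_ler_powR.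
  - by rewrite addr_ge0.
  - by rewrite nnegrE ltW.
  - by rewrite nnegrE.
  - exact: ltW.
rewrite mulrC ler_wpM2l//.
have -> : kappa - 1 = - (1 - kappa) by lra.
rewrite !powRN lef_pV2 ?posrE ?powR_gt0//.
by apply: ge0_ler_powR; rewrite ?nnegrE ?subr_ge0// ltW.
Qed.

Lemma errsum_le (J : nat) y : (Q * Q)%:R <= U * 2 ^+ J ->
  errsum z Q (kap A L) y <= 3 / z%:R * (6 / 5 * M + 37 * U ^+ 4 / N%:R) +
   J%:R * (M * (40 * ((Q * Q)%:R `^ (1 + kappa)) / N%:R + 5 * U `^ (kappa - 1))).
Proof.
move=> QU; rewrite /errsum (bigID (fun g : freq => (den g)%:R <= U)) /=.
apply: lerD; first exact: low_error.
set X := M * _.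
have blocks (j : nat) : \sum_(g : freq | S g && (U < (den g)%:R <= U * 2 ^+ j))
    hwt R g * kap A L (y + ang R g) <= j%:R * X.
  elim: j => [|j IH].
    rewrite mul0r expr0 mulr1 big_pred0// => g.
    by case: ltP => //=; rewrite ?andbF// => /lt_geF ->; rewrite andbF.
  rewrite (bigID (fun g : freq => (den g)%:R <= U * 2 ^+ j)) /=.
  have -> : j.+1%:R * X = j%:R * X + X by rewrite -natr1 mulrDl mul1r.
  have p1 : 1 <= 2 ^+ j :> R by rewrite exprn_ege1// ler1n.
  have UW : U <= U * 2 ^+ j by rewrite ler_peMr// ltW.
  apply: lerD.
    apply: le_trans IH; rewrite le_eqVlt; apply/orP; left; apply/eqP.
    apply: eq_bigl => g; case: (S g) => //=; case: (U < _) => //=.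
    apply/andP/idP => [[]//|h]; split=> //; apply: le_trans h _.
    by rewrite exprS mulrCA ler_peMl ?ler1n// mulr_ge0 ?exprn_ge0// ltW.
  apply: le_trans (block_error y (le_trans U1 UW) UW).
  rewrite le_eqVlt; apply/orP; left; apply/eqP; apply: eq_bigl => g.
  case: (S g) => //=; rewrite -ltNge exprS mulrCA andbC andbA.
  congr (_ && _); apply/andP/idP => [[]//|h]; split=> //; exact: le_lt_trans h.
apply: le_trans (blocks J); rewrite le_eqVlt; apply/orP; left; apply/eqP.
apply: eq_bigl => g; rewrite /S -ltNge.
case: (leqP (den g) (Q * Q)) => [d|_]; rewrite ?andbF ?andbT//=.
have -> : (den g)%:R <= U * 2 ^+ J by apply: le_trans QU; rewrite ler_nat.
by rewrite andbT.
Qed.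

End ErrorTerm.

Section Core.
Variable R : realType.
Local Notation normc := (@Normc.normc R).

Lemma window_choice (N : nat) (delta : R) : (10 <= N)%N -> 0 < delta -> delta <= 2^-1 ->
  exists2 L : nat, (0 < L)%N &
    let M := N%:R + delta^-1 in
    [/\ (N + L)%:R <= 6 / 5 * M, L%:R^-1 <= 10 / N%:R :> R &
      (N + L)%:R + L%:R^-1 * (delta^-1 + 2 + 12 / 35 * (delta ^+ 2)^-1) <= 41 / 35 * M + 5].
Proof.
move=> N10 d0 d2; rewrite /= -exprVn.
have D2 : 2 <= delta^-1 by rewrite -[2]invrK lef_pV2 ?posrE.
move: (delta^-1) D2 => D D2.
have n10 : 10 <= N%:R :> R by rewrite (ler_nat _ 10).
pose lam := Num.max (3 / 5 * D) (N%:R / 10).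
pose L := (Num.truncn lam).+1.
have lam1 : 3 / 5 * D <= lam by rewrite le_max lexx.
have lam2 : N%:R / 10 <= lam by rewrite le_max lexx orbT.
have L1 : lam < L%:R by exact: truncnS_gt.
have L2 : L%:R <= lam + 1 by rewrite /L -natr1 lerD2r truncn_le//; lra.
have L0 : 0 < L%:R :> R by rewrite ltr0n.
exists L => //; split.
- rewrite natrD; have : lam <= N%:R / 10 + 3 / 5 * D by rewrite ge_max; apply/andP; split; lra.
  lra.
- have -> : 10 / N%:R = (N%:R / 10)^-1 :> R by rewrite invfM invrK mulrC.
  rewrite lef_pV2 ?posrE//; lra.
have t1 : L%:R^-1 * (D + 2) <= 10 / 3.
  rewrite mulrC ler_pdivrMr//; lra.
have t2 : L%:R^-1 * (12 / 35 * D ^+ 2) <= 4 / 7 * D.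
  rewrite mulrC ler_pdivrMr//.
  have : 4 / 7 * D * (3 / 5 * D) <= 4 / 7 * D * L%:R by rewrite ler_wpM2l//; lra.
  by rewrite expr2; lra.
rewrite mulrDr natrD.
have : lam <= N%:R / 7 + 3 / 5 * D by rewrite ge_max; apply/andP; split; lra.
have : lam = 3 / 5 * D \/ lam = N%:R / 10.
  by rewrite /lam; case: leP; [right|left].
case; lra.
Qed.

Variables (I : finType) (th : I -> R) (u : nat -> R[i]) (delta : R) (N : nat).
Hypotheses (N10 : (10 <= N)%N) (delta0 : 0 < delta) (delta2 : delta <= 2^-1).
Hypothesis sep : forall i j, i != j -> forall m : int, delta <= `|th i - th j - m%:~R|.
Let M := N%:R + delta^-1.
Let K : R := #|I|%:R.

Lemma row_bound (L : nat) i : (0 < L)%N ->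
  \sum_j kap (N + L) L (th i - th j) <=
  (N + L)%:R + L%:R^-1 * (delta^-1 + 2 + 12 / 35 * (delta ^+ 2)^-1).
Proof.
move=> L0; rewrite (bigD1 i)//=; apply: lerD; first exact: kap_le.
apply: (row_sum _ L0 delta0) => [j k _ _ jk m|j ji m].
  have -> : th i - th j - (th i - th k) - m%:~R = th k - th j - m%:~R by ring.
  by apply: sep; rewrite eq_sym.
by apply: sep; rewrite eq_sym.
Qed.

Lemma large_sieve_trivial :
  \sum_i normc (\sum_(p < N.+1 | prime p) u p * e (th i * p%:R)) ^+ 2
  <= (41 / 35 * M + 5) * \sum_(p < N.+1 | prime p) normc (u p) ^+ 2.
Proof.
have [L L0 [AM LN rowM]] := window_choice N10 delta0 delta2.
have M0 : 0 <= M by rewrite addr_ge0// invr_ge0 ltW.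
have S0 : 0 <= \sum_(p < N.+1 | prime p) normc (u p) ^+ 2.
  by apply: sumr_ge0 => p _; exact: sqr_ge0.
have B0 : 0 < 41 / 35 * M + 5 by lra.
have err0 y : errsum 0 1 (kap (N + L) L) y <= 0 :> R.
  rewrite /errsum big_pred0// => g; apply/negP => /andP[/andP[Fg /eqP g0] _].
  apply: g0; apply/ffunP => p; rewrite ffunE; apply: (fam_nonrough Fg).
  by case: p => [[|[|[]]]].
have := @large_sieve_primes R 0 1 I th u N L (41 / 35 * M + 5) 0 L0 isT.
move=> /(_ (fun i => le_trans (row_bound i L0) rowM) B0 err0 (lexx _)) h.
apply: le_trans h _; rewrite ler_wpM2r//= mul0r addr0 mulr0 addr0.
have G1 := @Gsum_ge1 R 0 1 isT.
by rewrite ler_piMl ?(ltW B0)// invf_le1// (lt_le_trans _ G1).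
Qed.

Lemma large_sieve_core (z Q J : nat) (kappa U : R) : (3 <= z)%N -> (0 < Q)%N ->
  (forall p, prime p -> (z < p)%N -> 3 * p%:R <= (p.-1)%:R * p%:R `^ kappa) ->
  1 <= U -> 0 <= kappa -> kappa <= 1 -> (Q * Q)%:R <= U * 2 ^+ J ->
  \sum_i normc (\sum_(p < N.+1 | prime p) u p * e (th i * p%:R)) ^+ 2
  <= ((Gsum R z Q)^-1 * (41 / 35 * M + 5 + K *
       (3 / z%:R * (6 / 5 * M + 37 * U ^+ 4 / N%:R) +
        J%:R * (M * (40 * ((Q * Q)%:R `^ (1 + kappa)) / N%:R + 5 * U `^ (kappa - 1)))))
      + Q%:R * K) * \sum_(p < N.+1 | prime p) normc (u p) ^+ 2.
Proof.
move=> z3 Q0 kP U1 k0 k1 QU.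
have [L L0 [AM LN rowM]] := window_choice N10 delta0 delta2.
have M0 : 0 <= M by rewrite addr_ge0// invr_ge0 ltW.
have S0 : 0 <= \sum_(p < N.+1 | prime p) normc (u p) ^+ 2.
  by apply: sumr_ge0 => p _; exact: sqr_ge0.
have B0 : 0 < 41 / 35 * M + 5 by lra.
have NM : N%:R <= M by rewrite lerDl invr_ge0 ltW.
have N0 : (0 < N)%N := leq_trans (isT : (0 < 10)%N) N10.
have errE y := errsum_le z3 kP L0 N0 U1 AM NM LN k0 k1 y QU.
set E := (X in K * X).
have E0 : 0 <= E.
  apply: le_trans _ (errE 0); apply: sumr_ge0 => g _.
  by rewrite mulr_ge0 ?hwt_ge0 ?kap_ge0.
have := @large_sieve_primes R z Q I th u N L (41 / 35 * M + 5) E L0 Q0.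
move=> /(_ (fun i => le_trans (row_bound i L0) rowM) B0 errE E0) h.
apply: le_trans h _; rewrite ler_wpM2r// lerD2l ler_wpM2r ?ler0n// ler_nat.
exact: leq_pred.
Qed.

End Core.

(** * Explicit Chebyshev and Mertens bounds *)

Section Chebyshev.

Lemma binS_odd_le (m : nat) : ('C(m.*2.+1, m) <= 4 ^ m)%N.
Proof.
have h : ('C(m.*2.+1, m) + 'C(m.*2.+1, m.+1) <= 2 ^ m.*2.+1)%N.
  rewrite -[2%N]/(1 + 1)%N expnDn.
  have hm : (m < m.*2.+2)%N by lia.
  have hm1 : (m.+1 < m.*2.+2)%N by lia.
  rewrite (bigD1 (Ordinal hm)) //= (bigD1 (Ordinal hm1)) /=; last first.
    by rewrite -val_eqE /= gtn_eqF.
  by rewrite !exp1n !muln1 addnA leq_addr.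
have e : 'C(m.*2.+1, m.+1) = 'C(m.*2.+1, m).
  by rewrite -bin_sub; [congr binomial; lia|lia].
move: h; rewrite e expnS -muln2 mulnC expnM -[(2 ^ 2)%N]/4%N; lia.
Qed.

Lemma dvdn_prod_primes (s : seq nat) (n : nat) : uniq s ->
  (forall p, p \in s -> prime p && (p %| n)%N) -> (\prod_(p <- s) p %| n)%N.
Proof.
elim: s => [|p s IH] /=; first by rewrite big_nil dvd1n.
move=> /andP[ps us] h; rewrite big_cons Gauss_dvd.
  have /andP[_ ->] := h p (mem_head _ _); apply: IH => // q qs.
  by apply: h; rewrite inE qs orbT.
have /andP[pp _] := h p (mem_head _ _).
rewrite prime_coprime//; apply/negP => pd.
have {pd} : exists2 q, q \in s & (p %| q)%N.
  elim: s {IH us ps h} pd => [|q s IH]; first by rewrite big_nil dvdn1 => /eqP p1; rewrite p1 in pp.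
  rewrite big_cons Euclid_dvdM// => /orP[pq|/IH[r rs pr]].
    by exists q; rewrite ?mem_head.
  by exists r => //; rewrite inE rs orbT.
move=> [q qs]; have /andP[pq _] : prime q && (q %| n)%N.
  by apply: h; rewrite inE qs orbT.
by rewrite dvdn_prime2// => /eqP pqE; move: ps; rewrite pqE qs.
Qed.

Lemma primorial_le (n : nat) : (\prod_(p < n.+1 | prime p) p <= 4 ^ n)%N.
Proof.
rewrite -(big_mkord prime id).
have [k] := ubnP n; elim: k n => // k IH n nk.
case: (leqP n 2) => [n2|n2].
  by case: n n2 {nk} => [|[|[]]] // _; rewrite unlock.
case: (boolP (odd n)) => [on|en]; last first.
  rewrite big_mkcond big_nat_recr//= -big_mkcond /= ifN; last first.
    by apply: contra en => /even_prime[nE|//]; rewrite nE in n2.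
  case: n nk n2 {en} => // n nk n2; rewrite muln1; apply: leq_trans (IH n _) _; first lia.
  by rewrite leq_pexp2l.
pose m := n./2.
have nE : n = m.*2.+1 by rewrite -[LHS]odd_double_half on.
have m1 : (m.+2 <= n.+1)%N by lia.
rewrite (@big_cat_nat _ _ _ m.+2)//=.
have -> : (4 ^ n = 4 ^ m.+1 * 4 ^ m)%N by rewrite -expnD; congr expn; lia.
apply: leq_mul; first by apply: IH; lia.
apply: leq_trans (binS_odd_le m).
apply: dvdn_leq; first by rewrite bin_gt0; lia.
rewrite -big_filter; apply: dvdn_prod_primes.
  by rewrite filter_uniq// iota_uniq.
move=> p; rewrite mem_filter mem_index_iota => /andP[pp /andP[mp pn]].
rewrite pp /=.
have := @bin_fact m.*2.+1 m; move=> /(_ (ltac:(lia))) binE.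
have : (p %| (m.*2.+1)`!)%N by rewrite dvdn_fact// prime_gt0//=; lia.
rewrite -binE !Euclid_dvdM// => /orP[//|].
have nd j : (j < p)%N -> ~~ (p %| j`!)%N.
  elim: j => [|j IHj] jp; first by rewrite fact0 dvdn1; apply: contraTneq pp => ->.
  rewrite factS Euclid_dvdM// negb_or IHj ?(ltnW jp)// andbT.
  by rewrite gtnNdvd.
case/orP; apply: contraTT => _; apply: nd; lia.
Qed.

End Chebyshev.

Section FactorialBounds.
Variable R : realType.

Lemma ln_ge0_nat (n : nat) : 0 <= ln n%:R :> R.
Proof. by case: n => [|n]; [rewrite ln0|rewrite ln_ge0// ler1n]. Qed.

Lemma ln_ge1Binv (x : R) : 0 < x -> 1 - x^-1 <= ln x.
Proof.
move=> x0; have xi : 0 < x^-1 by rewrite invr_gt0.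
have := @le_ln1Dx R (x^-1 - 1); rewrite addrCA subrr addr0 lnV ?posrE//.
have h : -1 < x^-1 - 1 by rewrite ltrBrDr addrC subrr.
by move=> /(_ h); lra.
Qed.

Lemma ln_prod_nat (I : Type) (r : seq I) (P : pred I) (F : I -> nat) :
  (forall i, P i -> (0 < F i)%N) ->
  ln (\prod_(i <- r | P i) F i)%:R = \sum_(i <- r | P i) ln (F i)%:R :> R.
Proof.
move=> F0; apply: (proj2 (big_rec2 (fun (x : nat) (y : R) => (0 < x)%N /\ ln x%:R = y) _ _)) => //.
  by rewrite ln1.
move=> i x y Pi [x0 <-]; have f0 := F0 i Pi; rewrite muln_gt0 f0 x0; split=> //.
by rewrite natrM lnM// posrE ltr0n.
Qed.

Lemma theta_le (n : nat) : \sum_(p < n.+1 | prime p) ln p%:R <= n%:R * (2 * ln 2) :> R.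
Proof.
rewrite -ln_prod_nat; last by move=> p /prime_gt0.
have -> : n%:R * (2 * ln 2) = ln (4 ^ n)%:R :> R.
  have l4 : ln 4 = 2 * ln 2 :> R.
    have -> : 4 = 2 ^+ 2 :> R by ring.
    by rewrite lnXn// mulr_natl.
  by rewrite natrX lnXn// l4 mulr_natl.
by rewrite ler_ln ?posrE ?ltr0n ?expn_gt0// ?ler_nat ?primorial_le// prodn_cond_gt0// => p /prime_gt0.
Qed.

Lemma ln_fact_le (n : nat) : (0 < n)%N ->
  ln (n`!)%:R <= n%:R * ln n%:R - n%:R + ln n%:R + 1 :> R.
Proof.
case: n => // n _; elim: n => [|n IH]; first by rewrite (_ : 1`! = 1%N)// ln1; lra.
have n0 : 0 < n.+1%:R :> R by rewrite ltr0n.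
have n1 : 0 < n.+2%:R :> R by rewrite ltr0n.
rewrite factS natrM lnM ?posrE ?ltr0n ?fact_gt0//.
apply: le_trans (lerD (lexx _) IH) _.
have h := @ln_ge1Binv (n.+2%:R / n.+1%:R) (divr_gt0 n1 n0).
rewrite ln_div ?posrE// in h.
have e : n.+2%:R = n.+1%:R + 1 :> R by rewrite natr1.
have := ler_wpM2l (ltW n1) h.
have -> : n.+2%:R * (1 - (n.+2%:R / n.+1%:R)^-1) = 1 :> R.
  rewrite invf_div mulrBr mulr1 mulrCA divff ?gt_eqF// mulr1 e.
  by rewrite addrAC subrr add0r.
move: (ln n.+2%:R) (ln n.+1%:R) => a b; rewrite e => h2.
have : 1 <= n.+1%:R * a - n.+1%:R * b + (a - b) by lra.
lra.
Qed.

Lemma ln_factE (n : nat) : ln (n`!)%:R = \sum_(p < n.+1 | prime p) (logn p n`!)%:R * ln p%:R :> R.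
Proof.
have nE : n`! = (\prod_(p < n.+1 | prime p) p ^ logn p n`!)%N.
  rewrite -{1}[n`!]partnT ?fact_gt0// (@widen_partn n`!)//.
  rewrite (@big_cat_nat _ _ _ n.+1)//=; last by rewrite ltnS; exact: fact_geq.
  rewrite [X in (_ * X)%N]big_nat_cond [X in (_ * X)%N]big1 ?muln1; last first.
    move=> p /andP[/andP[np _] _]; case: (boolP (prime p)) => [pp|/negbTE pp].
      rewrite logn_fact// big_nat_cond big1 ?expn0// => k /andP[/andP[k0 _] _].
      rewrite divn_small//; apply: leq_trans np _.
      by rewrite -[X in (X <= _)%N]expn1 leq_pexp2l// prime_gt0.
    by rewrite lognE pp expn0.
  rewrite big_mkord [RHS]big_mkcond; apply: eq_big => [p|p _]; first by rewrite inE.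
  by case: ifP => // pp; rewrite lognE pp expn0.
rewrite {1}nE ln_prod_nat; last by move=> p pp; rewrite expn_gt0 prime_gt0.
apply: eq_bigr => p pp.
by rewrite natrX lnXn ?ltr0n ?prime_gt0// mulr_natl.
Qed.

Lemma logn_fact_ge (p n : nat) : prime p ->
  n%:R / p%:R - 1 <= (logn p n`!)%:R :> R.
Proof.
move=> pp; have p0 : 0 < p%:R :> R by rewrite ltr0n prime_gt0.
apply: (@le_trans _ _ (n %/ p)%:R).
  rewrite lerBlDr natr1 ler_pdivrMr// -natrM ler_nat ltnW//.
  by rewrite -ltn_divLR// ?prime_gt0.
rewrite ler_nat logn_fact//; case: n => [|n]; first by rewrite div0n.
by rewrite big_nat_recl//= expn1 leq_addr.
Qed.

Lemma logn_fact_ge_full (p n : nat) : prime p -> (0 < n)%N ->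
  n%:R / (p.-1)%:R * ln p%:R - ln n%:R - ln p%:R <= (logn p n`!)%:R * ln p%:R :> R.
Proof.
move=> pp n0; have p1 := prime_gt1 pp; have p0 : 0 < p%:R :> R by rewrite ltr0n prime_gt0.
have q0 : 0 < (p.-1)%:R :> R by rewrite ltr0n; lia.
have lp : 0 < ln p%:R :> R by rewrite ln_gt0// ltr1n.
pose K := trunc_log p n.
have /andP[Kn nK] : (p ^ K <= n < p ^ K.+1)%N by exact: trunc_log_bounds.
have Kln : K%:R * ln p%:R <= ln n%:R :> R.
  rewrite mulr_natl -lnXn// -natrX ler_ln ?posrE ?ltr0n ?expn_gt0 ?n0 ?(prime_gt0 pp)//.
  by rewrite ler_nat.
have KN : (K <= n)%N by apply: leq_trans (ltnW (ltn_expl K p1)) Kn.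
have low : \sum_(k < K) (n.+1%:R / p%:R ^+ k.+1 - 1) <= (logn p n`!)%:R :> R.
  rewrite logn_fact//; apply: (@le_trans _ _ (\sum_(1 <= k < K.+1) n %/ p ^ k)%:R).
    rewrite big_add1 big_mkord natr_sum; apply: ler_sum => k _.
    rewrite lerBlDr natr1 -natrX ler_pdivrMr ?ltr0n ?expn_gt0 ?prime_gt0// -natrM ler_nat.
    by rewrite -ltn_divLR// expn_gt0 prime_gt0.
  by rewrite ler_nat (@big_cat_nat _ _ _ K.+1 1 n.+1)//= leq_addr.
have geo (x : nat) (j : nat) : \sum_(k < j) (x%:R / p%:R ^+ k.+1 - 1) = x%:R / (p.-1)%:R * (1 - (p%:R ^+ j)^-1) - j%:R :> R.
  elim: j => [|j IH]; first by rewrite big_ord0 expr0 invr1 subrr mulr0 subr0.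
  rewrite big_ord_recr /= IH -[j.+1%:R]natr1.
  have -> : p%:R = (p.-1)%:R + 1 :> R by rewrite natr1 prednK// prime_gt0.
  rewrite exprS; have : ((p.-1)%:R + 1) ^+ j != 0 :> R by rewrite expf_neq0// gt_eqF// addr_gt0.
  move: (_ ^+ j) => y y0; field.
  by rewrite y0 !gt_eqF// addr_gt0.
have key : n%:R / (p.-1)%:R - 1 - K%:R <= (logn p n`!)%:R :> R.
  apply: le_trans low; rewrite geo lerD2r.
  have y0 : 0 < p%:R ^+ K :> R by rewrite exprn_gt0.
  have : n.+1%:R <= p%:R * p%:R ^+ K :> R by rewrite -exprS -natrX ler_nat.
  have -> : p%:R = (p.-1)%:R + 1 :> R by rewrite natr1 prednK// prime_gt0.
  have : 0 < ((p.-1)%:R + 1) ^+ K :> R by rewrite exprn_gt0// addr_gt0.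
  move: (_ ^+ K) => y y1 h; rewrite -natr1 in h *.
  have -> : (n%:R + 1) / (p.-1)%:R * (1 - y^-1) = n%:R / (p.-1)%:R - 1
     + ((p.-1)%:R * y + y - (n%:R + 1)) / ((p.-1)%:R * y) :> R.
    by field; rewrite !gt_eqF.
  rewrite lerDl divr_ge0//; last by rewrite mulr_ge0 ?(ltW q0) ?(ltW y1).
  by move: h; rewrite mulrDl mul1r subr_ge0.
by apply: le_trans _ (ler_wpM2r (ltW lp) key); rewrite !mulrBl mul1r; lra.
Qed.

(* Using [1/(p-1)] instead of [1/p] at [p = 2, 3, 5] accounts for the higher powers
   of these primes and lowers the constant in Mertens' bound. *)
Definition mweight (p : nat) : R := if (p <= 5)%N then (p.-1)%:R^-1 else p%:R^-1.

Definition mertens_sum (n : nat) : R := \sum_(p < n.+1 | prime p) mweight p * ln p%:R.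

Lemma mertens_sum_le (n : nat) : (0 < n)%N ->
  mertens_sum n <= ln n%:R - 1 + 2 * ln 2 + (4 * ln n%:R + 1) / n%:R.
Proof.
move=> n0; have n0' : 0 < n%:R :> R by rewrite ltr0n.
have h (p : nat) : prime p -> n%:R * (mweight p * ln p%:R) <=
    (logn p n`!)%:R * ln p%:R + ln p%:R + (if (p <= 5)%N then ln n%:R else 0).
  move=> pp; rewrite /mweight; case: ifP => _.
    by have := logn_fact_ge_full pp n0; rewrite mulrA; lra.
  have := logn_fact_ge n pp; rewrite -(ler_pM2r (_ : 0 < ln p%:R :> R)); last first.
    by rewrite ln_gt0// ltr1n prime_gt1.
  by rewrite mulrA; lra.
have : n%:R * mertens_sum n <= ln (n`!)%:R + n%:R * (2 * ln 2) + 3 * ln n%:R.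
  rewrite /mertens_sum mulr_sumr.
  apply: le_trans (ler_sum _ (fun (p : 'I_n.+1) pp => h p pp)) _.
  rewrite !big_split /= -ln_factE; apply: lerD; first by rewrite lerD2l theta_le.
  rewrite -big_mkcondr /=.
  apply: (@le_trans _ _ (\sum_(p < 6 | prime p) ln n%:R)).
    apply: (@ler_sum_inj R _ _ _ _ (fun p : 'I_n.+1 => inord p : 'I_6) (fun=> ln n%:R)) => //.
    - move=> p q /andP[_ p5] /andP[_ q5] /(congr1 val); rewrite /= !inordK//.
      exact: val_inj.
    - by move=> p /andP[pp p5]; rewrite inordK.
    - by move=> _ _; exact: ln_ge0_nat.
  rewrite big_mkcond !big_ord_recr big_ord0 /=; lra.
move=> hh; rewrite -(ler_pM2l n0'); apply: le_trans hh _.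
have := ln_fact_le n0; move: (ln _`!%:R) (ln n%:R) (ln 2) => a b c h2.
have -> : n%:R * (b - 1 + 2 * c + (4 * b + 1) / n%:R) =
  n%:R * b - n%:R + n%:R * (2 * c) + (4 * b + 1) by field; rewrite gt_eqF.
lra.
Qed.

End FactorialBounds.

Section Abel.
Variable R : realType.

Lemma mertens_gt0 z : 0 < mertens R z.
Proof.
by apply: prodr_gt0 => p pp; rewrite divr_gt0// ltr0n; have := prime_gt1 pp; lia.
Qed.

Lemma mertensS z : mertens R z.+1 =
  mertens R z * (if prime z.+1 then z.+1%:R / z%:R else 1).
Proof. by rewrite /mertens big_mkcond big_ord_recr -big_mkcond. Qed.

Lemma mertens_sumS z : mertens_sum R z.+1 =
  mertens_sum R z + (if prime z.+1 then mweight R z.+1 * ln z.+1%:R else 0).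
Proof. by rewrite /mertens_sum big_mkcond big_ord_recr -big_mkcond. Qed.

Lemma mertens_abel (y : nat) (c : R) : (5 <= y)%N ->
  (forall n, (y < n)%N -> mertens_sum R n <= ln n%:R + c) ->
  forall z, (y <= z)%N ->
  ln (mertens R z) <= ln (mertens R y)
    + ((mertens_sum R z - c) / ln z.+1%:R - (mertens_sum R y - c) / ln y.+1%:R)
    + (ln (ln z.+1%:R) - ln (ln y.+1%:R)) + (y%:R^-1 - z%:R^-1).
Proof.
move=> y5 bc z yz; rewrite -(subnKC yz); elim: (z - y)%N => {z yz} [|k IH].
  by rewrite addn0 !subrr !addr0.
rewrite addnS; set z := (y + k)%N in IH *.
have yz : (y <= z)%N by rewrite leq_addr.
apply: le_trans (_ : _ <= ln (mertens R z) + (if prime z.+1 then z%:R^-1 else 0)) _.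
  rewrite mertensS lnM ?posrE ?mertens_gt0//; last first.
    by case: ifP => // _; rewrite divr_gt0// ltr0n; lia.
  rewrite lerD2l; case: ifP => _; last by rewrite ln1.
  have z0 : z%:R != 0 :> R by rewrite pnatr_eq0; lia.
  have -> : z.+1%:R / z%:R = 1 + z%:R^-1 :> R by rewrite -natr1 mulrDl divff// mul1r.
  by apply: le_ln1Dx; apply: lt_le_trans (ltrN10 _) _.
apply: le_trans (lerD IH (lexx _)) _.
have m0 : 1 < z.+1%:R :> R by rewrite ltr1n; lia.
have m1 : z.+1%:R < z.+2%:R :> R by rewrite ltr_nat.
have z0 : 0 < z%:R :> R by rewrite ltr0n; lia.
have l0 : 0 < ln z.+1%:R :> R by rewrite ln_gt0.
have l1 : ln z.+1%:R < ln z.+2%:R :> R by rewrite ltr_ln// ?posrE; lra.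
have l2 : 0 < ln z.+2%:R :> R by lra.
have := bc z.+1 yz; rewrite mertens_sumS.
have -> : (if prime z.+1 then mweight R z.+1 * ln z.+1%:R else 0) =
    (if prime z.+1 then z.+1%:R^-1 else 0) * ln z.+1%:R.
  by case: ifP => _; rewrite ?mul0r// /mweight leqNgt ltnS (leq_trans y5 yz).
have -> : (if prime z.+1 then z%:R^-1 else 0) =
    (if prime z.+1 then z.+1%:R^-1 else 0) + (if prime z.+1 then z%:R^-1 - z.+1%:R^-1 else 0) :> R.
  by case: ifP => _; rewrite ?addr0// addrC subrK.
have dz : (if prime z.+1 then z%:R^-1 - z.+1%:R^-1 else 0) <= z%:R^-1 - z.+1%:R^-1 :> R.
  by case: ifP => // _; rewrite subr_ge0 lef_pV2 ?posrE ?ltr0n ?ler_nat//; lia.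
have lr : 1 - ln z.+1%:R / ln z.+2%:R <= ln (ln z.+2%:R) - ln (ln z.+1%:R) :> R.
  have := @ln_ge1Binv R (ln z.+2%:R / ln z.+1%:R) (divr_gt0 l2 l0).
  by rewrite invf_div ln_div// posrE.
move: dz lr; move: (if prime z.+1 then z.+1%:R^-1 else 0 : R) => d.
move: (if _ then _ else _) => d'.
move: (ln (ln z.+2%:R)) (ln (ln z.+1%:R)) (ln (ln y.+1%:R)) => ll2 ll1 ll0.
move: (ln z.+2%:R) (ln z.+1%:R) l0 l1 l2 => b a a0 ab b0 dz lr hb.
have key : (mertens_sum R z + d * a - c) * (a^-1 - b^-1) <= 1 - a / b.
  have -> : 1 - a / b = a * (a^-1 - b^-1) by field; rewrite !gt_eqF.
  rewrite ler_wpM2r//; last by lra.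
  by rewrite subr_ge0 lef_pV2 ?posrE ?ltW.
have e : (mertens_sum R z + d * a - c) / b = (mertens_sum R z - c) / a + d
   - (mertens_sum R z + d * a - c) * (a^-1 - b^-1).
  by field; rewrite !gt_eqF.
rewrite e; move: key; move: ((mertens_sum R z - c) / a : R) ((mertens_sum R z + d * a - c) * (a^-1 - b^-1) : R) => X Y key.
move: (z%:R^-1) (z.+1%:R^-1) (y%:R^-1) dz => i1 i2 i3 dz; lra.
Qed.

End Abel.

Section Numerics.
Variable R : realType.

Lemma pow_expn (a b : nat) : Nat.pow a b = (a ^ b)%N.
Proof. by elim: b => //= b ->; rewrite expnS. Qed.

Lemma leq_of_N (a b : nat) : BinNat.N.leb (BinNat.N.of_nat a) (BinNat.N.of_nat b) -> (a <= b)%N.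
Proof. by move=> /BinNat.N.leb_le; lia. Qed.

Definition primes_upto (n : nat) : seq nat := [seq p <- index_iota 0 n.+1 | prime p].

Definition prodN (s : seq nat) : BinNums.N :=
  foldr (fun p m => BinNat.N.mul (BinNat.N.of_nat p) m) (BinNat.N.of_nat 1) s.

Lemma prodNE (s : seq nat) : prodN s = BinNat.N.of_nat (\prod_(p <- s) p)%N.
Proof.
elim: s => [|p s IH]; first by rewrite big_nil.
by rewrite big_cons /= IH Nnat.Nat2N.inj_mul.
Qed.

Lemma prod_511 : (100 * \prod_(p <- primes_upto 511) p <=
   1121 * \prod_(p <- [seq p.-1 | p <- primes_upto 511]) p)%N.
Proof.
apply: leq_of_N; rewrite !Nnat.Nat2N.inj_mul -!prodNE.
by vm_compute.
Qed.

Definition log64 (p : nat) : nat :=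
  BinNat.N.to_nat (BinNat.N.log2 (BinNat.N.pow (BinNat.N.of_nat p) (BinNat.N.of_nat 64))).

Lemma log64_le (p : nat) : (0 < p)%N -> (2 ^ log64 p <= p ^ 64)%N.
Proof.
move=> p0; apply/ssrnat.leP; rewrite -!pow_expn /log64.
set x := BinNat.N.pow _ _.
have x0 : BinNat.N.lt BinNums.N0 x.
  have : x <> BinNums.N0.
    apply: BinNat.N.pow_nonzero => h.
    by move: p0; rewrite -[p]Nnat.Nat2N.id h.
  by case: (x).
have [h _] := BinNat.N.log2_spec x x0.
have -> : Nat.pow p 64 = BinNat.N.to_nat x.
  by rewrite /x Nnat.N2Nat.inj_pow !Nnat.Nat2N.id.
rewrite -[X in Nat.pow X]/(BinNat.N.to_nat (BinNat.N.of_nat 2)) -Nnat.N2Nat.inj_pow.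
lia.
Qed.

Definition mden (p : nat) : nat := if (p <= 5)%N then p.-1 else p.

(* [2000 * mweight p * log p / log 2], rounded down, from the bit length of [p^64]. *)
Definition mterm (p : nat) : BinNums.N :=
  BinNat.N.div (BinNat.N.mul (BinNat.N.of_nat 2000)
     (BinNat.N.log2 (BinNat.N.pow (BinNat.N.of_nat p) (BinNat.N.of_nat 64))))
   (BinNat.N.of_nat (64 * mden p)%N).

Lemma sum_mterm_511 : (8 * 2000 <= \sum_(p <- primes_upto 511) BinNat.N.to_nat (mterm p))%N.
Proof.
have sumE s : \sum_(p <- s) BinNat.N.to_nat (mterm p) =
    BinNat.N.to_nat (foldr (fun p m => BinNat.N.add (mterm p) m) BinNums.N0 s).
  elim: s => [|p s IH]; first by rewrite big_nil.
  by rewrite big_cons IH /= Nnat.N2Nat.inj_add.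
rewrite sumE; apply: leq_of_N; rewrite Nnat.N2Nat.id Nnat.Nat2N.inj_mul.
by vm_compute.
Qed.

Lemma mterm_le (p : nat) : prime p ->
  (BinNat.N.to_nat (mterm p))%:R * (ln 2 / 2000) <= mweight R p * ln p%:R.
Proof.
move=> pp; have p0 := prime_gt0 pp; have p1 := prime_gt1 pp.
have d0 : (0 < mden p)%N by rewrite /mden; case: ifP => _; lia.
have d0' : 0 < (mden p)%:R :> R by rewrite ltr0n.
have -> : mweight R p = (mden p)%:R^-1 by rewrite /mweight /mden; case: ifP.
have t1 : (BinNat.N.to_nat (mterm p) * (64 * mden p) <= 2000 * log64 p)%N.
  rewrite /mterm /log64; set l := BinNat.N.log2 _.
  have : (64 * mden p <> 0)%N by lia.
  move: (64 * mden p)%N => d dn0.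
  have := BinNat.N.Div0.mul_div_le (BinNat.N.mul (BinNat.N.of_nat 2000) l) (BinNat.N.of_nat d).
  by move: (BinNat.N.div _ _) => q; nia.
have l2 : 0 < ln 2 :> R by rewrite ln_gt0// ltr1n.
have t2 : (log64 p)%:R * ln 2 <= 64 * ln p%:R :> R.
  rewrite !mulr_natl -!lnXn// ?ltr0n// -!natrX.
  by rewrite ler_ln ?posrE ?ltr0n ?expn_gt0 ?p0// ler_nat log64_le.
have t3 : (BinNat.N.to_nat (mterm p))%:R * (64 * (mden p)%:R) <= 2000 * (log64 p)%:R :> R.
  by rewrite -!natrM ler_nat.
rewrite mulrC ler_pdivlMl//.
move: t2 t3; move: ((BinNat.N.to_nat _)%:R : R) ((log64 p)%:R : R) ((mden p)%:R : R) => a b c t2 t3.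
have : (a * (64 * c)) * ln 2 <= (2000 * b) * ln 2 by rewrite ler_pM2r.
have := t2; lra.
Qed.

Lemma mertens_sumE (n : nat) :
  mertens_sum R n = \sum_(p <- primes_upto n) mweight R p * ln p%:R.
Proof.
by rewrite /mertens_sum -(big_mkord prime (fun p => mweight R p * ln p%:R)) big_filter.
Qed.

Lemma mertensE (n : nat) :
  mertens R n = \prod_(p <- primes_upto n) (p%:R / p.-1%:R).
Proof.
by rewrite /mertens -(big_mkord prime (fun p => p%:R / p.-1%:R : R)) big_filter.
Qed.

Lemma mertens_sum_511 : 8 * ln 2 <= mertens_sum R 511.
Proof.
rewrite mertens_sumE; have := sum_mterm_511.
have : all prime (primes_upto 511) by exact: filter_all.
move: (primes_upto 511) => L /allP Lp h.
apply: (@le_trans _ _ (\sum_(p <- L) (BinNat.N.to_nat (mterm p))%:R * (ln 2 / 2000))).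
  rewrite -mulr_suml -natr_sum.
  have l2 : 0 < ln 2 :> R by rewrite ln_gt0// ltr1n.
  move: h; rewrite -(ler_nat R) natrM; move: (\sum_(p <- L) _)%:R => S h.
  have w0 : 0 < 2000%:R :> R by rewrite ltr0n.
  move: (2000%:R : R) w0 h => w w0 h.
  apply: le_trans (ler_wpM2r _ h); last by rewrite divr_ge0// ltW.
  by rewrite mulrA mulrAC mulfK ?gt_eqF.
rewrite !big_seq; apply: ler_sum => p /Lp; exact: mterm_le.
Qed.

Lemma mertens_511 : mertens R 511 <= 1121 / 100.
Proof.
rewrite mertensE; have := prod_511.
have : all prime (primes_upto 511) by exact: filter_all.
move: (primes_upto 511) => L /allP Lp; rewrite -(ler_nat R) !natrM.
rewrite big_map prodf_div -!natr_prod => h.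
have q0 : 0 < (\prod_(p <- L) p.-1)%:R :> R.
  by rewrite ltr0n big_seq prodn_cond_gt0// => p /Lp/prime_gt1; lia.
rewrite ler_pdivrMr//; move: h; move: (\prod_(p <- L) p)%:R (\prod_(p <- L) p.-1)%:R => a b h; lra.
Qed.

End Numerics.

Section MertensBound.
Variable R : realType.
Implicit Types t : R.

Lemma expR_ge_deg2 t : 0 <= t -> 1 + t + t ^+ 2 / 2 <= expR t.
Proof.
move=> t0; rewrite -subr_ge0.
apply: (@ge0_of_derive R (fun y => expR y - (1 + y + y ^+ 2 / 2))
  (fun y => expR y - (1 + y))) => //.
- by rewrite expR0; ring.
- move=> y; apply: is_derive_eq.
  by rewrite /GRing.scale /=; field.
- by move=> y _ _; rewrite subr_ge0 expR_ge1Dx.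
Qed.

Lemma expR_ge_deg3 t : 0 <= t -> 1 + t + t ^+ 2 / 2 + t ^+ 3 / 6 <= expR t.
Proof.
move=> t0; rewrite -subr_ge0.
apply: (@ge0_of_derive R (fun y => expR y - (1 + y + y ^+ 2 / 2 + y ^+ 3 / 6))
  (fun y => expR y - (1 + y + y ^+ 2 / 2))) => //.
- by rewrite expR0; ring.
- move=> y; apply: is_derive_eq.
  by rewrite /GRing.scale /=; field.
- by move=> y y0 _; rewrite subr_ge0 expR_ge_deg2.
Qed.

Lemma expRN_le_deg2 t : 0 <= t -> expR (- t) <= 1 - t + t ^+ 2 / 2.
Proof.
move=> t0; rewrite -subr_ge0.
apply: (@ge0_of_derive R (fun y => 1 - y + y ^+ 2 / 2 - expR (- y))
  (fun y => expR (- y) - (1 - y))) => //.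
- by rewrite oppr0 expR0; ring.
- move=> y; apply: is_derive_eq.
  by rewrite /GRing.scale /=; field.
- by move=> y _ _; rewrite subr_ge0 expR_ge1Dx.
Qed.

Lemma expRN_ge_deg3 t : 0 <= t -> 1 - t + t ^+ 2 / 2 - t ^+ 3 / 6 <= expR (- t).
Proof.
move=> t0; rewrite -subr_ge0.
apply: (@ge0_of_derive R (fun y => expR (- y) - (1 - y + y ^+ 2 / 2 - y ^+ 3 / 6))
  (fun y => 1 - y + y ^+ 2 / 2 - expR (- y))) => //.
- by rewrite oppr0 expR0; ring.
- move=> y; apply: is_derive_eq.
  by rewrite /GRing.scale /=; field.
- by move=> y y0 _; rewrite subr_ge0 expRN_le_deg2.
Qed.

Lemma sqr_le_trans (a b x : R) : 0 <= a -> b <= a ^+ 2 -> a <= x -> b <= x ^+ 2.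
Proof.
by move=> a0 ba ax; apply: le_trans ba _; rewrite ler_pXn2r// nnegrE// (le_trans a0).
Qed.

Lemma expR_mul8 t : expR (8%:R * t) = ((expR t ^+ 2) ^+ 2) ^+ 2.
Proof. by rewrite expRM_natl -!exprM. Qed.

Lemma ln2_le : ln 2 <= 52 / 75 :> R.
Proof.
rewrite -ler_expR lnK ?posrE//.
have -> : 52 / 75 = 8%:R * (13 / 150) :> R by field.
rewrite expR_mul8.
apply: (@sqr_le_trans (338 / 239)); [lra|lra|].
apply: (@sqr_le_trans (861 / 724)); [lra|lra|].
apply: (@sqr_le_trans (253 / 232)); [lra|lra|].
apply: le_trans (@expR_ge_deg3 (13 / 150) _); lra.
Qed.

Lemma ln2_ge : 70 / 101 <= ln 2 :> R.
Proof.
rewrite -ler_expR lnK ?posrE// -[leRHS]invrK -[leLHS]invrK lef_pV2 ?posrE ?invr_gt0 ?expR_gt0//.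
rewrite -expRN.
have -> : - (70 / 101) = 8%:R * - (35 / 404) :> R by field.
rewrite expR_mul8.
apply: (@sqr_le_trans (577 / 816)); [lra|lra|].
apply: (@sqr_le_trans (1649 / 1961)); [lra|lra|].
apply: (@sqr_le_trans (674 / 735)); [lra|lra|].
apply: le_trans (@expRN_ge_deg3 (35 / 404) _); lra.
Qed.

Lemma expR_11_60_le : expR (11 / 60) <= 841 / 700 :> R.
Proof.
have := @expRN_ge_deg3 (11 / 60) (ltac:(lra)); rewrite expRN => h.
have r0 := expR_gt0 (11 / 60 : R).
move: (expR _) r0 h => x x0 h.
have : (1 - 11 / 60 + (11 / 60) ^+ 2 / 2 - (11 / 60) ^+ 3 / 6) * x <= 1.
  by rewrite -ler_pdivlMr// div1r.
lra.
Qed.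

Lemma mertens_constant_le : 1121 / 100 / (9 * (70 / 101)) * (841 / 700) <= 54 / 25 :> R.
Proof. by lra. Qed.

Lemma mertens_le (z : nat) : (512 <= z)%N ->
  mertens R z <= 54 / 25 * ln z.+1%:R.
Proof.
move=> z512; have l2u := ln2_le; have l2l := ln2_ge.
have l512 : ln 512%:R = 9 * ln 2 :> R.
  by rewrite (_ : 512 = 2 ^ 9)%N// natrX lnXn// mulr_natl.
pose c : R := - 1 + 2 * ln 2 + (4 * ln 512%:R + 1) / 512%:R.
have bc n : (511 < n)%N -> mertens_sum R n <= ln n%:R + c.
  move=> n512; have n0 : (0 < n)%N by apply: leq_trans n512.
  apply: le_trans (mertens_sum_le R n0) _.
  rewrite /c l512.
  have w0 : 0 < 512%:R :> R by rewrite ltr0n.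
  have n0' : 0 < n%:R :> R by rewrite ltr0n.
  have wn : 512%:R <= n%:R :> R by rewrite ler_nat.
  have lnn : ln n%:R <= 9 * ln 2 + n%:R / 512%:R - 1 :> R.
    have q0 : 0 < n%:R / 512%:R :> R by rewrite divr_gt0.
    have -> : n%:R = 512%:R * (n%:R / 512%:R) :> R by rewrite mulrCA divff ?gt_eqF// mulr1.
    rewrite lnM ?posrE// l512 [512%:R * _]mulrCA divff ?gt_eqF// mulr1.
    have := @le_ln1Dx R (n%:R / 512%:R - 1); rewrite addrCA subrr addr0.
    by move=> /(_ _); have h : -1 < n%:R / 512%:R - 1 :> R by [lra]; move=> /(_ h); lra.
  have : (4 * ln n%:R + 1) / n%:R <= (4 * (9 * ln 2) + 1) / 512%:R :> R.
    rewrite ler_pdivrMr// mulrAC -mulrA.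
    have q1 : 1 <= n%:R / 512%:R :> R by rewrite ler_pdivlMr// mul1r.
    move: (n%:R / 512%:R : R) q1 lnn => q q1 lnn.
    have : 0 <= (q - 1) * (36 * ln 2 - 3) by rewrite mulr_ge0//; lra.
    lra.
  lra.
have := @mertens_abel R 511 c isT bc z (ltnW z512).
have l2z : 0 < ln z.+1%:R :> R by rewrite ln_gt0// ltr1n ltnS (leq_trans _ z512).
have h1 : (mertens_sum R z - c) / ln z.+1%:R <= 1.
  rewrite ler_pdivrMr// mul1r lerBlDr; apply: le_trans (bc z z512) _.
  by rewrite lerD2r ler_ln ?posrE ?ltr0n ?ler_nat//; lia.
have z0 : 0 <= z%:R^-1 :> R by rewrite invr_ge0.
have i511 : (511%:R : R)^-1 = 1 / 511 by rewrite div1r.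
rewrite l512 i511 => abel.
have b8 := mertens_sum_511 R; have M0 := mertens_511 R; have M1 := mertens_gt0 R 511.
have x9 : 0 < 9 * ln 2 :> R by rewrite mulr_gt0// ln_gt0// ltr1n.
have E : 1 + 1 / 511 - (mertens_sum R 511 - c) / (9 * ln 2) <= 11 / 60.
  rewrite lerBlDr -lerBlDl ler_pdivlMr//.
  have -> : c = - 1 + 2 * ln 2 + (4 * (9 * ln 2) + 1) / 512 by rewrite /c l512.
  lra.
have main : ln (mertens R z) <= ln (mertens R 511 / (9 * ln 2) * ln z.+1%:R) + 11 / 60.
  rewrite lnM ?posrE ?divr_gt0// ln_div ?posrE//.
  move: h1 abel E z0.
  move: ((mertens_sum R z - c) / _) ((mertens_sum R 511 - c) / _) (z%:R^-1) => a b d h1 abel E z0.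
  lra.
rewrite -ler_expR expRD !lnK ?posrE ?mulr_gt0 ?divr_gt0 ?invr_gt0 ?mertens_gt0// in main.
apply: le_trans main _; rewrite mulrAC ler_wpM2r ?(ltW l2z)//.
apply: (@le_trans _ _ (1121 / 100 / (9 * (70 / 101)) * (841 / 700))); last exact: mertens_constant_le.
apply: ler_pM; [by rewrite divr_ge0// ltW|exact: expR_ge0| |exact: expR_11_60_le].
apply: ler_pM; rewrite ?invr_ge0 ?(ltW M1) ?(ltW x9)//.
by rewrite lef_pV2 ?posrE// ?ler_wpM2l ?ler0n// mulr_gt0 ?divr_gt0 ?ltr0n.
Qed.

End MertensBound.

(** * Euler's constant *)

Section EulerGamma.
Variable R : realType.

Lemma le_sinh (w : R) : 0 <= w -> w <= (expR w - expR (- w)) / 2.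
Proof.
move=> w0; rewrite -subr_ge0.
apply: (@ge0_of_derive R (fun y => (expR y - expR (- y)) / 2 - y)
  (fun y => (expR y + expR (- y)) / 2 - 1)) => //.
- by rewrite oppr0 subrr mul0r addr0.
- move=> y; apply: is_derive_eq.
  by rewrite /GRing.scale /=; field.
- move=> y _ _; have := expR_ge1Dx y; have := expR_ge1Dx (- y); lra.
Qed.

Lemma ln1D_le (x : R) : 0 <= x -> ln (1 + x) <= (x + x / (1 + x)) / 2.
Proof.
move=> x0; have x1 : 0 < 1 + x by rewrite ltr_wpDr.
have w0 : 0 <= ln (1 + x) by rewrite ln_ge0// lerDl.
apply: le_trans (le_sinh w0) _; rewrite expRN lnK ?posrE//.
rewrite le_eqVlt; apply/orP; left; apply/eqP; field.
by rewrite gt_eqF.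
Qed.

(* [H_n - log n] decreases and [H_n - log n - 1/(2n)] increases to gamma. *)
Let a (n : nat) : R := series (@harmonic R) n.+1 - ln n.+1%:R.
Let b (n : nat) : R := a n - (2 * n.+1%:R)^-1.

Let ratio (n : nat) : ln n.+2%:R = ln n.+1%:R + ln (1 + n.+1%:R^-1) :> R.
Proof.
have n0 : 0 < n.+1%:R :> R by rewrite ltr0n.
rewrite -lnM ?posrE ?addr_gt0 ?invr_gt0//; congr ln.
by rewrite mulrDr mulr1 divff ?gt_eqF// natr1.
Qed.

Let a_step n : a n.+1 <= a n.
Proof.
rewrite /a [series harmonic n.+2]seriesSr ratio /=.
have n0 : 0 < n.+1%:R :> R by rewrite ltr0n.
have x0 : 0 < 1 + n.+1%:R^-1 :> R by rewrite addr_gt0// invr_gt0.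
have := ln_ge1Binv x0.
have -> : 1 - (1 + n.+1%:R^-1)^-1 = n.+2%:R^-1 :> R.
  by rewrite -[n.+2%:R]natr1; field; rewrite !gt_eqF// addr_gt0.
move: (n.+2%:R^-1) (ln (1 + _)) => x y h; lra.
Qed.

Let b_step n : b n <= b n.+1.
Proof.
rewrite /b /a [series harmonic n.+2]seriesSr ratio /=.
have n0 : 0 < n.+1%:R :> R by rewrite ltr0n.
have x0 : 0 <= n.+1%:R^-1 :> R by rewrite invr_ge0 ltW.
have := ln1D_le x0.
have -> : n.+1%:R^-1 / (1 + n.+1%:R^-1) = n.+2%:R^-1 :> R.
  by rewrite -[n.+2%:R]natr1; field; rewrite !gt_eqF// addr_gt0.
rewrite !invfM; move: (n.+2%:R^-1) (n.+1%:R^-1) (ln (1 + _)) => x y w h; lra.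
Qed.

Let a_lb n : (0 < n)%N -> 5 / 4 - ln 2 <= a n.
Proof.
case: n => // n _.
have bn : 5 / 4 - ln 2 <= b n.+1.
  elim: n => [|n IH]; last exact: le_trans IH (b_step _).
  rewrite /b /a !seriesSr /series /= big_nil ?big_geq//; lra.
apply: le_trans bn _; rewrite /b gerBl invr_ge0 mulr_ge0//.
Qed.

Lemma euler_gamma_ge : 5 / 4 - ln 2 <= euler_gamma R.
Proof.
have cva : cvgn a.
  apply: nonincreasing_is_cvgn; first by apply/nonincreasing_seqP; exact: a_step.
  exists (Num.min (5 / 4 - ln 2) (a 0)) => _ [n _ <-].
  case: n => [|n]; rewrite ge_min ?lexx ?orbT//.
  by rewrite a_lb.
have -> : euler_gamma R = limn a.
  rewrite /euler_gamma; apply/cvg_lim => //.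
  rewrite -(cvg_shiftS (fun n => series harmonic n - ln n%:R)).
  exact: cva.
apply: limr_ge => //; exists 1%N => // n /= n1; exact: a_lb.
Qed.

Lemma expR_euler_gamma_ge : 697 / 400 <= expR (euler_gamma R) :> R.
Proof.
have h : expR (5 / 4 - ln 2) <= expR (euler_gamma R) by rewrite ler_expR euler_gamma_ge.
apply: le_trans h; rewrite expRB lnK ?posrE// ler_pdivlMr//.
have -> : 697 / 400 * 2 = 697 / 200 :> R by field.
have -> : 5 / 4 = 8%:R * (5 / 32) :> R by field.
rewrite expR_mul8.
apply: (@sqr_le_trans R (603 / 323)); [lra|lra|].
apply: (@sqr_le_trans R (138 / 101)); [lra|lra|].
apply: (@sqr_le_trans R (83 / 71)); [lra|lra|].
apply: le_trans (@expR_ge_deg3 R (5 / 32) _); lra.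
Qed.

End EulerGamma.

(** * The large sieve for primes *)

Section Applied.
Variable R : realType.
Local Notation normc := (@Normc.normc R).

Lemma kappa_bound (k p : nat) : (0 < k)%N -> (13 <= p)%N -> (13 / 4) ^+ k <= p%:R :> R ->
  3 * p%:R <= (p.-1)%:R * p%:R `^ (k%:R^-1) :> R.
Proof.
move=> k0 p13 pk; have k0' : k%:R != 0 :> R by rewrite pnatr_eq0 -lt0n.
have h : 13 / 4 <= p%:R `^ (k%:R^-1) :> R.
  have -> : 13 / 4 = ((13 / 4) ^+ k) `^ (k%:R^-1) :> R.
    by rewrite -powR_mulrn// -powRrM divff// powRr1.
  by apply: ge0_ler_powR; rewrite ?invr_ge0 ?nnegrE ?exprn_ge0.
have p1 : p%:R = (p.-1)%:R + 1 :> R by rewrite natr1 prednK//; lia.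
have p12 : 12 <= (p.-1)%:R :> R by rewrite (ler_nat _ 12); lia.
apply: (@le_trans _ _ ((p.-1)%:R * (13 / 4))); first by rewrite p1; lra.
by rewrite ler_wpM2l.
Qed.

Lemma collect_errors (x1 x2 x3 x4 x5 eta : R) : x1 + x2 + 3 * x3 + x4 <= eta ->
  41 / 35 + x1 + (x5 + x2) + 3 * x3 + x4 <= 41 / 35 + x5 + eta.
Proof. by lra. Qed.

Lemma ln_ge1_nat (z : nat) : (512 <= z)%N -> 1 <= ln z.+1%:R :> R.
Proof.
move=> z512; apply: le_trans (_ : ln 512%:R <= _).
  rewrite (_ : 512 = 2 ^ 9)%N// natrX lnXn// -[ln 2 *+ 9]mulr_natl; have := ln2_ge R; lra.
by rewrite ler_ln ?posrE ?ltr0n// ler_nat leqW.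
Qed.

Variables (I : finType) (th : I -> R) (u : nat -> R[i]) (delta N : R).
Hypotheses (N11 : 11 <= N) (delta0 : 0 < delta) (delta2 : delta <= 2^-1).
Hypothesis sep : forall i j, i != j -> forall m : int, delta <= `|th i - th j - m%:~R|.
Let M := N + delta^-1.
Let K : R := #|I|%:R.
Let n := Num.truncn N.

Let N0 : 0 < N. Proof. by move: N11; lra. Qed.
Let nN : n%:R <= N. Proof. by rewrite truncn_le// ltW. Qed.
Let Nn : N < n%:R + 1. Proof. by rewrite natr1; exact: truncnS_gt. Qed.
Let n10 : (10 <= n)%N.
Proof. by rewrite -ltnS -(ltr_nat R) -natr1; move: N11 Nn; lra. Qed.
Let n0 : 0 < n%:R :> R. Proof. by rewrite ltr0n (leq_trans _ n10). Qed.
Let ninv : n%:R^-1 <= 2 * N^-1 :> R.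
Proof.
rewrite -[leRHS]invrK lef_pV2 ?posrE ?invr_gt0 ?mulr_gt0 ?invr_gt0//.
by rewrite invfM invrK; move: Nn N11; lra.
Qed.
Let S := \sum_i normc (\sum_(p < n.+1 | prime p) u p * e (th i * p%:R)) ^+ 2.
Let Su := \sum_(p < n.+1 | prime p) normc (u p) ^+ 2.
Let Su0 : 0 <= Su. Proof. by apply: sumr_ge0 => p _; exact: sqr_ge0. Qed.

Lemma trivial_applied : S <= (41 / 35 * M + 5) * Su.
Proof.
apply: le_trans (large_sieve_trivial u n10 delta0 delta2 sep) _.
by rewrite ler_wpM2r// lerD2r ler_wpM2l// lerD2r.
Qed.

Lemma sieve_applied (A k : nat) (theta eta : R) : (512 <= A * #|I|)%N -> (0 < k)%N ->
  (13 / 4) ^+ k <= (A * #|I|)%:R :> R -> 0 < theta -> theta <= 2^-1 ->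
  5 / N + 222 / A%:R * N `^ (- (1 / 5)) + 3 * (K * ln N *
     (80 * N `^ (2 * theta * (1 + k%:R^-1) - 1) + 5 * N `^ (9 / 20 * (k%:R^-1 - 1))))
     + N `^ (theta - 1) * K * ln N <= eta ->
  S <= 54 / 25 * ln (A * #|I|).+1%:R / (theta * ln N) *
       (41 / 35 + 18 / 5 / A%:R + eta) * M * Su.
Proof.
move=> z512 k0 zk th0 th1 etaP.
set z := (A * #|I|)%N in z512 zk *; set ka : R := k%:R^-1 in etaP *.
have half : 2^-1 <= 54 / 25 * 1 :> R by lra.
have ka0 : 0 <= ka by rewrite invr_ge0.
have ka1 : ka <= 1 by rewrite invf_le1 ?ltr0n// ler1n.
have lN1 : 1 <= ln N.
  rewrite -ler_expR lnK ?posrE//; apply: le_trans N11.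
  have := @expRN_ge_deg3 R 1 ler01; rewrite expRN => h.
  have e0 := expR_gt0 (1 : R); move: (expR 1) e0 h => x x0 h.
  have : (1 - 1 + 1 ^+ 2 / 2 - 1 ^+ 3 / 6) * x <= 1 by rewrite -ler_pdivlMr// div1r.
  lra.
pose Q := Num.truncn (N `^ theta).
have N1 : 1 <= N by move: N11; lra.
have Np1 : 1 <= N `^ theta by rewrite -(powRr0 N) ler_powR// ltW.
have Q1 : (0 < Q)%N by rewrite truncn_gt0.
have QN : Q%:R <= N `^ theta by rewrite truncn_le// powR_ge0.
pose U := N `^ (9 / 20).
have U1 : 1 <= U by rewrite -(powRr0 N) ler_powR//; apply: divr_ge0.
pose J := (Num.truncn (2 * ln N)).+1.
have J3 : J%:R <= 3 * ln N.
  rewrite /J -natr1; have : (Num.truncn (2 * ln N))%:R <= 2 * ln N by rewrite truncn_le//; lra.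
  lra.
have QQ : (Q * Q)%:R <= N `^ (2 * theta).
  rewrite natrM mulrDl mul1r powRD; last by rewrite (gt_eqF N0) implybT.
  by apply: ler_pM.
have QJ : (Q * Q)%:R <= U * 2 ^+ J.
  apply: le_trans QQ _; apply: (@le_trans _ _ N).
    by rewrite -[leRHS]powRr1 ?(ltW N0)// ler_powR//; lra.
  apply: (@le_trans _ _ (2 ^+ J)); last by rewrite ler_peMl// exprn_ge0.
  rewrite -ler_ln ?posrE ?exprn_gt0// lnXn// -[ln 2 *+ J]mulr_natl.
  have : 2 * ln N < J%:R by exact: truncnS_gt.
  have l2 : 1 / 2 <= ln 2 :> R by have := ln2_ge R; lra.
  have : J%:R * (1 / 2) <= J%:R * ln 2 :> R by rewrite ler_wpM2l.
  by move: (J%:R * ln 2) => y h1 h2; lra.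
have kP p : prime p -> (z < p)%N -> 3 * p%:R <= (p.-1)%:R * p%:R `^ ka.
  move=> pp zp; have p13 : (13 <= p)%N.
    exact: leq_trans (leq_trans _ z512) (ltnW zp).
  apply: (kappa_bound k0 p13).
  by apply: le_trans zk _; rewrite ler_nat ltnW.
have := large_sieve_core u n10 delta0 delta2 sep (_ : 3 <= z)%N Q1 kP U1 ka0 ka1 QJ.
move=> /(_ (leq_trans _ z512)) => /(_ isT); rewrite -/S -/Su => h.
apply: le_trans h _; rewrite ler_wpM2r//.
have I0 : (0 < #|I|)%N by move: z512; rewrite /z; case: #|I| => //; rewrite muln0.
have A0 : (0 < A)%N by move: z512; rewrite /z; case: (A).
have K0 : 0 < K by rewrite ltr0n.
have K0' := ltW K0.
have A0' : 0 < A%:R :> R by rewrite ltr0n.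
have NM : N <= M by rewrite lerDl invr_ge0 ltW.
have M0 : 0 <= M by apply: le_trans NM; exact: ltW.
have Mn : n%:R + delta^-1 <= M by rewrite lerD2r.
have lz : 1 <= ln z.+1%:R :> R by exact: ln_ge1_nat.
have lN0 : 0 < ln N by exact: lt_le_trans ltr01 lN1.
have lz0 : 0 < ln z.+1%:R :> R by exact: lt_le_trans ltr01 lz.
pose B := 54 / 25 * ln z.+1%:R / (theta * ln N).
have tl0 : 0 < theta * ln N by rewrite mulr_gt0.
have B0 : 0 <= B by rewrite divr_ge0 ?(ltW tl0)// mulr_ge0 ?(ltW lz0)// divr_ge0.
have GB : (Gsum R z Q)^-1 <= B.
  have G1 : 0 < Gsum R z Q by exact: lt_le_trans ltr01 (Gsum_ge1 R z Q1).
  have hG := le_trans (ln_le_harmonic R Q) (harmonic_le_mertens R z Q).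
  have lQ : theta * ln N <= ln Q.+1%:R.
    rewrite -ln_powR ler_ln ?posrE ?ltr0n ?powR_gt0//.
    exact/ltW/truncnS_gt.
  rewrite /B ler_pdivlMr// mulrC ler_pdivrMr//.
  by apply: le_trans lQ (le_trans hG _); rewrite ler_wpM2r ?mertens_le// ltW.
have BK : 1 <= B * ln N.
  have -> : B * ln N = 54 / 25 * ln z.+1%:R / theta by rewrite /B; field; rewrite !gt_eqF.
  rewrite ler_pdivlMr// mul1r; apply: le_trans th1 _; apply: le_trans (_ : 54 / 25 * 1 <= _).
    exact: half.
  by rewrite ler_wpM2l// divr_ge0.
have U4 : 37 * U ^+ 4 / n%:R <= 74 * (M * N `^ (- (1 / 5))).
  have -> : U ^+ 4 = N * (N * N `^ (- (1 / 5))).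
    rewrite -powR_mulrn ?powR_ge0// /U -powRrM.
    rewrite -[X in X * (X * _)](powRr1 (ltW N0)) -!powRD ?(gt_eqF N0) ?implybT//.
    by congr (_ `^ _); field.
  have p0 := powR_ge0 N (- (1 / 5)); move: (N `^ _) p0 => p p0.
  apply: (@le_trans _ _ (37 * (N * (N * p)) * (2 * N^-1))).
    by rewrite ler_wpM2l// !mulr_ge0// ltW.
  have -> : 37 * (N * (N * p)) * (2 * N^-1) = 74 * (N * p) by field; rewrite gt_eqF.
  by rewrite ler_wpM2l// ler_wpM2r.
have V1 : 40 * ((Q * Q)%:R `^ (1 + ka)) / n%:R <= 80 * N `^ (2 * theta * (1 + ka) - 1).
  apply: (@le_trans _ _ (40 * N `^ (2 * theta * (1 + ka)) * (2 * N^-1))).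
    apply: ler_pM; rewrite ?mulr_ge0 ?powR_ge0 ?invr_ge0 ?(ltW n0)//.
    rewrite ler_wpM2l// powRrM; apply: ge0_ler_powR; rewrite ?nnegrE ?powR_ge0 ?addr_ge0//.
  rewrite powRB; last by rewrite (gt_eqF N0) implybT.
  by rewrite powRr1 ?(ltW N0)// le_eqVlt; apply/orP; left; apply/eqP; field; rewrite gt_eqF.
have U2 : U `^ (ka - 1) = N `^ (9 / 20 * (ka - 1)) by rewrite /U -powRrM.
have Kz : K * (3 / z%:R) = 3 / A%:R.
  by rewrite /z natrM /K; field; rewrite !gt_eqF.
have QK : Q%:R * K <= B * (M * (N `^ (theta - 1) * K * ln N)).
  have -> : B * (M * (N `^ (theta - 1) * K * ln N)) = (B * ln N) * (M * N `^ (theta - 1) * K) by ring.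
  apply: (@le_trans _ _ (M * N `^ (theta - 1) * K)); last first.
    by rewrite ler_peMl// !mulr_ge0 ?powR_ge0.
  rewrite ler_wpM2r//; apply: le_trans QN _.
  have -> : N `^ theta = N * N `^ (theta - 1) by rewrite mulr_powRB1 ?(ltW N0).
  by rewrite ler_wpM2r ?powR_ge0.
set X := 80 * _ + 5 * _ in etaP.
have X0 : 0 <= X by rewrite addr_ge0// mulr_ge0 ?powR_ge0.
have X1 : 40 * ((Q * Q)%:R `^ (1 + ka)) / n%:R + 5 * U `^ (ka - 1) <= X.
  by rewrite /X U2 lerD2r.
set p := N `^ (- (1 / 5)) in U4 etaP; have p0 : 0 <= p by exact: powR_ge0.
apply: (@le_trans _ _ (B * (M * (41 / 35 + 5 / N + 3 / A%:R * (6 / 5 + 74 * p) + 3 * (K * ln N * X)))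
    + B * (M * (N `^ (theta - 1) * K * ln N)))); last first.
  rewrite -mulrDr -mulrDr -/B -[leRHS]mulrA [_ * M]mulrC ler_wpM2l// ler_wpM2l//.
  have -> : 3 / A%:R * (6 / 5 + 74 * p) = 18 / 5 / A%:R + 222 / A%:R * p :> R.
    by field; rewrite gt_eqF.
  exact: collect_errors.
have Mn0 : 0 <= n%:R + delta^-1 by rewrite addr_ge0 ?ltW// invr_gt0.
have U40 : 0 <= 37 * U ^+ 4 / n%:R by rewrite divr_ge0 ?(ltW n0)// mulr_ge0// exprn_ge0// powR_ge0.
have X10 : 0 <= 40 * ((Q * Q)%:R `^ (1 + ka)) / n%:R + 5 * U `^ (ka - 1).
  by rewrite addr_ge0// ?divr_ge0 ?mulr_ge0 ?powR_ge0// ltW.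
apply: lerD => //; apply: ler_pM => //.
- by rewrite invr_ge0; apply: le_trans (Gsum_ge1 R z Q1).
- rewrite addr_ge0//; first by rewrite addr_ge0// mulr_ge0.
  rewrite mulr_ge0// addr_ge0//; last by rewrite mulr_ge0// mulr_ge0.
  by rewrite mulr_ge0 ?divr_ge0// addr_ge0// mulr_ge0.
rewrite [K * (_ + _)]mulrDr [K * (3 / z%:R * _)]mulrA Kz.
have t1 : 41 / 35 * (n%:R + delta^-1) <= 41 / 35 * M by rewrite ler_wpM2l.
have t2 : 5 <= 5 / N * M :> R by rewrite mulrAC ler_pdivlMr// ler_wpM2l.
have t3 : 3 / A%:R * (6 / 5 * (n%:R + delta^-1) + 37 * U ^+ 4 / n%:R) <=
    3 / A%:R * (6 / 5 * M + 74 * (M * p)).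
  rewrite ler_wpM2l ?divr_ge0 ?(ltW A0')//; apply: lerD => //.
  by rewrite ler_wpM2l.
have t4 : K * (J%:R * ((n%:R + delta^-1) * (40 * ((Q * Q)%:R `^ (1 + ka)) / n%:R + 5 * U `^ (ka - 1))))
    <= K * (3 * ln N * (M * X)).
  rewrite ler_wpM2l//; apply: ler_pM => //; first by rewrite mulr_ge0.
  exact: ler_pM.
apply: le_trans (lerD (lerD t1 t2) (lerD t3 t4)) _.
rewrite le_eqVlt; apply/orP; left; apply/eqP; field.
by rewrite !gt_eqF.
Qed.

End Applied.

Section Interface.
Variable R : realType.
Local Notation normc := (@Normc.normc R).

Lemma prime_large_sieve_fset (c delta : R) (X : set (circle R)) (N : R) (u : nat -> R[i]) :
  finite_set X ->
  \sum_(x : fset_set X) normc (\sum_(p < (Num.truncn N).+1 | prime p)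
      u p * e (repr (val x) * p%:R)) ^+ 2
    <= c * ((N + delta^-1) / ln N) * ln (2 * #|{: fset_set X}|%:R)
       * \sum_(p < (Num.truncn N).+1 | prime p) normc (u p) ^+ 2 ->
  prime_large_sieve c delta X N u.
Proof.
move=> finX; rewrite /prime_large_sieve fsbig_finite//= cardfE.
by rewrite big_seq_fsetE.
Qed.

Lemma well_spaced_repr (delta : R) (X : set (circle R)) : finite_set X ->
  well_spaced delta X -> forall x y : fset_set X, x != y ->
  forall m : int, delta <= `|repr (val x) - repr (val y) - m%:~R|.
Proof.
move=> finX wX x y xy m.
have mem (z : fset_set X) : X (val z).
  by have := valP z; rewrite in_fset_set// inE.
apply: le_trans (wX _ _ (mem x) (mem y) _) _; first by [].
rewrite /circle_dist -(reprK (val x)) -(reprK (val y)) -pi_circleB dist_int_pi !reprK.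
exact: dist_int_le.
Qed.

Section Finite.
Variables (I : finType) (th : I -> R) (u : nat -> R[i]) (delta : R).

Lemma spacing_le_half : (1 < #|I|)%N ->
  (forall i j, i != j -> forall m : int, delta <= `|th i - th j - m%:~R|) -> delta <= 2^-1.
Proof.
move=> I1 sep; have /card_gt1P[i [j [_ _ ij]]] := I1.
exact: le_trans (sep i j ij (nint (th i - th j))) (nintP _).
Qed.

Lemma sum_cond_sqr_le (J : finType) (P : pred J) (a : J -> R) :
  (\sum_(j | P j) a j) ^+ 2 <= #|P|%:R * \sum_(j | P j) a j ^+ 2.
Proof.
rewrite expr2 mulr_suml.
apply: (@le_trans _ _ (\sum_(i | P i) \sum_(j | P j) (a i ^+ 2 / 2 + a j ^+ 2 / 2))).
  apply: ler_sum => i _; rewrite mulr_sumr; apply: ler_sum => j _.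
  by have := sqr_ge0 (a i - a j); rewrite sqrrB mulr2n; lra.
set s := \sum_(j | P j) a j ^+ 2.
rewrite (eq_bigr (fun i => #|P|%:R * (a i ^+ 2 / 2) + s / 2)); last first.
  by move=> i _; rewrite big_split /= sumr_const mulr_natl -mulr_suml.
rewrite big_split /= -mulr_sumr -mulr_suml -/s sumr_const -[X in _ + X]mulr_natl.
by rewrite le_eqVlt; apply/orP; left; apply/eqP; field.
Qed.

Lemma sum_sqr_exp_le_card (n : nat) :
  \sum_i normc (\sum_(p < n.+1 | prime p) u p * e (th i * p%:R)) ^+ 2 <=
  #|I|%:R * #|[pred p : 'I_n.+1 | prime p]|%:R * \sum_(p < n.+1 | prime p) normc (u p) ^+ 2.
Proof.
rewrite -mulrA mulr_natl -sumr_const; apply: ler_sum => i _.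
apply: le_trans _ (sum_cond_sqr_le _ _).
rewrite ler_pXn2r ?nnegrE ?normc_ge0//; last by apply: sumr_ge0 => p _; exact: normc_ge0.
apply: le_trans (normc_sum _ _ _) _; apply: ler_sum => p _.
by rewrite Normc.normcM normc_e mulr1.
Qed.

End Finite.

Lemma prime_count_le (N : R) : 10 ^+ 4 <= N ->
  #|[pred p : 'I_(Num.truncn N).+1 | prime p]|%:R <= 29 / 10 * (N / ln N).
Proof.
move=> N4; set n := Num.truncn N.
have N0 : 0 < N by apply: lt_le_trans N4; rewrite exprn_gt0.
pose y := Num.sqrt N.
have y2 : y ^+ 2 = N by rewrite sqr_sqrtr// ltW.
have y100 : 100 <= y.
  rewrite -(@ler_pXn2r _ 2)// ?nnegrE ?sqrtr_ge0// y2; apply: le_trans N4; lra.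
have y0 : 0 < y by lra.
have lNy : ln N = 2 * ln y by rewrite -y2 lnXn// mulr_natl.
have ly0 : 0 < ln y by rewrite ln_gt0//; lra.
pose s := Num.truncn y.
have sy : s%:R <= y by rewrite truncn_le// ltW.
have ys : y < s%:R + 1 by rewrite natr1; exact: truncnS_gt.
have nN : n%:R <= N by rewrite truncn_le// ltW.
have cnt : #|[pred p : 'I_n.+1 | prime p]|%:R <=
    \sum_(p < n.+1 | prime p) ((if (p <= s)%N then 1 else 0) + ln p%:R / ln y).
  rewrite -sumr_const; under [leLHS]eq_bigl do rewrite inE.
  apply: ler_sum => p pp; case: ifP => ps.
    by rewrite lerDl divr_ge0 ?(ltW ly0)// ln_ge0_nat.
  rewrite add0r ler_pdivlMr// mul1r ler_ln ?posrE ?ltr0n ?prime_gt0//.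
  apply: ltW; apply: lt_le_trans ys _; rewrite natr1 ler_nat ltnNge ps//.
apply: le_trans cnt _; rewrite big_split /= -mulr_suml.
have t1 : \sum_(p < n.+1 | prime p) (if (p <= s)%N then 1 else 0) <= s%:R :> R.
  rewrite -big_mkcondr /=.
  apply: (@le_trans _ _ (\sum_(q : 'I_s.+1 | q != ord0) 1)).
    apply: (@ler_sum_inj R _ _ _ _ (fun p : 'I_n.+1 => inord p : 'I_s.+1) (fun=> 1)) => //.
    - move=> p q /andP[_ ps] /andP[_ qs] /(congr1 val); rewrite /= !inordK//.
      exact: val_inj.
    - move=> p /andP[pp ps]; rewrite -val_eqE /= inordK//.
      by rewrite -lt0n prime_gt0.
  by rewrite sumr_const cardC1 card_ord.
have t2 : (\sum_(p < n.+1 | prime p) ln p%:R) / ln y <= 2 * (52 / 75) * N / ln y.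
  rewrite ler_wpM2r ?invr_ge0 ?(ltW ly0)//; apply: le_trans (theta_le R n) _.
  rewrite mulrC; apply: ler_pM => //; first by rewrite mulr_ge0// ltW// ln_gt0// ltr1n.
  by rewrite ler_wpM2l// ln2_le.
have l100 : ln y <= 7 * (52 / 75) + y / 100 - 1.
  have q0 : 0 < y / 100 by rewrite divr_gt0.
  have -> : y = 100 * (y / 100) by lra.
  rewrite lnM ?posrE//.
  have h1 : ln 100 <= 7 * ln 2 :> R.
    rewrite mulr_natl -lnXn// ler_ln ?posrE ?exprn_gt0//; lra.
  have := @le_ln1Dx R (y / 100 - 1); rewrite addrCA subrr addr0 => h2.
  have h3 : -1 < y / 100 - 1 by lra.
  have := h2 h3; have := ln2_le R; lra.
apply: le_trans (lerD t1 t2) _.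
rewrite lNy.
have -> : 29 / 10 * (N / (2 * ln y)) = 29 / 20 * N / ln y by field; rewrite gt_eqF.
rewrite -lerBrDr -mulrBl; apply: le_trans sy _; rewrite ler_pdivlMr//.
rewrite -y2; apply: (@le_trans _ _ (y * (7 * (52 / 75) + y / 100 - 1))).
  by rewrite ler_wpM2l// ltW.
have : y * 100 <= y * y by rewrite ler_pM2l.
lra.
Qed.

End Interface.

Section PartTwo.
Variable R : realType.
Local Notation normc := (@Normc.normc R).

Lemma ln_nat_pow2_le (k m : nat) : (2 ^ k <= m)%N -> k%:R * ln 2 <= ln m%:R :> R.
Proof.
move=> km; rewrite mulr_natl -lnXn// -natrX ler_ln ?posrE ?ltr0n ?expn_gt0//.
  by rewrite ler_nat.
by apply: leq_trans km; rewrite expn_gt0.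
Qed.

Lemma powR_le_half_pow (T N a : R) (j : nat) : 0 < T -> 0 < N -> T * ln 2 <= ln N ->
  j%:R / T <= a -> N `^ (- a) <= 2 ^- j.
Proof.
move=> T0 N0 lN ja; have l2 : 0 < ln 2 :> R by rewrite ln_gt0// ltr1n.
have a0 : 0 <= a by apply: le_trans ja; rewrite divr_ge0// ltW.
rewrite -ler_ln ?posrE ?powR_gt0 ?invr_gt0 ?exprn_gt0// ln_powR lnV ?posrE ?exprn_gt0//.
rewrite lnXn// mulNr lerN2 -[ln 2 *+ j]mulr_natl.
apply: (@le_trans _ _ (a * (T * ln 2))); last by rewrite ler_wpM2l.
by rewrite mulrA ler_wpM2r ?(ltW l2)// -ler_pdivrMr.
Qed.

Lemma ln_le_powR (N a : R) : 0 < N -> 0 < a -> ln N <= a^-1 * N `^ a.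
Proof.
move=> N0 a0; rewrite -ler_pdivrMl ?invr_gt0// invrK -ln_powR.
by apply/ltW/ln_sublinear; rewrite powR_gt0.
Qed.

Lemma errors_small (K N : R) : 0 <= K -> 0 < N -> 80 * ln 2 <= ln N ->
  K <= N `^ (16^-1) ->
  5 / N + 222 / 32%:R * N `^ (- (1 / 5)) + 3 * (K * ln N *
     (80 * N `^ (2 * (7 / 25) * (1 + 5%:R^-1) - 1) + 5 * N `^ (9 / 20 * (5%:R^-1 - 1))))
     + N `^ (7 / 25 - 1) * K * ln N <= 1 / 20.
Proof.
move=> K0 N0 lN KN.
have l2 : 0 < ln 2 :> R by rewrite ln_gt0// ltr1n.
have lN0 : 0 <= ln N by apply: le_trans lN; rewrite mulr_ge0// ltW.
pose q : R := 2 ^- 20.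
have q0 : 0 < q by rewrite invr_gt0 exprn_gt0.
have small a : 1 / 4 <= a -> N `^ (- a) <= q.
  by move=> a4; apply: (powR_le_half_pow (T := 80)) => //; apply: le_trans a4; lra.
have addp a b : N `^ a * N `^ b = N `^ (a + b) by rewrite powRD// (gt_eqF N0) implybT.
have KlN : K * ln N <= 80 * N `^ (3 / 40).
  have h := ln_le_powR N0 (_ : 0 < 1 / 80 :> R).
  have {}h : ln N <= 80 * N `^ (1 / 80) by apply: le_trans (h _) _; rewrite ?div1r ?invrK.
  apply: le_trans (ler_pM K0 lN0 KN h) _.
  by rewrite mulrCA addp le_eqVlt; apply/orP; left; apply/eqP; congr (_ * _ `^ _); field.
have t1 : 5 / N <= 5 * q.
  rewrite ler_wpM2l// -powR_inv1 ?(ltW N0)//; apply: small; lra.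
have t2 : N `^ (- (1 / 5)) <= 16 * q.
  apply: le_trans (powR_le_half_pow (j := 16) (T := 80) _ N0 lN _) _ => //; first lra.
  have -> : 16 * q = 2 ^- 16 by rewrite /q; field.
  by [].
have Kq a : a <= - (13 / 40) -> K * ln N * N `^ a <= 80 * q.
  move=> ha; apply: le_trans (ler_wpM2r (powR_ge0 _ _) KlN) _.
  rewrite -mulrA addp ler_wpM2l//.
  rewrite (_ : 3 / 40 + a = - (- (3 / 40) - a)); last by ring.
  by apply: small; lra.
have t3 : K * ln N * (80 * N `^ (2 * (7 / 25) * (1 + 5%:R^-1) - 1) + 5 * N `^ (9 / 20 * (5%:R^-1 - 1)))
   <= 80 * (80 * q) + 5 * (80 * q).
  rewrite mulrDr; apply: lerD; rewrite mulrCA ler_wpM2l//; apply: Kq.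
    rewrite (_ : 2 * (7 / 25) * (1 + 5%:R^-1) - 1 = - (41 / 125)); last by field.
    lra.
  rewrite (_ : 9 / 20 * (5%:R^-1 - 1) = - (9 / 25)); last by field.
  lra.
have t4 : N `^ (7 / 25 - 1) * K * ln N <= 80 * q.
  rewrite -mulrA mulrC; apply: Kq; lra.
have qs : q <= 1 / 1000 * (1 / 1000).
  rewrite /q; have -> : 2 ^- 20 = (1 / 32) ^+ 4 :> R by field.
  lra.
have r7 : 222 / 32%:R <= 7 :> R by rewrite ler_pdivrMr ?ltr0n// -natrM ler_nat.
have t2' : 222 / 32%:R * N `^ (- (1 / 5)) <= 7 * (16 * q).
  exact: (ler_pM (divr_ge0 (ler0n R 222) (ler0n R 32)) (powR_ge0 _ _) r7 t2).
move: t1 t2' t3 t4 qs.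
move: (5 / N) (222 / 32%:R * _) (K * ln N * _) (_ * K * ln N) (q) => x1 x2 x3 x4 r h1 h2 h3 h4 hr.
lra.
Qed.

Section Nineteen.
Variables (I : finType) (th : I -> R) (u : nat -> R[i]) (delta N : R).
Hypotheses (N4 : 10 ^+ 4 <= N) (delta0 : 0 < delta) (I0 : (0 < #|I|)%N).
Hypothesis sep : forall i j, i != j -> forall m : int, delta <= `|th i - th j - m%:~R|.
Let M := N + delta^-1.
Let K : R := #|I|%:R.
Let S := \sum_i normc (\sum_(p < (Num.truncn N).+1 | prime p) u p * e (th i * p%:R)) ^+ 2.
Let Su := \sum_(p < (Num.truncn N).+1 | prime p) normc (u p) ^+ 2.
Let Su0 : 0 <= Su. Proof. by apply: sumr_ge0 => p _; exact: sqr_ge0. Qed.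
Let N1000 : 1000 <= N. Proof. by move: N4; lra. Qed.
Let N0 : 0 < N. Proof. by move: N1000; lra. Qed.
Let lN0 : 0 < ln N. Proof. by rewrite ln_gt0//; move: N1000; lra. Qed.
Let NM : N <= M. Proof. by rewrite lerDl invr_ge0 ltW. Qed.
Let M0 : 0 <= M. Proof. by apply: le_trans NM; exact: ltW. Qed.

Lemma small_card_ln (k : nat) : (0 < k)%N -> (k < 16)%N -> 29 / 10 * k%:R <= 19 * ln (2 * k%:R) :> R.
Proof.
move=> k0 k16; rewrite -natrM; have l2 := ln2_ge R.
have [k4|k4] := ltnP k 4.
  have h := @ln_nat_pow2_le 1 (2 * k) (leq_mul (leqnn 2) k0).
  have k3 : k%:R <= 3 :> R by rewrite (ler_nat _ k 3).
  by move: (ln (2 * k)%:R) h => x h; lra.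
have [k8|k8] := ltnP k 8.
  have h := @ln_nat_pow2_le 3 (2 * k) (leq_mul (leqnn 2) k4).
  have k7 : k%:R <= 7 :> R by rewrite (ler_nat _ k 7).
  by move: (ln (2 * k)%:R) h => x h; lra.
have h := @ln_nat_pow2_le 4 (2 * k) (leq_mul (leqnn 2) k8).
have k7 : k%:R <= 15 :> R by rewrite (ler_nat _ k 15).
by move: (ln (2 * k)%:R) h => x h; lra.
Qed.

Let small_case : (#|I| < 16)%N -> S <= 19 * (M / ln N) * ln (2 * K) * Su.
Proof.
move=> K16; apply: le_trans (sum_sqr_exp_le_card th u (Num.truncn N)) _.
rewrite -/Su ler_wpM2r//.
apply: (@le_trans _ _ (K * (29 / 10 * (N / ln N)))).
  by rewrite ler_wpM2l// prime_count_le.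
have -> : K * (29 / 10 * (N / ln N)) = N / ln N * (29 / 10 * K) by ring.
have -> : 19 * (M / ln N) * ln (2 * K) = M / ln N * (19 * ln (2 * K)) by ring.
apply: ler_pM; rewrite ?mulr_ge0 ?invr_ge0 ?(ltW N0) ?(ltW lN0)//.
  by rewrite ler_wpM2r// invr_ge0 ltW.
exact: small_card_ln.
Qed.

Let large_case : (16 <= #|I|)%N -> S <= 19 * (M / ln N) * ln (2 * K) * Su.
Proof.
move=> K16; have l2 := ln2_ge R; have l2' := ln2_le R.
have N11 : 11 <= N by move: N1000; lra.
have delta2 : delta <= 2^-1 by apply: spacing_le_half sep; apply: leq_trans K16.
have M1000 := le_trans N1000 NM.
have l2K : 5 * ln 2 <= ln (2 * K).
  by rewrite -natrM; apply: ln_nat_pow2_le; rewrite (leq_mul2l 2 16).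
have [lNK|lNK] := leP (ln N) (16 * ln (2 * K)).
  apply: le_trans (trivial_applied u N11 delta0 delta2 sep) _; rewrite -/M -/Su ler_wpM2r//.
  apply: (@le_trans _ _ (19 * M * 16^-1)); first by move: M1000; lra.
  have -> : 19 * (M / ln N) * ln (2 * K) = 19 * M * (ln (2 * K) / ln N) by ring.
  rewrite ler_wpM2l ?mulr_ge0// ler_pdivlMr// mulrC ler_pdivrMr//.
  by rewrite mulrC.
have lN80 : 80 * ln 2 <= ln N by move: l2K lNK; lra.
have K0 : 0 < K by rewrite ltr0n.
have KN : K <= N `^ (16^-1).
  apply: (@le_trans _ _ (2 * K)); first by move: K0; lra.
  rewrite -ler_ln ?posrE ?powR_gt0 ?mulr_gt0// ln_powR.
  rewrite ler_pdivlMl//; exact: ltW.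
have z512 : (512 <= 32 * #|I|)%N by rewrite (leq_mul2l 32 16).
have zR : 512 <= (32 * #|I|)%:R :> R by rewrite (ler_nat _ 512).
have h134 : (13 / 4) ^+ 5 <= (32 * #|I|)%:R :> R by apply: le_trans zR; lra.
have th0 : 0 < 7 / 25 :> R by lra.
have th1 : 7 / 25 <= 2^-1 :> R by lra.
have hS := sieve_applied u N11 delta0 delta2 sep (k := 5) z512 isT h134 th0 th1
  (errors_small (ltW K0) N0 lN80 KN).
apply: le_trans hS _.
rewrite -/M -/Su ler_wpM2r//.
have lz : ln (32 * #|I|).+1%:R <= 91 / 50 * ln (2 * K) :> R.
  have : (32 * #|I|).+1%:R <= 2 * K * (16 * (17 / 16)) :> R.
    rewrite -natr1 natrM -/K.
    have : 16 <= K by rewrite (ler_nat _ 16).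
    lra.
  rewrite -ler_ln ?posrE ?ltr0n ?mulr_gt0//.
  move=> h; apply: le_trans h _.
  rewrite lnM ?posrE ?mulr_gt0//.
  rewrite [ln (16 * _)]lnM ?posrE//.
  have h16 : ln 16 = 4 * ln 2 :> R.
    by rewrite mulr_natl -lnXn//; congr ln; lra.
  have h17 : ln (17 / 16) <= 1 / 16 :> R.
    by have := @le_ln1Dx R (1 / 16); rewrite (_ : 1 + 1 / 16 = 17 / 16); [apply; lra|field].
  by move: (ln (2 * K)) (ln (17 / 16)) h17 l2K h16 => x y hy hx ->; lra.
have lN0' : 0 <= (ln N)^-1 by rewrite invr_ge0 ltW.
set l := ln (32 * #|I|).+1%:R in lz *; set x := ln (2 * K) in lz *.
have -> : 54 / 25 * l / (7 / 25 * ln N) * (41 / 35 + 18 / 5 / 32%:R + 1 / 20) * M =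
    (54 / 25 * (25 / 7) * (41 / 35 + 18 / 5 / 32 + 1 / 20) * l) * (M * (ln N)^-1).
  by field; rewrite gt_eqF.
have -> : 19 * (M / ln N) * x = 19 * x * (M * (ln N)^-1) by ring.
rewrite ler_wpM2r ?mulr_ge0//.
have : 0 <= x by move: l2K; rewrite -/x; lra.
by move=> x0; lra.
Qed.

Lemma sieve_nineteen : S <= 19 * (M / ln N) * ln (2 * K) * Su.
Proof. by have [/small_case|/large_case] := ltnP #|I| 16. Qed.

End Nineteen.

End PartTwo.

(** * The asymptotic constant *)

Section PartOne.
Variable R : realType.
Local Notation normc := (@Normc.normc R).

Lemma errors_tiny_sum (q x1 x2 x3 x4 : R) : q <= 1 / 1000 * (1 / 1000) * (1 / 1000) ->
  x1 <= 5 * q -> x2 <= 1 * q -> x3 <= 80 * (250 * q) + 5 * (250 * q) -> x4 <= 250 * q ->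
  x1 + x2 + 3 * x3 + x4 <= 1 / 1000.
Proof. by move=> hq h1 h2 h3 h4; lra. Qed.

Lemma errors_tiny (K N : R) : 0 <= K -> 0 < N -> 50 * (50 * ln 2) <= ln N ->
  K <= N `^ (17 / 100) ->
  5 / N + 222 / 1000%:R * N `^ (- (1 / 5)) + 3 * (K * ln N *
     (80 * N `^ (2 * (37 / 100) * (1 + 10%:R^-1) - 1) + 5 * N `^ (9 / 20 * (10%:R^-1 - 1))))
     + N `^ (37 / 100 - 1) * K * ln N <= 1 / 1000.
Proof.
move=> K0 N0 lN KN.
have l2 : 0 < ln 2 :> R by rewrite ln_gt0// ltr1n.
have lN0 : 0 <= ln N by apply: le_trans lN; rewrite !mulr_ge0// ltW.
pose q : R := 2 ^- 30.
have q0 : 0 < q by rewrite invr_gt0 exprn_gt0.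
have small a : 3 / 250 <= a -> N `^ (- a) <= q.
  by move=> a4; apply: (powR_le_half_pow (T := 50 * 50)); rewrite -?mulrA //; apply: le_trans a4; lra.
have addp a b : N `^ a * N `^ b = N `^ (a + b) by rewrite powRD// (gt_eqF N0) implybT.
have [b b250] : {b : R | b = 250} by exists 250.
have b0 : 0 <= b by rewrite b250 ler0n.
have KlN : K * ln N <= b * N `^ (87 / 500).
  have h := ln_le_powR N0 (_ : 0 < 1 / 250 :> R).
  have {}h : ln N <= b * N `^ (1 / 250).
    by rewrite b250; apply: le_trans (h _) _; rewrite ?div1r ?invrK ?lexx ?invr_gt0 ?ltr0n.
  apply: le_trans (ler_pM K0 lN0 KN h) _.
  by rewrite mulrCA addp le_eqVlt; apply/orP; left; apply/eqP; congr (_ * _ `^ _); field.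
have t1 : 5 / N <= 5 * q.
  rewrite ler_wpM2l// -powR_inv1 ?(ltW N0)//; apply: small; lra.
have t2 : N `^ (- (1 / 5)) <= q by apply: small; lra.
have Kq a : a <= - (93 / 500) -> K * ln N * N `^ a <= b * q.
  move=> ha; apply: le_trans (ler_wpM2r (powR_ge0 _ _) KlN) _.
  rewrite -mulrA addp; apply: ler_wpM2l => //.
  rewrite (_ : 87 / 500 + a = - (- (87 / 500) - a)); last by ring.
  by apply: small; lra.
have t3 : K * ln N * (80 * N `^ (2 * (37 / 100) * (1 + 10%:R^-1) - 1) + 5 * N `^ (9 / 20 * (10%:R^-1 - 1)))
   <= 80 * (b * q) + 5 * (b * q).
  rewrite mulrDr; apply: lerD; rewrite mulrCA ler_wpM2l//; apply: Kq.
    by rewrite le_eqVlt; apply/orP; left; apply/eqP; field.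
  rewrite (_ : 9 / 20 * (10%:R^-1 - 1) = - (81 / 200)); last by field.
  lra.
have t4 : N `^ (37 / 100 - 1) * K * ln N <= b * q.
  rewrite -mulrA mulrC; apply: Kq; lra.
have qs : q <= 1 / 1000 * (1 / 1000) * (1 / 1000).
  rewrite /q; have -> : 2 ^- 30 = (1 / 32) ^+ 6 :> R by field.
  lra.
have r1 : 222 / 1000%:R <= 1 :> R by rewrite ler_pdivrMr ?ltr0n// mul1r ler_nat.
have t2' : 222 / 1000%:R * N `^ (- (1 / 5)) <= 1 * q.
  by apply: (ler_pM (divr_ge0 (ler0n R 222) (ler0n R 1000)) (powR_ge0 _ _) r1 t2).
subst b.
have h := errors_tiny_sum qs t1.
have {}h := h _ _ _ t2'.
have {}h := h _ _ t3.
have {}h := h _ t4.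
exact: h.
Qed.

Lemma trivial_numeric (x : R) : 2500 <= x -> 41 / 35 * x + 5 <= 697 / 100 * x * (17 / 100).
Proof. by move=> h; lra. Qed.

Lemma final_numeric (l x : R) : l <= 101 / 100 * x -> 0 <= x ->
  54 / 25 * (100 / 37) * (41 / 35 + 18 / 5 / 1000%:R + 1 / 1000) * l <= 697 / 100 * x.
Proof. by move=> h1 h2; lra. Qed.

Lemma ln_thousand (k : nat) : (0 < k)%N -> 700 <= ln (2 * k%:R) :> R ->
  ln (1000 * k).+1%:R <= 101 / 100 * ln (2 * k%:R) :> R.
Proof.
move=> k0; have l2' := ln2_le R; have k0' : 0 < k%:R :> R by rewrite ltr0n.
have k2 : 0 < 2 * k%:R :> R by rewrite mulr_gt0.
have p9 : 0 < 2 ^+ 9 :> R by rewrite exprn_gt0.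
have h : (1000 * k).+1%:R <= 2 * k%:R * 2 ^+ 9 :> R.
  have -> : 2 * k%:R * 2 ^+ 9 = (1024 * k)%:R :> R by rewrite [(1024 * k)%:R]natrM; ring.
  rewrite ler_nat; apply: (@leq_trans (1001 * k)); last by rewrite leq_mul2r orbC.
  by rewrite (mulnDl 1000 1) -addn1 leq_add2l mul1n.
have {h} : ln (1000 * k).+1%:R <= ln (2 * k%:R * 2 ^+ 9) :> R.
  by rewrite ler_ln ?posrE ?ltr0n// mulr_gt0.
rewrite lnM ?posrE// lnXn// -[ln 2 *+ 9]mulr_natl.
move: (ln (2 * _)) (ln (1000 * k).+1%:R) => x y h1 h2.
lra.
Qed.

Lemma ln2_scale (x y : R) : 50 * 50 <= x -> y <= 52 / 75 -> 50 * (50 * y) <= x.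
Proof. by move=> h1 h2; lra. Qed.

Lemma pow_134 : (13 / 4) ^+ 10 <= 1000%:R * 701 :> R.
Proof.
apply: (@le_trans _ _ (11 ^+ 5)).
  by rewrite (exprM _ 2 5) lerXn2r ?nnegrE ?exprn_ge0 ?divr_ge0//; lra.
rewrite -natrX -natrM ler_nat.
by vm_compute.
Qed.

Section Asymptotic.
Variables (I : finType) (th : I -> R) (u : nat -> R[i]) (delta N c : R).
Hypotheses (NE : expR (50 * 50) <= N) (IE : expR 700 <= #|I|%:R :> R) (delta0 : 0 < delta).
Hypothesis c7 : 697 / 100 <= c.
Hypothesis sep : forall i j, i != j -> forall m : int, delta <= `|th i - th j - m%:~R|.
Let M := N + delta^-1.
Let K : R := #|I|%:R.

Lemma sieve_asymptotic :
  \sum_i normc (\sum_(p < (Num.truncn N).+1 | prime p) u p * e (th i * p%:R)) ^+ 2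
    <= c * (M / ln N) * ln (2 * K) * \sum_(p < (Num.truncn N).+1 | prime p) normc (u p) ^+ 2.
Proof.
have th0 : 0 < 37 / 100 :> R by lra.
have th1 : 37 / 100 <= 2^-1 :> R by lra.
have N2500 : 2500 <= N by apply: le_trans NE; apply: le_trans (expR_ge1Dx _); lra.
have K700 : 701 <= K by apply: le_trans IE; apply: le_trans (expR_ge1Dx _); lra.
have l2' := ln2_le R; have l20 : 0 < ln 2 :> R by rewrite ln_gt0// ltr1n.
have N0 : 0 < N by move: N2500; lra.
have lN : 50 * 50 <= ln N by rewrite -ler_expR lnK.
have lN0 : 0 < ln N by move: lN; lra.
have NM : N <= M by rewrite lerDl invr_ge0 ltW.
have M0 : 0 <= M by apply: le_trans NM; exact: ltW.
have K0 : 0 < K by move: K700; lra.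
have N11 : 11 <= N by move: N2500; lra.
have I1 : (1 < #|I|)%N by rewrite -(ltr_nat R); move: K700; rewrite /K; lra.
have delta2 : delta <= 2^-1 by apply: spacing_le_half sep.
have M2500 := le_trans N2500 NM.
have lK : 700 <= ln K by rewrite -ler_expR lnK.
have lK2 : ln K <= ln (2 * K) by rewrite ler_ln ?posrE ?mulr_gt0// ler_peMl ?ler1n ?(ltW K0).
have l2K := le_trans lK lK2.
have Su0 : 0 <= \sum_(p < (Num.truncn N).+1 | prime p) normc (u p) ^+ 2.
  by apply: sumr_ge0 => p _; exact: sqr_ge0.
have c70 : 0 <= 697 / 100 :> R := divr_ge0 (ler0n R 697) (ler0n R 100).
have c0 : 0 <= c := le_trans c70 c7.
have [NK|KN] := ltP (N `^ (17 / 100)) K.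
  apply: le_trans (trivial_applied u N11 delta0 delta2 sep) _; rewrite -/M ler_wpM2r//.
  apply: (@le_trans _ _ (697 / 100 * M * (17 / 100))); first exact: trivial_numeric M2500.
  have -> : c * (M / ln N) * ln (2 * K) = c * M * (ln (2 * K) / ln N) by ring.
  apply: ler_pM; [exact: mulr_ge0 c70 M0|exact: divr_ge0 (ler0n _ _) (ler0n _ _)|exact: ler_wpM2r|].
  rewrite ler_pdivlMr//; apply: le_trans lK2.
  by rewrite -ln_powR ler_ln ?posrE ?powR_gt0// ltW.
have lN2 : 50 * (50 * ln 2) <= ln N by exact: ln2_scale lN l2'.
have I0 : (0 < #|I|)%N by exact: ltnW.
have z512 : (512 <= 1000 * #|I|)%N.
  by apply: (@leq_trans (1000 * 1)); rewrite // leq_mul2l I0 orbT.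
have h134 : (13 / 4) ^+ 10 <= (1000 * #|I|)%:R :> R.
  by rewrite [(1000 * _)%:R]natrM; exact: (le_trans pow_134 (ler_wpM2l (ler0n _ _) K700)).
have hS := sieve_applied u N11 delta0 delta2 sep (k := 10) z512 isT h134 th0 th1
  (errors_tiny (ltW K0) N0 lN2 KN).
apply: le_trans hS _; rewrite -/M ler_wpM2r//.
have lz := ln_thousand I0 l2K.
have lN0' : 0 <= (ln N)^-1 by rewrite invr_ge0 ltW.
set l := ln (1000 * #|I|).+1%:R in lz *; set x := ln (2 * K) in lz l2K *.
have -> : 54 / 25 * l / (37 / 100 * ln N) * (41 / 35 + 18 / 5 / 1000%:R + 1 / 1000) * M =
    (54 / 25 * (100 / 37) * (41 / 35 + 18 / 5 / 1000%:R + 1 / 1000) * l) * (M * (ln N)^-1).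
  by field; rewrite gt_eqF.
have -> : c * (M / ln N) * x = c * x * (M * (ln N)^-1) by ring.
rewrite ler_wpM2r ?mulr_ge0//.
have x0 : 0 <= x := le_trans (ler0n _ _) l2K.
exact: le_trans (final_numeric lz x0) (ler_wpM2r x0 c7).
Qed.

End Asymptotic.

Lemma card_fset_set_gt0 (T : choiceType) (X : set T) : finite_set X -> X !=set0 ->
  (0 < #|{: fset_set X}|)%N.
Proof.
move=> finX [x Xx]; have xX : x \in fset_set X by rewrite in_fset_set// inE.
by apply/card_gt0P; exists [` xX]%fset.
Qed.

Lemma asymptotic_constant_gt (c : R) : 697 / 100 <= c -> asymptotic_constant c.
Proof.
move=> c7; have c0 : 0 <= c by move: c7; lra.
pose big (N : R) (k : nat) := (expR (50 * 50) <= N) && (expR 700 <= k%:R :> R).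
pose o (N : R) (k : nat) : R := if big N k then 0
  else k%:R * (Num.truncn N).+1%:R * ln N / (N * ln 2).
exists o; split.
  apply: cvg_near_cst.
  exists ([set N | expR (50 * 50) <= N], [set k | expR 700 <= k%:R :> R]) => /=.
    split; first by apply: nbhs_pinfty_ge; rewrite num_real.
    exact: nbhs_infty_ger.
  by move=> [N k] /= [h1 h2]; rewrite /o /big h1 h2.
move=> delta X N u delta0 wX X0 N1.
have finX := well_spaced_finite delta0 wX.
have sep := well_spaced_repr finX wX.
have cardX : #|{: fset_set X}| = #|` fset_set X| by rewrite cardfE.
rewrite -cardX; apply: prime_large_sieve_fset => //; rewrite /o.
have [/andP[h1 h2]|_] := boolP (big _ _).
  by rewrite addr0; apply: sieve_asymptotic.
set K := #|{: fset_set X}|; have K0 : (0 < K)%N by exact: card_fset_set_gt0.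
have [->|N1'] := eqVneq N 1.
  rewrite truncn1 [leRHS]mulrC [X in X * _]big_pred0 ?mul0r; last by case=> [[|[]]].
  rewrite big1// => i _; rewrite big_pred0; last by case=> [[|[]]].
  by rewrite Normc.normc0 expr0n.
have {}N1 : 1 < N by rewrite lt_neqAle eq_sym N1'.
have lN0 : 0 < ln N by rewrite ln_gt0.
have N0 : 0 < N by apply: lt_trans N1.
have l20 : 0 < ln 2 :> R by rewrite ln_gt0// ltr1n.
have lK : ln 2 <= ln (2 * K%:R) :> R.
  rewrite ler_ln ?posrE ?mulr_gt0 ?ltr0n//.
  by rewrite ler_peMr// ler1n.
apply: le_trans (sum_sqr_exp_le_card _ u (Num.truncn N)) _.
rewrite ler_wpM2r//; first by apply: sumr_ge0 => p _; exact: sqr_ge0.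
rewrite -/K; set m := #|_|; set n1 := (Num.truncn N).+1.
have mn : (m <= n1)%N by rewrite -[n1]card_ord; exact: max_card.
apply: (@le_trans _ _ (K%:R * n1%:R)); first by rewrite ler_wpM2l// ler_nat.
set D := delta^-1; have D0 : 0 <= D by rewrite invr_ge0 ltW.
set o1 := K%:R * _ * _ / _.
have o10 : 0 <= o1 by rewrite divr_ge0 ?mulr_ge0// ltW.
have -> : K%:R * n1%:R = o1 * (N / ln N) * ln 2.
  by rewrite /o1; field; rewrite !gt_eqF.
apply: ler_pM => //; first by rewrite mulr_ge0// divr_ge0// ltW.
  exact: ltW.
apply: ler_pM => //; first by rewrite divr_ge0// ltW.
  by rewrite lerDr.
by rewrite ler_wpM2r ?invr_ge0 ?(ltW lN0)// lerDl.
Qed.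

Lemma asymptotic_constant_gamma : asymptotic_constant (4 * expR (euler_gamma R)).
Proof. by apply: asymptotic_constant_gt; have := expR_euler_gamma_ge R; lra. Qed.

Lemma prime_large_sieve_nineteen (delta : R) (X : set (circle R)) (N : R) (u : nat -> R[i]) :
  0 < delta -> well_spaced delta X -> X !=set0 -> 10 ^+ 4 <= N ->
  prime_large_sieve 19 delta X N u.
Proof.
move=> delta0 wX X0 N4; have finX := well_spaced_finite delta0 wX.
apply: prime_large_sieve_fset => //; apply: sieve_nineteen => //; last exact: well_spaced_repr.
exact: card_fset_set_gt0.
Qed.

End PartOne.

(** * The lower bound for the constant *)

Section PrimeDensity.
Variable R : realType.

Definition primepi (n : nat) : R := \sum_(p < n.+1 | prime p) 1.

Lemma primepiS n : primepi n.+1 = primepi n + (prime n.+1)%:R.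
Proof.
rewrite /primepi big_mkcond big_ord_recr -big_mkcond /=.
by case: (prime _).
Qed.

Lemma primepi_le n : primepi n <= n%:R.
Proof.
elim: n => [|n IH]; first by rewrite /primepi big_mkcond big_ord_recl big_ord0 /= addr0.
rewrite primepiS -natr1; apply: lerD => //.
by case: (prime _).
Qed.

Lemma Gsum_self z : (0 < z)%N -> Gsum R z z = 1.
Proof.
move=> z0; rewrite /Gsum (big_pred1 (freq0 z)) => [|g].
  by rewrite /wt big1 ?expr1n// => p _; rewrite ffunE eqxx.
apply/idP/eqP => [/andP[Fg _]|->]; last exact: level_freq0.
apply/ffunP => p; rewrite ffunE; apply: fam_nonrough Fg _.
by rewrite /rough negb_and -leqNgt -ltnS ltn_ord orbT.
Qed.

Lemma ln_le_mertens z : (0 < z)%N -> ln z.+1%:R <= mertens R z.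
Proof.
move=> z0; apply: le_trans (ln_le_harmonic R z) _.
by have := harmonic_le_mertens R z z; rewrite Gsum_self// mulr1.
Qed.

Lemma mertens_primepi_step (z : nat) (b : R) : (2 <= z)%N -> 0 <= b -> b <= 1 ->
  primepi z.+1 * ln z.+1%:R <= b * z.+1%:R ->
  ln (mertens R z.+1) - primepi z.+1 / z.+1%:R + z.+1%:R^-1 - b * ln (ln z.+1%:R)
  <= ln (mertens R z) - primepi z / z%:R + z%:R^-1 - b * ln (ln z%:R).
Proof.
move=> z2 b0 b1 pib; have z0 : 0 < z%:R :> R by rewrite ltr0n; lia.
have zE : z.+1%:R = z%:R + 1 :> R by rewrite natr1.
have z10 : 0 < z.+1%:R :> R by rewrite ltr0n.
have lz0 : 0 < ln z%:R :> R by rewrite ln_gt0// ltr1n.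
have lz1 : 1 <= ln z.+1%:R :> R.
  apply: le_trans (_ : ln 3 <= _); last by rewrite ler_ln ?posrE// ler_nat.
  have h3 : 0 < 3 / 2 :> R by lra.
  have -> : 3 = 2 * (3 / 2) :> R by field.
  by rewrite lnM ?posrE//; have := ln2_ge R; have := ln_ge1Binv h3; lra.
have lz1' : 0 < ln z.+1%:R :> R by lra.
have step : ln (mertens R z.+1) <= ln (mertens R z) + (prime z.+1)%:R / z%:R.
  rewrite mertensS lnM ?posrE ?mertens_gt0//; last first.
    by case: ifP => // _; rewrite divr_gt0.
  rewrite lerD2l; case: ifP => _; last by rewrite ln1 mul0r.
  have -> : z.+1%:R / z%:R = 1 + z%:R^-1 :> R by rewrite -natr1 mulrDl divff ?gt_eqF// mul1r.
  rewrite mul1r; apply: le_ln1Dx; apply: lt_le_trans (ltrN10 _) _.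
  by rewrite invr_ge0 ltW.
have lr : z.+1%:R^-1 / ln z.+1%:R <= ln (ln z.+1%:R) - ln (ln z%:R) :> R.
  have := @ln_ge1Binv R (ln z.+1%:R / ln z%:R) (divr_gt0 lz1' lz0).
  rewrite invf_div ln_div// => h; apply: le_trans h.
  have := @ln_ge1Binv R (z.+1%:R / z%:R) (divr_gt0 z10 z0).
  rewrite invf_div ln_div ?posrE// => h.
  rewrite ler_pdivrMr// mulrBl mul1r divfK ?gt_eqF//; apply: le_trans h.
  by rewrite le_eqVlt zE; apply/orP; left; apply/eqP; field; rewrite -zE gt_eqF.
have {}pib : primepi z.+1 * (z%:R^-1 - z.+1%:R^-1) <=
    b * (z.+1%:R^-1 / ln z.+1%:R) + (z%:R^-1 - z.+1%:R^-1).
  have -> : z%:R^-1 - z.+1%:R^-1 = (z%:R * z.+1%:R)^-1 :> R.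
    by rewrite zE; field; rewrite -zE !gt_eqF.
  have h : primepi z.+1 <= b * z.+1%:R / ln z.+1%:R by rewrite ler_pdivlMr.
  have : (primepi z.+1) * (z%:R * z.+1%:R)^-1 <= b * z.+1%:R / ln z.+1%:R * (z%:R * z.+1%:R)^-1.
    by rewrite ler_wpM2r// invr_ge0 mulr_ge0// ltW.
  move=> h2; apply: le_trans h2 _.
  have -> : b * z.+1%:R / ln z.+1%:R * (z%:R * z.+1%:R)^-1 =
     b * (z.+1%:R^-1 / ln z.+1%:R) + (b / ln z.+1%:R) * (z%:R * z.+1%:R)^-1.
    by rewrite zE; field; rewrite -zE !gt_eqF.
  rewrite lerD2l ler_piMl// ?invr_ge0 ?mulr_ge0 ?(ltW z0)//.
  by rewrite ler_pdivrMr// mul1r; apply: le_trans b1 lz1.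
have blr := ler_wpM2l b0 lr.
rewrite primepiS in pib *.
move: step pib blr; rewrite mulrBr.
move: (ln (mertens R z.+1)) (ln (mertens R z)) (ln (ln z.+1%:R)) (ln (ln z%:R)) => A B C D.
move: (b * (z.+1%:R^-1 / ln z.+1%:R)) => E0.
rewrite !mulrDl !mulrBr.
move: (z.+1%:R^-1) (z%:R^-1) (primepi z) ((prime z.+1)%:R : R) (b * C) (b * D).
move=> x y p d F G0 h1 h2 h3; lra.
Qed.

(* If [pi(n) < b n / log n] for all large [n], partial summation turns
   [log(n + 1) <= mertens n] into [log log n <= C + b log log n]. *)
Lemma primepi_lower (b : R) (n0 : nat) : 0 <= b -> b < 1 ->
  exists2 n, (n0 <= n)%N & b * n%:R <= primepi n * ln n%:R.
Proof.
move=> b0 b1; apply: contrapT => /forall2NP no.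
pose y := maxn n0 2.
pose A z := ln (mertens R z) - primepi z / z%:R + z%:R^-1 - b * ln (ln z%:R).
have low n : (n0 <= n)%N -> primepi n * ln n%:R <= b * n%:R.
  by move=> nn; have [//|/negP] := no n; rewrite -ltNge => /ltW.
have dec z : (y <= z)%N -> A z <= A y.
  move=> yz; rewrite -(subnKC yz); elim: (z - y)%N => [|k IH]; first by rewrite addn0.
  apply: le_trans IH; rewrite addnS; apply: mertens_primepi_step => //; last 2 first.
  - exact: ltW.
  - by apply: low; rewrite leqW// (leq_trans (leq_maxl n0 2))// leq_addr.
  by rewrite (leq_trans (leq_maxr n0 2))// leq_addr.
pose T := (A y + 2) / (1 - b).
pose z := (maxn y (Num.truncn (expR (expR T)))).+1.
have yz : (y <= z)%N by rewrite leqW// leq_maxl.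
have z2 : (2 <= z)%N by apply: leq_trans yz; rewrite leq_maxr.
have z0 : 0 < z%:R :> R by rewrite ltr0n.
have zT : expR (expR T) < z%:R.
  by apply: lt_le_trans (truncnS_gt _) _; rewrite ler_nat ltnS leq_maxr.
have lz0 : 0 < ln z%:R :> R by rewrite ln_gt0// ltr1n.
have zT2 : T < ln (ln z%:R).
  by rewrite -ltr_expR lnK ?posrE// -ltr_expR lnK ?posrE.
have h := dec z yz.
have hm : ln (ln z%:R) <= ln (mertens R z) :> R.
  rewrite ler_ln ?posrE ?mertens_gt0//; apply: le_trans (ln_le_mertens (ltnW z2)).
  by rewrite ler_ln ?posrE ?ltr0n// ler_nat.
have hp : primepi z / z%:R <= 1 by rewrite ler_pdivrMr// mul1r primepi_le.
have hz : 0 <= z%:R^-1 :> R by rewrite invr_ge0.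
have hT : (1 - b) * T = A y + 2 by rewrite /T mulrC divfK// gt_eqF// subr_gt0.
have hb : (1 - b) * T <= (1 - b) * ln (ln z%:R) by rewrite ler_wpM2l ?subr_ge0 ?(ltW b1) ?(ltW zT2).
move: h hm hp hz hb; rewrite hT {1}/A; move: (A y) => a.
rewrite mulrBl mul1r.
move: (ln (mertens R z)) (ln (ln z%:R)) (b * ln (ln z%:R)) (primepi z / z%:R) (z%:R^-1).
by move=> x1 x2 x3 x4 x5 h1 h2 h3 h4 h5; lra.
Qed.

End PrimeDensity.

Section LowerBound.
Variable R : realType.
Local Notation normc := (@Normc.normc R).

Lemma spaced_card (I : finType) (P : pred I) (t : I -> R) (n : nat) : (0 < n)%N ->
  (forall i j, P i -> P j -> i != j -> forall m : int, n%:R^-1 <= `|t i - t j - m%:~R|) ->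
  (#|P| <= n)%N.
Proof.
move=> n0 sep; have n0' : 0 < n%:R :> R by rewrite ltr0n.
pose f i := t i - (Num.floor (t i))%:~R.
have f0 i : 0 <= f i by rewrite subr_ge0 floor_le.
have f1 i : f i < 1 by rewrite ltrBlDl -[X in _ + X]/(1%:~R) -intrD floorD1_gt.
have gn i : (Num.truncn (f i * n%:R) < n)%N.
  by rewrite truncn_lt_nat ?mulr_ge0// gtr_pMl.
rewrite -[leqRHS]card_ord; apply: (@leq_card_in _ _ (fun i => Ordinal (gn i))).
move=> i j Pi Pj /(congr1 val) /= E; apply/eqP/negPn/negP => ij.
have := sep i j Pi Pj ij (Num.floor (t i) - Num.floor (t j)).
have -> : t i - t j - (Num.floor (t i) - Num.floor (t j))%:~R = f i - f j.
  by rewrite /f rmorphB /=; ring.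
have /andP[a1 a2] := truncn_itv (mulr_ge0 (f0 i) (ltW n0')).
have /andP[c1 c2] := truncn_itv (mulr_ge0 (f0 j) (ltW n0')).
rewrite E in a1 a2; rewrite -natr1 in a2 c2.
apply/negP; rewrite -ltNge -[ltRHS]mul1r ltr_pdivlMr//.
rewrite -[X in _ * X](ger0_norm (ltW n0')) -normrM mulrBl ltr_norml.
by move: a1 a2 c1 c2; move: (f i * _) (f j * _) (_%:R) => x y k; lra.
Qed.

Section Farey.
Variables Q : nat.
Hypothesis Q1 : (1 < Q)%N.
Let Q0 : (0 < Q)%N. Proof. exact: ltnW. Qed.
Let lev := enum (@level 1 Q).

Definition farey : seq (circle R) := [seq \pi_(circle R) (ang R g) | g <- lev].

Let lev_fam g : g \in lev -> g \in family (@residues 1 Q).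
Proof. by rewrite mem_enum => /andP[]. Qed.

Lemma farey_spaced (g g' : freq Q) (m : int) : level 1 g -> level 1 g' -> g != g' ->
  (Q * Q)%:R^-1 <= `|ang R g - ang R g' - m%:~R|.
Proof.
move=> /andP[Fg dg] /andP[Fg' dg'] gg'; apply: le_trans (ang_spaced R m Fg Fg' gg').
rewrite lef_pV2 ?posrE ?mulr_gt0 ?ltr0n ?muln_gt0 ?Q0 ?(den_gt0 Fg) ?(den_gt0 Fg')//.
by rewrite -natrM ler_nat leq_mul.
Qed.

Lemma uniq_farey : uniq farey.
Proof.
rewrite map_inj_in_uniq ?enum_uniq// => g g' lg lg' /eqP; rewrite piZ => /intrP[m E].
exact: ang_inj (lev_fam lg) (lev_fam lg') E.
Qed.

Lemma well_spaced_farey : well_spaced (Q * Q)%:R^-1 [set` farey].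
Proof.
move=> x y /= /mapP[g lg ->] /mapP[g' lg' ->] gg'.
rewrite /circle_dist -pi_circleB dist_int_pi /dist_int; apply: lb_le_inf.
  by exists `|ang R g - ang R g' - 0%:~R|, 0.
move=> _ [m _ <-]; rewrite mem_enum in lg; rewrite mem_enum in lg'.
by apply: (farey_spaced m lg lg'); apply: contraNneq gg' => ->.
Qed.

Lemma card_farey : #|` fset_set [set` farey]| = size lev.
Proof.
have -> : [set` farey] = [set` [fset x in farey]%fset].
  by apply/seteqP; split=> x /=; rewrite inE.
by rewrite set_fsetK card_fseq undup_id ?uniq_farey// size_map.
Qed.

Lemma size_level_le : (size lev <= Q * Q)%N.
Proof.
rewrite -cardE; apply: (@spaced_card (freq Q) (@level 1 Q) (@ang R Q)).
  by rewrite muln_gt0 Q0.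
by move=> g g' lg lg' gg' m; exact: farey_spaced.
Qed.

Lemma wt_le1 (g : freq Q) : wt R g <= 1.
Proof.
apply: (@le_trans _ _ (\prod_(p < Q.+1) 1)); last by rewrite big1.
apply: ler_prod => p _; case: ifP => _; rewrite ?ler01 ?lexx// invr_ge0 ler0n /=.
case: (p.-1) => [|k]; first by rewrite invr0.
by rewrite invf_le1// ler1n.
Qed.

Lemma Gsum_le_size : Gsum R 1 Q <= (size lev)%:R.
Proof.
rewrite -cardE -[X in _ <= X]mulr1 mulr_natl -sumr_const /Gsum.
by apply: ler_sum => g _; rewrite expr_le1// ?wt_ge0 ?wt_le1.
Qed.

Lemma ln_le_Gsum : ln Q%:R <= Gsum R 1 Q.
Proof.
apply: (@le_trans _ _ (ln Q.+1%:R)).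
  by rewrite ler_ln ?posrE ?ltr0n// ler_nat.
apply: le_trans (ln_le_harmonic R Q) _.
apply: le_trans (harmonic_le_mertens R 1 Q) _.
rewrite /mertens big_mkcond !big_ord_recl big_ord0 /=.
by rewrite !mul1r.
Qed.

Definition large_prime_ind (p : nat) : R[i] := ((Q < p)%N%:R%:C)%C.

Lemma farey_exp_sum_ge (N : nat) :
  Gsum R 1 Q * (\sum_(p < N.+1 | prime p && (Q < p)%N) 1) ^+ 2 <=
  \sum_(x \in [set` farey]) normc (exp_sum (N%:R : R) large_prime_ind x) ^+ 2.
Proof.
set P : R := \sum_(p < _ | _) 1; set G := Gsum R 1 Q.
have P0 : 0 <= P by apply: sumr_ge0.
rewrite -fsbig_seq ?uniq_farey// /farey big_map big_enum /=.
pose S (g : freq Q) : R[i] := \sum_(p < N.+1 | prime p && (Q < p)%N) e (p%:R * ang R g).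
have SE g : exp_sum (N%:R : R) large_prime_ind (\pi_(circle R) (ang R g)) = S g.
  rewrite /exp_sum natrK /S big_mkcondr /=; apply: eq_bigr => p _.
  by rewrite /large_prime_ind e_pi mulrC [_ * p%:R]mulrC; case: ifP => _; rewrite ?mulr1 ?mulr0.
under eq_bigr do rewrite SE.
have GP : G * P <= \sum_(g | level 1 g) wt R g * normc (S g).
  have -> : G * P = normc (((G * P)%:C)%C).
    by rewrite normc_real ger0_norm// mulr_ge0// Gsum_ge0.
  have -> : ((G * P)%:C)%C = \sum_(g | level 1 g) ((sgnwt R g)%:C)%C * S g.
    under eq_bigr do rewrite mulr_sumr.
    rewrite exchange_big /= /P mulr_sumr rmorph_sum /=.
    apply: eq_bigr => p /andP[pp Qp]; rewrite mulr1 sum_sgnwt_e// => q qQ /andP[pq _].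
    by rewrite dvdn_prime2//; apply: contraTneq Qp => <-; rewrite -leqNgt.
  apply: le_trans (normc_sum _ _ _) _; apply: ler_sum => g _.
  by rewrite Normc.normcM normc_sgnwt.
have [->|Pn] := eqVneq P 0.
  by rewrite expr0n mulr0; apply: sumr_ge0 => g _; exact: sqr_ge0.
have {Pn}P1 : 0 < P by rewrite lt_neqAle eq_sym Pn.
set T := \sum_(g | _) _ ^+ 2.
have : \sum_(g | level 1 g) wt R g * normc (S g) <=
    \sum_(g | level 1 g) (wt R g ^+ 2 * P / 2 + normc (S g) ^+ 2 / P / 2).
  apply: ler_sum => g _; move: (wt R g) (normc (S g)) => x y.
  have -> : x ^+ 2 * P / 2 + y ^+ 2 / P / 2 = x * y + P / 2 * (x - y / P) ^+ 2.
    by field; rewrite gt_eqF.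
  by rewrite lerDl mulr_ge0 ?sqr_ge0// divr_ge0.
rewrite big_split /= -!mulr_suml -/(Gsum R 1 Q) -/G -/T => h.
have {h GP} : G * P <= T / P by move: (le_trans GP h); move: (T / P) (G * P) => a b ?; lra.
by rewrite ler_pdivlMr// expr2 mulrA.
Qed.

End Farey.

Lemma large_prime_count_ge (Q n : nat) :
  primepi R n - Q%:R <= \sum_(p < n.+1 | prime p && (Q < p)%N) 1.
Proof.
rewrite lerBlDr /primepi (bigID (fun p : 'I_n.+1 => Q < p)%N) /= lerD2l.
apply: (@le_trans _ _ (\sum_(q : 'I_Q.+1 | q != ord0) 1)); last by rewrite sumr_const cardC1 card_ord.
apply: (@ler_sum_inj R _ _ _ _ (fun p : 'I_n.+1 => inord p : 'I_Q.+1) (fun=> 1)) => //.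
- move=> p q /andP[_ pQ] /andP[_ qQ] /(congr1 val); rewrite /= !inordK ?ltnS 1?leqNgt//.
  exact: val_inj.
- by move=> p /andP[pp pQ]; rewrite -val_eqE /= inordK ?ltnS 1?leqNgt// -lt0n prime_gt0.
Qed.

Lemma sum_large_prime_ind (Q n : nat) :
  \sum_(p < n.+1 | prime p) normc (large_prime_ind Q p) ^+ 2 =
  \sum_(p < n.+1 | prime p && (Q < p)%N) 1.
Proof.
rewrite [RHS]big_mkcondr; apply: eq_bigr => p _.
by rewrite /large_prime_ind normc_real normr_nat; case: ifP => _; rewrite ?expr1n ?expr0n.
Qed.

Lemma constant_contradiction (L b t : R) : b = (1 - t) / 2 -> 0 < t -> t <= 1 -> 1 < t * L -> 0 <= L ->
  L * (1 - t / 4) <= b * (1 + t / 4) * (1 + 2 * L) -> False.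
Proof.
move=> -> t0 t1 tL L0.
have : 0 <= t ^+ 2 * (1 + 2 * L) by rewrite mulr_ge0 ?sqr_ge0// addr_ge0// mulr_ge0.
lra.
Qed.

Lemma asymptotic_constant_ge_half (c : R) : asymptotic_constant c -> 2^-1 <= c.
Proof.
move=> [err [err0 ineq]]; apply: contrapT => /negP; rewrite -ltNge => c2.
pose b : R := (Num.max c 0 + 1 / 2) / 2; pose t := 1 - 2 * b.
have m0 : 0 <= Num.max c 0 by rewrite le_max lexx orbT.
have mc : c <= Num.max c 0 by rewrite le_max lexx.
have m2 : Num.max c 0 < 1 / 2 by rewrite gt_max; apply/andP; split; lra.
have b0 : 0 < b by rewrite /b; lra.
have bc : 0 < b - c by rewrite /b; lra.
have t0 : 0 < t by rewrite /t /b; lra.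
have t1 : t <= 1 by rewrite /t; lra.
have bt : b = (1 - t) / 2 by rewrite /t; lra.
clearbody t; clearbody b; clear m0 mc m2.
have [[A B] /= [[M [_ hA]] [K1 _ hB]] sub] := cvgr0_norm_lt _ err0 _ bc.
pose Q := (Num.truncn (expR (K1%:R + t^-1))).+2.
have Q1 : (1 < Q)%N by [].
have Q0 : 0 < Q%:R :> R by rewrite ltr0n.
have ti : 0 < t^-1 by rewrite invr_gt0.
have LQ : K1%:R + t^-1 < ln Q%:R.
  rewrite -ltr_expR lnK ?posrE//; apply: lt_le_trans (truncnS_gt _) _.
  by rewrite ler_nat.
clearbody Q; set L := ln Q%:R in LQ.
have L0 : 0 <= L by apply: le_trans (ltW LQ); rewrite addr_ge0// ltW.
have tL : 1 < t * L.
  by rewrite -ltr_pdivrMl// mulr1; apply: le_lt_trans LQ; rewrite lerDr.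
pose W : R := 32 * Q%:R / t.
have W0 : 0 <= W by exact: divr_ge0 (mulr_ge0 (ler0n _ _) (ltW Q0)) (ltW t0).
have [n nn0 hn] := @primepi_lower R (1 - t / 8) (Num.truncn (`|M| + W ^+ 2)).+1
  ltac:(lra) ltac:(lra).
have nW : `|M| + W ^+ 2 < n%:R by apply: lt_le_trans (truncnS_gt _) _; rewrite ler_nat.
have Mn : M < n%:R by apply: le_lt_trans (ler_norm M) _; apply: le_lt_trans nW; rewrite lerDl sqr_ge0.
have Wn : W ^+ 2 < n%:R by apply: le_lt_trans nW; rewrite lerDr.
have QW : 32 * Q%:R <= W by rewrite ler_pdivlMr// ler_piMr// mulr_ge0.
have Q2 : 2 <= Q%:R :> R by rewrite ler_nat.
have W1 : 1 <= W by lra.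
have n1 : 1 < n%:R :> R by apply: le_lt_trans Wn; rewrite exprn_ege1.
have n0 : 0 < n%:R :> R by lra.
have ln0 : 0 < ln n%:R :> R by rewrite ln_gt0.
have Qln : Q%:R * ln n%:R <= t / 8 * n%:R.
  pose y : R := Num.sqrt n%:R.
  have y2 : y ^+ 2 = n%:R by rewrite sqr_sqrtr// ltW.
  have y0 : 0 < y by rewrite sqrtr_gt0.
  have Wy : W <= y by rewrite -(@ler_pXn2r _ 2)// ?nnegrE ?(ltW y0)// y2 ltW.
  have lny : ln n%:R <= 2 * y.
    rewrite -y2 lnXn// -[leLHS]mulr_natl ler_wpM2l//.
    by apply/ltW/ln_sublinear.
  apply: le_trans (ler_wpM2l (ltW Q0) lny) _.
  rewrite -y2; have -> : Q%:R = t / 32 * W :> R by rewrite /W; field; rewrite gt_eqF.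
  have : W * y <= y * y by rewrite ler_pM2r.
  move=> /(ler_wpM2l (ltW t0)) h.
  have h2 : 0 <= t * (y * y) by rewrite !mulr_ge0// ltW.
  lra.
have Q2n : (Q * Q)%:R <= t / 4 * n%:R.
  apply: (@le_trans _ _ (t / 4 * W ^+ 2)); last by rewrite ler_wpM2l ?divr_ge0 ?ltW.
  rewrite natrM /W; have -> : t / 4 * (32 * Q%:R / t) ^+ 2 = 256 * (Q%:R * Q%:R) / t :> R.
    by field; rewrite gt_eqF.
  rewrite ler_pdivlMr// mulrC; apply: ler_pM; rewrite ?mulr_ge0 ?(ltW t0)//; lra.
pose P : R := \sum_(p < n.+1 | prime p && (Q < p)%N) 1.
have Pln : (1 - t / 4) * n%:R <= P * ln n%:R.
  have : (primepi R n - Q%:R) * ln n%:R <= P * ln n%:R.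
    by rewrite ler_wpM2r ?(ltW ln0)// large_prime_count_ge.
  by rewrite [(_ - Q%:R) * _]mulrBl => h; lra.
have P0 : 0 < P.
  rewrite -(pmulr_lgt0 _ ln0); apply: lt_le_trans Pln; rewrite mulr_gt0//; lra.
set X := [set` farey Q]; pose K := size (enum (@level 1 Q)).
have KX : #|` fset_set X| = K by exact: card_farey.
have GK := Gsum_le_size Q; rewrite -/K in GK.
have LG := ln_le_Gsum Q1; rewrite -/L in LG.
have K1K : (K1 <= K)%N.
  rewrite -(ler_nat R); apply: le_trans (le_trans LG GK).
  by apply: le_trans (ltW LQ); rewrite lerDl ltW.
have X0 : X !=set0.
  exists (\pi_(circle R) (ang R (freq0 Q))); apply/mapP; exists (freq0 Q) => //.
  by rewrite mem_enum; exact: level_freq0 (ltnW Q1).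
have QQ0 : 0 < (Q * Q)%:R^-1 :> R by rewrite invr_gt0 ltr0n muln_gt0 ltnW.
have := ineq _ _ n%:R (large_prime_ind Q) QQ0 (well_spaced_farey Q1) X0 (ltW n1).
rewrite /prime_large_sieve -/X KX natrK sum_large_prime_ind -/P invrK => up.
have := le_trans (farey_exp_sum_ge Q n) up; rewrite -/P => {}up.
have ob : c + err n%:R K <= b.
  have : `|err n%:R K| < b - c by apply: (sub (n%:R, K)); split; [exact: hA|exact: hB].
  by move=> h; have := ler_norm (err n%:R K); lra.
have K0 : (0 < K)%N.
  rewrite -(ltr_nat R); apply: lt_le_trans (le_trans LG GK); apply: lt_trans LQ.
  exact: ltr_wpDl (ler0n _ _) ti.
have lK : ln (2 * K%:R) <= 1 + 2 * L.
  have : ln (2 * K%:R) <= ln (2 * (Q%:R * Q%:R)) :> R.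
    have K0' : 0 < K%:R :> R by rewrite ltr0n.
    rewrite ler_ln ?posrE ?mulr_gt0// ler_pM2l// -natrM ler_nat.
    exact: size_level_le.
  rewrite [ln (2 * (_ * _))]lnM ?posrE ?mulr_gt0// [ln (Q%:R * _)]lnM ?posrE// -/L => h.
  by have := ln2_le R; lra.
have lK0 : 0 <= ln (2 * K%:R) :> R.
  by rewrite ln_ge0// -natrM ler1n muln_gt0.
apply: (constant_contradiction bt t0 t1 tL L0).
have D0 : 0 <= (n%:R + (Q * Q)%:R) / ln n%:R :> R by rewrite divr_ge0 ?addr_ge0// ltW.
have key : Gsum R 1 Q * P <= b * ((n%:R + (Q * Q)%:R) / ln n%:R) * (1 + 2 * L).
  rewrite -(ler_pM2r P0) -[Gsum R 1 Q * P * P]mulrA -expr2; apply: le_trans up _.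
  rewrite ler_pM2r//; apply: (@le_trans _ _ (b * ((n%:R + (Q * Q)%:R) / ln n%:R) * ln (2 * K%:R))).
    by do 2!rewrite ler_wpM2r//.
  by rewrite ler_wpM2l// mulr_ge0// ltW.
have h1 : L * ((1 - t / 4) * n%:R) <= Gsum R 1 Q * (P * ln n%:R).
  by apply: ler_pM => //; rewrite mulr_ge0 ?(ltW n0)//; lra.
have h2 : Gsum R 1 Q * (P * ln n%:R) <= b * (n%:R + (Q * Q)%:R) * (1 + 2 * L).
  rewrite mulrA -ler_pdivlMr//; apply: le_trans key _.
  by rewrite le_eqVlt; apply/orP; left; apply/eqP; ring.
rewrite -(ler_pM2r n0) -[L * _ * _]mulrA; apply: le_trans h1 (le_trans h2 _).
rewrite [leRHS]mulrAC ler_wpM2r//; first by rewrite addr_ge0// mulr_ge0.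
by rewrite -mulrA ler_wpM2l ?(ltW b0)//; lra.
Qed.

End LowerBound.

Unset Implicit Arguments.

Theorem theorem5 (R : realType) :
  asymptotic_constant (4 * expR (euler_gamma R))
  /\ (forall (delta : R) (X : set (circle R)) (N : R) (u : nat -> R[i]),
        0 < delta -> well_spaced delta X -> X !=set0 -> 10 ^+ 4 <= N ->
        prime_large_sieve 19 delta X N u)
  /\ (forall c : R, asymptotic_constant c -> 2^-1 <= c).
Proof.
split; first exact: asymptotic_constant_gamma.
split; first exact: prime_large_sieve_nineteen.
exact: asymptotic_constant_ge_half.
Qed.
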